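(* Let $(M,\mathcal T,\varepsilon,\eta)$ be a weighted triangulated connected closed surface with weights $\varepsilon\equiv1$ and $\eta:E\to(-1,1]$ satisfying the structure condition. (a) In the Euclidean background geometry, if there exists a discrete conformal structure $\overline u\in\mathbb R^N$ with combinatorial curvature $\overline K$, then for any $s\in\mathbb R$ and any initial value $u(0)\in\mathbb R^N$ with $\sum_{i\in V}u_i(0)=\sum_{i\in V}\overline u_i$, the solution of the fractional combinatorial Calabi flow $\frac{du_i}{dt}=\Delta^s(K-\overline K)_i$, $i\in V$, exists for all time $t\ge0$ and converges exponentially fast to $\overline u$. (b) In the hyperbolic background geometry, if there exists a discrete conformal structure $\overline u\in\mathbb R^N_{<0}$ with combinatorial curvature $\overline K$, then for any $s\in\mathbb R$ and any initial value $u(0)\in\mathbb R^N_{<0}$, the solution of the fractional combinatorial Calabi flow $\frac{du_i}{dt}=\Delta^s(K-\overline K)_i$, $i\in V$, exists for all time $t\ge0$ and converges exponentially fast to $\overline u$. Here exponential convergence means $\|u(t)-\overline u\|\le Ce^{-ct}$ for all $t\ge0$ and some constants $C,c>0$.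
   Context: $\mathcal T=\{V,E,F\}$ is a triangulation of the connected closed surface $M$ with vertex set $V$, edge set $E$ and face set $F$; $N=|V|$; vertices, edges and faces are denoted $i$, $\{ij\}$, $\triangle ijk$. $\mathbb R^N_{<0}=(-\infty,0)^N$. Structure condition (for $\varepsilon\equiv1$): $1+\eta_{pq}>0$ for every edge $\{pq\}\in E$, and $\eta_{qr}+\eta_{pq}\eta_{pr}\ge 0$ for every face $\triangle pqr\in F$ and every labelling $p,q,r$ of its vertices. Discrete conformal structures (with $\varepsilon\equiv1$): in the Euclidean background geometry, $u\in\mathbb R^N$ determines the edge lengths $l_{ij}=\sqrt{e^{2u_i}+e^{2u_j}+2\eta_{ij}e^{u_i+u_j}}$. In the hyperbolic background geometry, $u\in\mathbb R^N_{<0}$ determines $r\in(0,+\infty)^N$ through $u_i=\log\tanh\frac{r_i}{2}$, and the edge lengths $l_{ij}>0$ through $\cosh l_{ij}=\cosh r_i\cosh r_j+\eta_{ij}\sinh r_i\sinh r_j$. If $\eta_{pq}\in(-1,1]$ for every edge $\{pq\}\in E$ and $\eta_{qr}+\eta_{pq}\eta_{pr}\ge 0$ for every face $\triangle pqr\in F$ and every labelling $p,q,r$ of its vertices, it is known that the strict triangle inequalities hold for every face for all $u\in\mathbb R^N$ (Euclidean), resp. all $u\in\mathbb R^N_{<0}$ (hyperbolic), so each face is realized as a Euclidean (resp. hyperbolic) triangle. Combinatorial curvature: $K_i=2\pi-\sum_{\triangle ijk\in F}\theta_i^{jk}$, where $\theta_i^{jk}$ is the inner angle at $i$ in $\triangle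 ijk$ and the sum is over the faces at $i$. Let $L=\left(\frac{\partial K_i}{\partial u_j}\right)_{i,j\in V}$, which is known to be symmetric positive semi-definite under the structure condition. Write $L=P^T\mathrm{diag}\{\lambda_1,\dots,\lambda_N\}P$ with $P\in O(N)$ and $\lambda_i\ge0$. For $s\in\mathbb R$, $L^s=P^T\mathrm{diag}\{\lambda_1^s,\dots,\lambda_N^s\}P$ with the convention $0^s=0$ for every $s\in\mathbb R$, and $\Delta^s=-L^s$. In the flow, $K$ and $\Delta^s$ are evaluated at $u(t)$ and $\overline K$ is fixed. *)

(* Defs.v *)
From HB Require Import structures.
From mathcomp Require Import all_boot all_order all_algebra.
From mathcomp Require Import all_classical all_reals all_analysis.
From mathcomp Require Import ring lra.

Set Implicit Arguments.
Unset Strict Implicit.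
Unset Printing Implicit Defensive.

Import Order.TTheory GRing.Theory Num.Theory.
Import numFieldNormedType.Exports.

Local Open Scope ring_scope.

(* A triangulated connected closed surface, as a finite abstract simplicial
   complex on the vertex set 'I_N: the space is a closed surface because the
   link of every vertex is a simple cycle, traversed here by the sequence [c].
   In particular every edge lies in exactly two faces. *)
Record triangulation (N : nat) := Triangulation {
  edges : {set {set 'I_N}};
  faces : {set {set 'I_N}};
  card_edge : forall e, e \in edges -> #|e| = 2%N;
  card_face : forall f, f \in faces -> #|f| = 3%N;
  face_edge : forall (f e : {set 'I_N}),
    f \in faces -> e \subset f -> #|e| = 2%N -> e \in edges;
  link_cycle : forall i, exists c : seq 'I_N,
    [/\ uniq c, (2 < size c)%N,
        forall j, ([set i; j] \in edges) = (j \in c)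
      & forall j k, ([set i; j; k] \in faces) =
          (j \in c) && ((k == next c j) || (k == prev c j))];
  nonempty : (0 < N)%N;
  connected_skeleton :
    forall i j, connect (fun p q : 'I_N => [set p; q] \in edges) i j
}.

(* Weights are functions of unordered pairs, used on edges only. *)
Definition structure_condition (R : realType) (N : nat) (T : triangulation N)
    (eta : {set 'I_N} -> R) :=
  (forall p q, [set p; q] \in edges T -> 0 < 1 + eta [set p; q]) /\
  (forall p q r, [set p; q; r] \in faces T ->
     0 <= eta [set q; r] + eta [set p; q] * eta [set p; r]).

Local Open Scope classical_set_scope.

Section Hyperbolic.
Variable R : realType.
Implicit Types x r l : R.

Definition cosh x : R := (expR x + expR (- x)) / 2.
Definition sinh x : R := (expR x - expR (- x)) / 2.
Definition tanh x : R := sinh x / cosh x.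

Definition hyp_radius x : R := xget 0 [set r | 0 < r /\ x = ln (tanh (r / 2))].

Definition arcosh x : R := xget 0 [set l | 0 < l /\ cosh l = x].

Lemma tanh_half r : 0 < r -> tanh (r / 2) = (expR r - 1) / (expR r + 1).
Proof.
move=> r0; rewrite /tanh /sinh /cosh.
have -> : expR r = expR (r / 2) * expR (r / 2).
  by rewrite -expRD; congr expR; field.
rewrite expRN; have := expR_gt0 (r / 2); move: (expR _) => y y0.
by field; rewrite ?gt_eqF //; nra.
Qed.

Lemma hyp_radiusE x : x < 0 -> hyp_radius x = ln ((1 + expR x) / (1 - expR x)).
Proof.
move=> x0; have y0 := expR_gt0 x; have y1 : expR x < 1 by rewrite expR_lt1.
have d0 : 0 < 1 - expR x by lra.
have q1 : 1 < (1 + expR x) / (1 - expR x) by rewrite ltr_pdivlMr //; lra.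
apply: xget_unique => /=.
  split; first exact: ln_gt0.
  rewrite tanh_half ?ln_gt0 // lnK ?posrE; last by lra.
  rewrite -[LHS]expRK; congr ln.
  by field; rewrite ?gt_eqF //; lra.
move=> r [r0 xE]; rewrite -[LHS]expRK; congr ln.
have e1 : 1 < expR r by rewrite expR_gt1.
rewrite xE lnK ?posrE tanh_half ?divr_gt0 //; [|lra..].
by field; rewrite ?gt_eqF //; lra.
Qed.

Lemma arcoshE x : 1 < x -> arcosh x = ln (x + Num.sqrt (x ^+ 2 - 1)).
Proof.
move=> x1; set w := Num.sqrt _.
have w0 : 0 <= w by exact: sqrtr_ge0.
have w2 : w ^+ 2 = x ^+ 2 - 1 by rewrite sqr_sqrtr //; nra.
apply: xget_unique => /=.
  split; first by apply: ln_gt0; lra.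
  rewrite /cosh expRN lnK ?posrE; last by lra.
  have -> : (x + w)^-1 = x - w.
    have xw : x + w != 0 by rewrite gt_eqF //; lra.
    by apply: (mulfI xw); rewrite mulfV //; lra.
  by lra.
move=> l [l0]; rewrite /cosh expRN => lE.
rewrite -[LHS]expRK; congr ln.
have e1 : 1 < expR l by rewrite expR_gt1.
move: lE e1; move: (expR l) => y lE e1.
have yx : y ^+ 2 + 1 = 2 * x * y by rewrite -lE; field; rewrite gt_eqF //; lra.
have h : (y - x) ^+ 2 = w ^+ 2 by rewrite w2; lra.
have yx0 : 0 <= y - x by nra.
have : y - x = w by apply: (@pexpIrn _ 2%N) => //; rewrite qualifE.
by lra.
Qed.

End Hyperbolic.

Section Geometry.
Variables (R : realType) (N : nat) (T : triangulation N).
Variable eta : {set 'I_N} -> R.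
Implicit Types (u : 'cV[R]_N) (i j k : 'I_N).

(* The inner angle at the vertex between the sides [a] and [b], opposite to
   the side [c], given by the law of cosines. *)
Definition eucl_angle (a b c : R) : R :=
  acos ((a ^+ 2 + b ^+ 2 - c ^+ 2) / (2 * a * b)).

Definition hyp_angle (a b c : R) : R :=
  acos ((cosh a * cosh b - cosh c) / (sinh a * sinh b)).

Definition eucl_length u i j : R :=
  Num.sqrt (expR (2 * u i 0) + expR (2 * u j 0)
            + 2 * eta [set i; j]%SET * expR (u i 0 + u j 0)).

Definition hyp_length u i j : R :=
  let r := fun k => hyp_radius (u k 0) in
  arcosh (cosh (r i) * cosh (r j)
          + eta [set i; j]%SET * sinh (r i) * sinh (r j)).

(* Each face at [i] is counted once, through its ordered pair [j < k] of
   remaining vertices. *)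
Definition curvature (angle : R -> R -> R -> R) (l : 'I_N -> 'I_N -> R)
    : 'cV[R]_N :=
  \col_i (2 * pi - \sum_(j < N) \sum_(k < N | (j < k)%N &&
                       ([set i; j; k]%SET \in faces T))
                     angle (l i j) (l i k) (l j k)).

Definition eucl_curvature u := curvature eucl_angle (eucl_length u).
Definition hyp_curvature u := curvature hyp_angle (hyp_length u).

Definition hyp_domain : set 'cV[R]_N := [set u | forall i, u i 0 < 0].

End Geometry.

Section SpectralPower.
Variables (R : realType) (N : nat).
Implicit Types (A B P : 'M[R]_N) (lam : 'rV[R]_N) (s x : R).

(* The convention 0^s = 0 also covers s = 0, unlike [powR]. *)
Definition power0 s x : R := if x == 0 then 0 else x `^ s.

Definition is_spectral_power s A B :=
  exists P lam, [/\ P^T *m P = 1%:M, forall i, 0 <= lam 0 i,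
    A = P^T *m diag_mx lam *m P
    & B = P^T *m diag_mx (map_mx (power0 s) lam) *m P].

Definition spectral_power s A : 'M[R]_N := xget 0 (is_spectral_power s A).

Lemma is_spectral_power_unique s A B C :
  is_spectral_power s A B -> is_spectral_power s A C -> B = C.
Proof.
move=> [P [d [PP _ AP ->]]] [Q [m [QQ _ AQ ->]]].
have PP' := mulmx1C PP; have QQ' := mulmx1C QQ.
set W := Q *m P^T.
have WE : W *m diag_mx d = diag_mx m *m W.
  have : Q *m A *m P^T = Q *m A *m P^T by [].
  rewrite {1}AP AQ !mulmxA QQ' mul1mx -!mulmxA PP' mulmx1 !mulmxA.
  by rewrite -/W -(mulmxA _ Q) -/W => ->.
have WF : W *m diag_mx (map_mx (power0 s) d) =
          diag_mx (map_mx (power0 s) m) *m W.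
  apply/matrixP => i j; move/matrixP/(_ i j): WE.
  rewrite !mul_mx_diag !mul_diag_mx !mxE => h.
  have [->|W0] := eqVneq (\sum_j0 Q i j0 * P^T j0 j) 0.
    by rewrite mul0r mulr0.
  by rewrite mulrC; congr (power0 s _ * _); apply: (mulIf W0); rewrite mulrC.
have -> : P^T *m diag_mx (map_mx (power0 s) d) *m P =
    Q^T *m (W *m diag_mx (map_mx (power0 s) d)) *m P.
  by rewrite /W !mulmxA QQ mul1mx.
by rewrite WF /W -!mulmxA PP mulmx1.
Qed.

Lemma spectral_powerE s A B : is_spectral_power s A B -> spectral_power s A = B.
Proof.
by move=> AB; apply: xget_unique => // C; move/is_spectral_power_unique; apply.
Qed.

End SpectralPower.

Section Flow.
Variables (R : realType) (N : nat).
Variable K : 'cV[R]_N -> 'cV[R]_N.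
Implicit Types (u : 'cV[R]_N) (s : R).

Definition curvature_jacobian u : 'M[R]_N :=
  \matrix_(i, j) 'D_(delta_mx j 0) (fun v => K v i 0) u.

Definition frac_laplacian s u : 'M[R]_N :=
  - spectral_power s (curvature_jacobian u).

(* [u] solves the flow on the time interval [I] within the domain [D]; at an
   endpoint of [I] the time derivative is one-sided. *)
Definition calabi_flow (D : set 'cV[R]_N) s (Kbar u0 : 'cV[R]_N)
    (I : set R) (u : R -> 'cV[R]_N) :=
  u 0 = u0 /\
  forall t, I t -> D (u t) /\
    forall i, (t' - t)^-1 * (u t' i 0 - u t i 0) @[t' --> within I t^'] -->
              (frac_laplacian s (u t) *m (K (u t) - Kbar)) i 0.

End Flow.

(* Main.v *)
Require Import Defs.
From HB Require Import structures.
From mathcomp Require Import all_boot all_order all_algebra.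
From mathcomp Require Import all_classical all_reals all_analysis.
From mathcomp Require Import complex ring lra.

Set Implicit Arguments.
Unset Strict Implicit.
Unset Printing Implicit Defensive.

Import Order.TTheory GRing.Theory Num.Theory.
Import numFieldNormedType.Exports.

Local Open Scope classical_set_scope.
Local Open Scope ring_scope.

(* The Ricci potential W(u) = int_0^1 (K - Kbar)(ubar + t (u - ubar)) . (u - ubar) dt
   is convex and proper, its gradient is K - Kbar, and along the flow
   dW/dt = - (K - Kbar) . L^s (K - Kbar).  As W decreases, the flow stays in a
   box on which the nonzero eigenvalues of L are bounded away from zero, whence
   dW/dt <= - c W and exponential convergence.  On such a box L^s is Lipschitz in
   u, so Picard iteration, applied to the field composed with the coordinatewise
   projection onto a box, gives the solution as long as it stays in that box.

   W does not control the hyperbolic boundary u_i = 0.  There the angles at i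
   tend to 0, so K_i > Kbar_i, while the off-diagonal entries of the i-th row of
   L, and hence of L^s, are O(|u_i|): the diagonal term dominates and u_i
   decreases. *)

(** For negative s the power x^s is unbounded near 0 while 0^s = 0, so L^s jumps where the rank of L
    changes. What saves the argument is that the kernel of L never moves: it is spanned by the
    constant vector in the Euclidean case and is trivial in the hyperbolic one. On a box the
    spectrum therefore lies in the union of {0} and an interval away from 0; on such a set every
    power is Lipschitz and bounded below by a positive multiple of x.

    The spectral gap may shrink as the box grows, so the box has to be fixed before the flow is run.
    The radius of the sublevel set of W is computed only from the gap on a small neighbourhood of
    [ubar]; convexity carries the growth obtained there to all distances.

    At the hyperbolic boundary the edge lengths blow up, but the entries of L, written with cosh u
    and sinh u, extend to u_i = 0 with denominators bounded below. All constants are thus uniform up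
    to the boundary, which allows the distance of the box to the boundary to be chosen last. *)

Lemma sum_ord_le (R : numDomainType) n (f : 'I_n -> R) (M : R) :
  (forall i, f i <= M) -> \sum_i f i <= n%:R * M.
Proof.
move=> fM; rewrite mulr_natl -[n in M *+ n]card_ord -sumr_const.
exact: ler_sum.
Qed.

(** * The dot product against the maximum norm *)

Section DotProduct.
Variables (R : realType) (n : nat).
Implicit Types (x y z : 'cV[R]_n) (A : 'M[R]_n).

Definition dotv x y : R := (x^T *m y) 0 0.

Lemma dotvE x y : dotv x y = \sum_i x i 0 * y i 0.
Proof. by rewrite /dotv mxE; apply: eq_bigr => i _; rewrite mxE. Qed.

Lemma dotvC x y : dotv x y = dotv y x.
Proof. by rewrite !dotvE; apply: eq_bigr => i _; rewrite mulrC. Qed.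

Lemma dotvDr x y z : dotv x (y + z) = dotv x y + dotv x z.
Proof. by rewrite /dotv mulmxDr mxE. Qed.

Lemma dotvZr a x y : dotv x (a *: y) = a * dotv x y.
Proof. by rewrite /dotv -scalemxAr mxE. Qed.

Lemma dotvNr x y : dotv x (- y) = - dotv x y.
Proof. by rewrite -scaleN1r dotvZr mulN1r. Qed.

Lemma dotvBr x y z : dotv x (y - z) = dotv x y - dotv x z.
Proof. by rewrite dotvDr dotvNr. Qed.

Lemma dotvDl x y z : dotv (x + y) z = dotv x z + dotv y z.
Proof. by rewrite ![dotv _ z]dotvC dotvDr. Qed.

Lemma dotvZl a x y : dotv (a *: x) y = a * dotv x y.
Proof. by rewrite ![dotv _ y]dotvC dotvZr. Qed.

Lemma dotvBl x y z : dotv (x - y) z = dotv x z - dotv y z.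
Proof. by rewrite ![dotv _ z]dotvC dotvBr. Qed.

Lemma dotv_mulmxl A x y : dotv (A *m x) y = dotv x (A^T *m y).
Proof. by rewrite /dotv trmx_mul mulmxA. Qed.

Lemma dotv_ge0 x : 0 <= dotv x x.
Proof. by rewrite dotvE sumr_ge0 // => i _; rewrite -expr2 sqr_ge0. Qed.

Lemma dotv_eq0 x : dotv x x = 0 -> x = 0.
Proof.
rewrite dotvE => /eqP; rewrite psumr_eq0; last first.
  by move=> i _; rewrite -expr2 sqr_ge0.
move=> /allP h; apply/colP => i; rewrite mxE.
have /eqP := h i (mem_index_enum _).
by move/eqP; rewrite /= mulf_eq0 orbb => /eqP.
Qed.

Lemma dotv_gt0 x : x != 0 -> 0 < dotv x x.
Proof.
move=> x0; rewrite lt_neqAle dotv_ge0 andbT eq_sym.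
by apply: contra_neq x0; exact: dotv_eq0.
Qed.

Lemma norm_coord x i : `|x i 0| <= `|x|.
Proof.
rewrite [leRHS]/Num.Def.normr /= mx_normrE.
by apply/bigmax_geP; right => /=; exists (i, 0).
Qed.

Lemma norm_leP x (e : R) : 0 <= e ->
  (forall i, `|x i 0| <= e) -> `|x| <= e.
Proof.
move=> e0 h; rewrite [leLHS]/Num.Def.normr /= mx_normrE.
by apply/bigmax_leP; split => // -[i j] _ /=; rewrite ord1.
Qed.

(** The matrix norm is the maximum of the entries, so its square is one term of the sum of
    squares. *)
Lemma norm_dotv_le x : `|x| ^+ 2 <= dotv x x.
Proof.
rewrite -[leRHS]sqr_sqrtr ?dotv_ge0 // lerXn2r ?qualifE ?normr_ge0 ?sqrtr_ge0 //=.
apply: norm_leP => [|i]; first exact: sqrtr_ge0.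
rewrite -sqrtr_sqr ler_sqrt ?dotv_ge0 // dotvE (bigD1 i) //= -expr2 lerDl.
by apply: sumr_ge0 => j _; rewrite -expr2 sqr_ge0.
Qed.

Lemma dotv_bound x y : `|dotv x y| <= n%:R * (`|x| * `|y|).
Proof.
rewrite dotvE (le_trans (ler_norm_sum _ _ _)) //.
apply: sum_ord_le => i; rewrite normrM.
by apply: ler_pM; rewrite ?normr_ge0 ?norm_coord.
Qed.

Lemma mulmx_bound A x (M : R) : (forall i j, `|A i j| <= M) ->
  `|A *m x| <= n%:R * (M * `|x|).
Proof.
move=> AM; have Ai i : `|(A *m x) i 0| <= n%:R * (M * `|x|).
  rewrite mxE (le_trans (ler_norm_sum _ _ _)) //.
  apply: sum_ord_le => j; rewrite normrM.
  by apply: ler_pM; rewrite ?normr_ge0 ?AM ?norm_coord.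
(* [M] carries no sign hypothesis: the bound is nonnegative because it dominates some coordinate, or
   because n = 0. *)
apply: norm_leP => //; case: (pickP 'I_n) => [i _|n0].
  exact: le_trans (Ai i).
suff /eqP -> : n%:R == 0 :> R by rewrite mul0r.
rewrite pnatr_eq0 -leqn0 leqNgt; apply/negP => h.
by have := n0 (Ordinal h).
Qed.

End DotProduct.

(** * Fractional powers of symmetric matrices *)

Section SpectralTheorem.
Variable R : realType.

(** Over the complex numbers, diagonalization of Hermitian matrices yields a real eigenvalue. It is
    a root of the characteristic polynomial, whose coefficients are real, so it already has a real
    eigenvector. *)
Lemma symmetric_eigenvector n (A : 'M[R]_n.+1) : A^T = A ->
  exists a (v : 'cV[R]_n.+1), v != 0 /\ A *m v = a *: v.
Proof.
move=> symA; pose Ac := map_mx (real_complex R) A.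
have Ah : Ac \is hermsymmx.
  apply: realsym_hermsym.
    apply/is_hermitianmxP; rewrite expr0 scale1r map_mx_id //.
    by rewrite /Ac map_trmx symA.
  apply/mxOverP => i j; rewrite mxE; apply/complex_realP; by exists (A i j).
have /hermitian_normalmx /orthomx_spectralP AE := Ah.
have /mxOverP/(_ 0 0)/complex_realP[a aE] := hermitian_spectral_diag_real Ah.
have Ac_eig : eigenvalue Ac (a%:C)%C.
  apply/eigenvalueP; exists (row 0 (spectralmx Ac)).
    have PA := congr1 (mulmx (spectralmx Ac)) AE.
    rewrite !mulmxA mulmxV ?spectral_unit // mul1mx in PA.
    by rewrite -row_mul PA row_mul row_diag_mx -scalemxAl -rowE aE.
  apply/negP => /eqP h; have := spectral_unit Ac.
  rewrite -row_free_unit => /row_freeP[B] /(congr1 (row 0)).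
  rewrite row_mul h mul0mx => /rowP/(_ 0); rewrite !mxE eqxx => /esym/eqP.
  by rewrite oner_eq0.
have : eigenvalue A a.
  move: Ac_eig; rewrite !eigenvalue_root_char /Ac.
  by rewrite -map_char_poly fmorph_root.
move=> /eigenvalueP[w wA w0]; exists a, w^T; split.
  by rewrite -trmx0 (inj_eq trmx_inj).
by rewrite -[in LHS]symA -trmx_mul wA linearZ.
Qed.

(* A Householder reflection. *)
Lemma orthogonal_first_column n (v : 'cV[R]_n.+1) : v != 0 ->
  exists H : 'M[R]_n.+1, H^T *m H = 1%:M /\
    exists c, H *m delta_mx 0 0 = c *: v.
Proof.
move=> v0; have vv := dotv_gt0 v0.
pose e : 'cV[R]_n.+1 := delta_mx 0 0.
pose c := (Num.sqrt (dotv v v))^-1.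
pose x := c *: v.
have xx : dotv x x = 1.
  rewrite /x dotvZl dotvZr mulrA -expr2 exprVn sqr_sqrtr ?ltW //.
  by rewrite mulVf // gt_eqF.
have ee : dotv e e = 1.
  rewrite dotvE (bigD1 0) //= big1 ?addr0 => [|i /negPf i0].
    by rewrite !mxE !eqxx mul1r.
  by rewrite !mxE i0 mul0r.
have [xe|xe] := eqVneq x e.
  by exists 1%:M; rewrite trmx1 mul1mx; split => //; exists c; rewrite mul1mx.
pose w := x - e.
have w0 : 0 < dotv w w by apply: dotv_gt0; rewrite subr_eq0.
have ww : dotv w w = 2 - 2 * dotv x e.
  by rewrite !(dotvBl, dotvBr) xx ee (dotvC e x); ring.
have we : dotv w e = - (dotv w w / 2).
  by rewrite ww dotvBl ee; field.
have wTw : w^T *m w = (dotv w w)%:M by rewrite [LHS]mx11_scalar.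
have wTe : w^T *m e = (dotv w e)%:M by rewrite [LHS]mx11_scalar.
pose W := w *m w^T.
have WW : W *m W = dotv w w *: W.
  rewrite /W -mulmxA (mulmxA w^T) wTw mul_scalar_mx.
  by rewrite -scalemxAr.
have WT : W^T = W by rewrite /W trmx_mul trmxK.
pose k := 2 / dotv w w.
have kw : k * dotv w w = 2 by rewrite /k divfK // gt_eqF.
exists (1%:M - k *: W); split.
  have -> : (1%:M - k *: W)^T = 1%:M - k *: W.
    by apply/matrixP => i j; rewrite -[in RHS]WT !mxE eq_sym.
  rewrite mulmxBl mul1mx mulmxBr mulmx1.
  rewrite -scalemxAl -scalemxAr WW !scalerA -mulrA kw.
  rewrite (_ : k * 2 = k + k); last by rewrite mulr_natr.
  by rewrite scalerDl opprB addrC addrK addrC subrK.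
exists c; rewrite mulmxBl mul1mx -scalemxAl -mulmxA wTe -/e -/x.
rewrite mul_mx_scalar scalerA we mulrN mulrA kw divff ?pnatr_eq0 //.
by rewrite scaleN1r opprK addrC subrK.
Qed.

(** Deflation: conjugation by a reflection taking the first basis vector to the line of an
    eigenvector makes the first column a multiple of that basis vector, symmetry clears the first
    row, and the induction hypothesis applies to the remaining block. *)
Lemma symmetric_spectral n (A : 'M[R]_n) : A^T = A ->
  exists (P : 'M[R]_n) lam, P^T *m P = 1%:M /\ A = P^T *m diag_mx lam *m P.
Proof.
elim: n A => [|n IH] A symA.
  by exists 1%:M, 0; split; apply/matrixP => -[].
have [a [v [v0 Av]]] := symmetric_eigenvector symA.
have [H [HH [c Hc]]] := orthogonal_first_column v0.
have HH' := mulmx1C HH.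
set e := delta_mx 0 0 in Hc.
have [B defB] : exists B, B = H^T *m A *m H by exists (H^T *m A *m H).
have symB : B^T = B by rewrite defB !trmx_mul trmxK symA mulmxA.
have Be : B *m e = a *: e.
  rewrite defB -!mulmxA Hc -scalemxAr Av -!scalemxAr scalerA mulrC -scalerA.
  by rewrite scalemxAr -Hc mulmxA HH mul1mx.
have B0 i : B i 0 = a * (i == 0)%:R.
  have -> : B i 0 = (B *m e) i 0 by rewrite -colE mxE.
  by rewrite Be !mxE eqxx andbT.
pose A' := @drsubmx _ 1 n 1 n B.
have symA' : A'^T = A' by rewrite /A' trmx_drsub symB.
have [Q [lam [QQ A'E]]] := IH A' symA'.
have blockB : B = block_mx (n1 := 1) a%:M 0 0 A'.
  rewrite -[LHS](@submxK _ 1 n 1 n); congr (@block_mx _ 1 n 1 n _ _ _ _).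
  - apply/matrixP => i j; rewrite !ord1 !mxE eqxx mulr1n lshift0.
    by rewrite B0 eqxx mulr1.
  - rewrite -[LHS]trmxK trmx_ursub symB; apply/matrixP => i j.
    by rewrite !ord1 !mxE lshift0 B0 mulr0.
  - by apply/matrixP => i j; rewrite !ord1 !mxE lshift0 B0 mulr0.
pose P0 : 'M[R]_(1 + n) := block_mx 1%:M 0 0 Q.
have P0T : P0^T = block_mx 1%:M 0 0 Q^T.
  by rewrite /P0 tr_block_mx !trmx0 tr_scalar_mx.
have P0P : P0^T *m P0 = 1%:M.
  rewrite P0T mulmx_block.
  by rewrite !(mul0mx, mulmx0, addr0, add0r, mul1mx) QQ -scalar_mx_block.
have P0B : P0^T *m diag_mx (row_mx a%:M lam) *m P0 = B.
  rewrite P0T diag_mx_row !mulmx_block.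
  rewrite !(mul0mx, mulmx0, addr0, add0r, mul1mx, mulmx1) -A'E blockB.
  by congr block_mx; apply/matrixP => i j; rewrite !ord1 !mxE.
exists (P0 *m H^T), (row_mx a%:M lam); rewrite trmx_mul trmxK; split.
  by rewrite -mulmxA (mulmxA _ P0) P0P mul1mx.
transitivity (H *m B *m H^T).
  by rewrite defB !mulmxA HH' mul1mx -mulmxA HH' mulmx1.
by rewrite -P0B !mulmxA.
Qed.

End SpectralTheorem.

Lemma lipschitz_of_derive (R : realType) (f df : R -> R) (a b M : R) :
  (forall x, a <= x <= b -> is_derive x 1 f (df x)) ->
  (forall x, a <= x <= b -> `|df x| <= M) ->
  forall x y, a <= x <= b -> a <= y <= b -> `|f x - f y| <= M * `|x - y|.
Proof.
move=> fdf dfM x y; wlog yx : x y / y <= x => [hw xab yab|].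
  have [yx|/ltW xy] := leP y x; first exact: hw.
  by rewrite distrC (distrC x); exact: hw.
move=> /andP[ax xb] /andP[ay yb].
have sub t : t \in `[y, x] -> a <= t <= b.
  by rewrite in_itv /= => /andP[yt tx]; rewrite (le_trans ay) ?(le_trans tx).
have [t tyx ->] : exists2 t, t \in `[y, x] & f x - f y = df t * (x - y).
  apply: MVT_segment => // [t tyx|].
    by apply/fdf/sub; move: tyx; rewrite !in_itv /= => /andP[/ltW-> /ltW->].
  apply: derivable_within_continuous => t tyx.
  by have [] := fdf t (sub _ tyx).
by rewrite normrM ler_wpM2r // dfM // sub.
Qed.

Section PowerEstimates.
Variables (R : realType) (lo up s : R).
Hypothesis lo0 : 0 < lo.

(** Bounds both x^r and its inverse on [[lo], [up]] whatever the sign of [r], as |ln x| <= |ln lo| +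
    |ln up| there. *)
Let B (r : R) : R := expR (`|r| * (`|ln lo| + `|ln up|)).

Let powR_bounds r x : lo <= x <= up -> (B r)^-1 <= x `^ r <= B r.
Proof.
move=> /andP[lx xu]; have x0 := lt_le_trans lo0 lx.
have h : `|r * ln x| <= `|r| * (`|ln lo| + `|ln up|).
  rewrite normrM ler_wpM2l //.
  have l1 : ln lo <= ln x by rewrite ler_ln ?posrE.
  have l2 : ln x <= ln up by rewrite ler_ln ?posrE // (lt_le_trans x0).
  have := ler_norm (ln up); have := ler_norm (- ln lo); rewrite normrN.
  have := normr_ge0 (ln lo); have := normr_ge0 (ln up).
  by rewrite ler_norml; lra.
rewrite /powR gt_eqF // /B -expRN !ler_expR.
by move: h; rewrite ler_norml.
Qed.

(** The gap between 0 and [lo] makes this true for every exponent, negative ones included: against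
    the value at 0 one has x^s <= [B s] <= [B s] / [lo] * x, and inside [[lo], [up]] the mean value
    theorem applies. *)
Lemma power0_lipschitz : exists2 K, 0 <= K & forall x y,
  x = 0 \/ lo <= x <= up -> y = 0 \/ lo <= y <= up ->
  `|power0 s x - power0 s y| <= K * `|x - y|.
Proof.
have B0 r : 0 <= B r by exact: expR_ge0.
pose K := `|s| * B (s - 1) + B s / lo.
have Blo r : 0 <= B r / lo by rewrite mulr_ge0 // invr_ge0 ltW.
have sB : 0 <= `|s| * B (s - 1) by rewrite mulr_ge0.
have K0 : 0 <= K by rewrite addr_ge0.
have pE x : lo <= x <= up -> power0 s x = x `^ s.
  by move=> /andP[lx _]; rewrite /power0 gt_eqF // (lt_le_trans lo0).
have zero x : lo <= x <= up -> `|power0 s x - power0 s 0| <= K * `|x - 0|.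
  move=> xb; have /andP[_ h] := powR_bounds s xb.
  have /andP[lx _] := xb; have x0 := lt_le_trans lo0 lx.
  rewrite pE // {1}/power0 eqxx !subr0 (ger0_norm (powR_ge0 _ _)) (gtr0_norm x0).
  apply: (le_trans h); apply: (@le_trans _ _ (B s / lo * x)).
    by rewrite mulrAC ler_pdivlMr // ler_wpM2l.
  by rewrite /K ler_wpM2r ?(ltW x0) // lerDr.
exists K => // x y [->|xb] [->|yb].
- by rewrite !subrr normr0 mulr0.
- by rewrite distrC (distrC 0); exact: zero.
- exact: zero.
rewrite !pE //; apply: (@le_trans _ _ (`|s| * B (s - 1) * `|x - y|)).
  apply: (@lipschitz_of_derive _ (fun z => z `^ s)
      (fun z => s * z `^ (s - 1)) lo up) => // z zb.
    apply: is_derive1_powR.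
    by case/andP: zb => lz _; exact: lt_le_trans lz.
  rewrite normrM ler_wpM2l // ger0_norm ?powR_ge0 //.
  by have /andP[] := powR_bounds (s - 1) zb.
by rewrite /K ler_wpM2r // lerDl.
Qed.

(** Lets the quadratic form of L^s be bounded below by that of L. Since x / [up] <= 1, the uniform
    lower bound of x^s is enough. *)
Lemma power0_ge : exists2 c, 0 < c & forall x,
  x = 0 \/ lo <= x <= up -> c * x <= power0 s x.
Proof.
(* If [up] < [lo], only x = 0 remains and both sides vanish. *)
have [lu|ul] := leP lo up; last first.
  exists 1 => // x [->|/andP[lx xu]]; first by rewrite /power0 eqxx mulr0.
  by have := le_lt_trans (le_trans lx xu) ul; rewrite ltxx.
have up0 := lt_le_trans lo0 lu.
exists ((B s)^-1 / up); first by rewrite divr_gt0 ?invr_gt0 ?expR_gt0.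
move=> x [->|xb]; first by rewrite /power0 eqxx mulr0.
have /andP[lx xu] := xb; have x0 := lt_le_trans lo0 lx.
rewrite /power0 gt_eqF //; have /andP[h _] := powR_bounds s xb.
apply: le_trans h; rewrite -mulrA ler_piMr ?invr_ge0 ?expR_ge0 //.
by rewrite mulrC ler_pdivrMr ?mul1r.
Qed.

End PowerEstimates.

Section Gapped.
Variables (R : realType) (n : nat).
Implicit Types (A B P : 'M[R]_n) (x : 'cV[R]_n).

(** The squared Frobenius norm, preferred to the maximum of the entries because it is invariant
    under orthogonal matrices on either side. *)
Definition fro2 A : R := \sum_i \sum_j A i j ^+ 2.

Lemma fro2_trace A : fro2 A = \tr (A *m A^T).
Proof.
apply: eq_bigr => i _; rewrite mxE; apply: eq_bigr => j _.
by rewrite mxE expr2.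
Qed.

Lemma fro2_orthogonal P Q A : P^T *m P = 1%:M -> Q^T *m Q = 1%:M ->
  fro2 (P *m A *m Q^T) = fro2 A.
Proof.
move=> PP QQ; rewrite !fro2_trace !trmx_mul trmxK !mulmxA.
rewrite -(mulmxA _ Q^T) QQ mulmx1 mxtrace_mulC !mulmxA PP mul1mx.
by [].
Qed.

Lemma fro2_entry A i j : A i j ^+ 2 <= fro2 A.
Proof.
rewrite /fro2 (bigD1 i) //= (bigD1 j) //= -addrA lerDl addr_ge0 //.
  by apply: sumr_ge0 => k _; rewrite sqr_ge0.
by apply: sumr_ge0 => k _; apply: sumr_ge0 => l _; rewrite sqr_ge0.
Qed.

Lemma fro2_bound A e : (forall i j, `|A i j| <= e) ->
  fro2 A <= (n%:R * e) ^+ 2.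
Proof.
move=> Ae; rewrite /fro2 exprMn expr2 -mulrA.
apply: sum_ord_le => i; apply: sum_ord_le => j.
have e0 := le_trans (normr_ge0 _) (Ae i j).
by rewrite -real_normK ?num_real // lerXn2r ?qualifE /=.
Qed.

(** Stated through eigenvectors, so that it can be checked from coercivity without diagonalizing. *)
Definition gapped (lo up : R) A := A^T = A /\
  forall a x, x != 0 -> A *m x = a *: x -> a = 0 \/ lo <= a <= up.

Lemma spectral_eigenvector P (lam : 'rV[R]_n) i : P^T *m P = 1%:M ->
  let x : 'cV[R]_n := P^T *m delta_mx i 0 in
  (P^T *m diag_mx lam *m P) *m x = lam 0 i *: x /\ x != 0.
Proof.
move=> PP x; rewrite {}/x; have PP' := mulmx1C PP; split.
  rewrite -!mulmxA (mulmxA P) PP' mul1mx scalemxAr; congr (_ *m _).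
  by apply/matrixP => j k; rewrite mul_diag_mx !mxE; case: eqVneq => [->|];
    rewrite ?mulr0 ?mulr1 //= !mulr0.
apply/eqP => /(congr1 (mulmx P)); rewrite mulmxA PP' mul1mx mulmx0.
by move=> /matrixP/(_ i 0)/eqP; rewrite !mxE !eqxx oner_eq0.
Qed.

Lemma gapped_spectral lo up s A : 0 < lo -> gapped lo up A ->
  exists P (lam : 'rV[R]_n), [/\ P^T *m P = 1%:M,
    A = P^T *m diag_mx lam *m P,
    spectral_power s A = P^T *m diag_mx (map_mx (power0 s) lam) *m P
  & forall i, lam 0 i = 0 \/ lo <= lam 0 i <= up].
Proof.
move=> lo0 [symA eigA]; have [P [lam [PP AE]]] := symmetric_spectral symA.
have lamb i : lam 0 i = 0 \/ lo <= lam 0 i <= up.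
  have [e1 e2] := spectral_eigenvector lam i PP.
  by apply: eigA e2 _; rewrite -e1 -AE.
exists P, lam; split => //; apply: spectral_powerE; exists P, lam; split => //.
by move=> i; case: (lamb i) => [->//|/andP[+ _]]; apply: le_trans; exact: ltW.
Qed.

Lemma dotv_spectral P (d : 'rV[R]_n) x :
  dotv x (P^T *m diag_mx d *m P *m x) = \sum_i d 0 i * ((P *m x) i 0) ^+ 2.
Proof.
rewrite -!mulmxA -dotv_mulmxl dotvE.
by apply: eq_bigr => i _; rewrite mul_diag_mx [X in _ * X]mxE; ring.
Qed.

(** With A diagonal in the frame P and B in the frame Q, the matrix Q (A - B) P^T has entries (d_j -
    m_i) W_ij, where W = Q P^T, and the difference of the powers has entries (d_j^s - m_i^s) W_ij.
    The scalar Lipschitz bound then applies entry by entry, without any choice of matching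
    eigenvectors. *)
Lemma spectral_power_lipschitz lo up s : 0 < lo -> exists2 K, 0 <= K &
  forall A B, gapped lo up A -> gapped lo up B ->
  fro2 (spectral_power s A - spectral_power s B) <= K ^+ 2 * fro2 (A - B).
Proof.
move=> lo0; have [K K0 hK] := power0_lipschitz up s lo0.
exists K => // A B gA gB.
have [P [d [PP AE -> dS]]] := gapped_spectral s lo0 gA.
have [Q [m [QQ BE -> mS]]] := gapped_spectral s lo0 gB.
have PP' := mulmx1C PP; have QQ' := mulmx1C QQ.
pose W := Q *m P^T.
have conjE (e f : 'rV[R]_n) : Q *m (P^T *m diag_mx e *m P -
    Q^T *m diag_mx f *m Q) *m P^T = W *m diag_mx e - diag_mx f *m W.
  rewrite mulmxBr mulmxBl !mulmxA QQ' mul1mx -/W; congr (_ - _).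
  by rewrite -(mulmxA _ P) PP' mulmx1.
rewrite -(fro2_orthogonal _ QQ PP) -(fro2_orthogonal (A - B) QQ PP).
rewrite {}AE {}BE !conjE /fro2 mulr_sumr; apply: ler_sum => i _.
rewrite mulr_sumr; apply: ler_sum => j _.
rewrite !mul_mx_diag !mul_diag_mx; move: (W) => V; rewrite !mxE.
rewrite -exprMn -(real_normK (num_real (_ - _))).
rewrite -[leRHS]real_normK ?num_real // lerXn2r ?qualifE //=.
rewrite [V i j * d 0 j]mulrC [V i j * power0 _ _]mulrC -!mulrBl !normrM.
by rewrite (ger0_norm K0) mulrA ler_wpM2r // hK.
Qed.

Lemma spectral_power_ge lo up s : 0 < lo -> exists2 c, 0 < c &
  forall A x, gapped lo up A ->
  c * dotv x (A *m x) <= dotv x (spectral_power s A *m x).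
Proof.
move=> lo0; have [c c0 hc] := power0_ge up s lo0.
exists c => // A x gA.
have [P [d [PP AE -> dS]]] := gapped_spectral s lo0 gA.
rewrite AE !dotv_spectral mulr_sumr; apply: ler_sum => i _.
by rewrite mulrA ler_wpM2r ?sqr_ge0 // mxE hc.
Qed.

Lemma spectral_power_sym lo up s A : 0 < lo -> gapped lo up A ->
  (spectral_power s A)^T = spectral_power s A.
Proof.
move=> lo0 gA; have [P [d [_ _ -> _]]] := gapped_spectral s lo0 gA.
by rewrite !trmx_mul trmxK tr_diag_mx mulmxA.
Qed.

(** Rests on 0^s = 0: in the eigenbasis, [x] is supported on the zero eigenvalues. *)
Lemma spectral_power_kernel lo up s A x : 0 < lo -> gapped lo up A ->
  A *m x = 0 -> spectral_power s A *m x = 0.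
Proof.
move=> lo0 gA; have [P [d [PP -> -> _]]] := gapped_spectral s lo0 gA.
move=> /(congr1 (mulmx P)); rewrite mulmx0 !mulmxA (mulmx1C PP) mul1mx => h.
rewrite -!mulmxA; suff -> : diag_mx (map_mx (power0 s) d) *m (P *m x) = 0.
  by rewrite mulmx0.
apply/colP => i; move/matrixP/(_ i 0): h.
rewrite -!mulmxA !mul_diag_mx [RHS]mxE mxE => /eqP; rewrite mulf_eq0.
rewrite [RHS]mxE mxE /power0.
by move: (P *m x) => y; rewrite mxE; case/orP => /eqP->; rewrite ?eqxx ?mul0r ?mulr0.
Qed.

Lemma spectral_power_conj s (Q A : 'M[R]_n) lo up : 0 < lo -> Q^T *m Q = 1%:M ->
  gapped lo up A ->
  spectral_power s (Q^T *m A *m Q) = Q^T *m spectral_power s A *m Q.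
Proof.
move=> lo0 QQ gA; have [P [d [PP {2}-> -> dS]]] := gapped_spectral s lo0 gA.
apply: spectral_powerE; exists (P *m Q), d; split.
- by rewrite trmx_mul -mulmxA (mulmxA _ P) PP mul1mx.
- by move=> i; case: (dS i) => [->//|/andP[+ _]]; apply: le_trans; exact: ltW.
- by rewrite trmx_mul !mulmxA.
- by rewrite trmx_mul !mulmxA.
Qed.

Lemma gapped_conj lo up (Q A : 'M[R]_n) : Q^T *m Q = 1%:M -> gapped lo up A ->
  gapped lo up (Q^T *m A *m Q).
Proof.
move=> QQ [symA eigA]; split; first by rewrite !trmx_mul trmxK symA mulmxA.
move=> a x x0 h; apply: (eigA a (Q *m x)).
  apply: contra_neq x0 => Qx; by rewrite -[x]mul1mx -QQ -mulmxA Qx mulmx0.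
by rewrite scalemxAr -h !mulmxA (mulmx1C QQ) mul1mx.
Qed.

Lemma gapped0 lo up : gapped lo up (0 : 'M[R]_n).
Proof.
split; first by rewrite trmx0.
move=> a x x0 /eqP; rewrite mul0mx eq_sym scaler_eq0 (negPf x0) orbF.
by move/eqP; left.
Qed.

Lemma spectral_power0 s : spectral_power s (0 : 'M[R]_n) = 0.
Proof.
apply: spectral_powerE; exists 1%:M, 0; split.
- by rewrite trmx1 mul1mx.
- by move=> i; rewrite mxE.
- by rewrite linear0 mulmx0 mul0mx.
- suff -> : map_mx (power0 s) 0 = 0 :> 'rV[R]_n.
    by rewrite linear0 mulmx0 mul0mx.
  by apply/rowP => i; rewrite !mxE /power0 eqxx.
Qed.

(* Flipping the sign of the i-th coordinate negates the off-diagonal entries of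
   the i-th row, so their size is controlled by the Lipschitz bound. *)
Lemma spectral_power_offdiag lo up s : 0 < lo -> exists2 K, 0 <= K &
  forall A i e, gapped lo up A -> (forall j, j != i -> `|A i j| <= e) ->
  forall j, j != i -> `|spectral_power s A i j| <= K * e.
Proof.
move=> lo0; have [K K0 hK] := spectral_power_lipschitz up s lo0.
exists (K * n%:R); first by rewrite mulr_ge0.
move=> A i e gA Ae j ji; have e0 := le_trans (normr_ge0 _) (Ae j ji).
pose q : 'rV[R]_n := \row_k (-1) ^+ (k == i); pose Q := diag_mx q.
have QT : Q^T = Q by rewrite tr_diag_mx.
have QQ : Q^T *m Q = 1%:M.
  rewrite QT; apply/matrixP => k l; rewrite mul_diag_mx !mxE.
  by have [->|kl] := eqVneq k l; rewrite /= ?mulr1n ?mulr0n ?mulr0 // -expr2 sqrr_sign.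
have conjE (B : 'M[R]_n) k l : (Q^T *m B *m Q - B) k l =
    ((-1) ^+ (k == i) * (-1) ^+ (l == i) - 1) * B k l.
  by rewrite QT mul_mx_diag mul_diag_mx !mxE; ring.
have := hK _ _ (gapped_conj QQ gA) gA.
rewrite (spectral_power_conj s lo0 QQ gA) => h.
have /fro2_bound h2 k l : `|(Q^T *m A *m Q - A) k l| <= 2 * e.
  rewrite conjE; case: (eqVneq k i) => [->|ki]; case: (eqVneq l i) => [->|li];
    rewrite ?expr0 ?expr1 ?mulrNN ?mulr1 ?mul1r ?subrr ?mul0r ?normr0 ?mulr_ge0 //.
  - rewrite -opprD mulNr normrN normrM ger0_norm // ler_wpM2l //; exact: Ae.
  - rewrite -opprD mulNr normrN normrM ger0_norm // ler_wpM2l //.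
    by have [<- _] := gA; rewrite mxE; exact: Ae.
have := le_trans (le_trans (fro2_entry _ i j) h) (ler_wpM2l (sqr_ge0 K) h2).
have -> : (Q^T *m spectral_power s A *m Q - spectral_power s A) i j =
    - 2 * spectral_power s A i j.
  rewrite conjE eqxx (negPf ji); congr (_ * _).
  by rewrite /= expr0 expr1 mulr1 -opprD.
move=> h3; rewrite -ler_sqr ?qualifE /= ?mulr_ge0 // real_normK ?num_real //.
by lra.
Qed.

End Gapped.

(** * One-variable calculus and ordinary differential equations *)

Section DerivativeRules.
Variable R : realType.
Implicit Types (f g : R -> R) (x a b k : R).

(** The rules below dictate the form of the derivative; this replaces it by the wanted expression
    once a derivative has been built as a term. *)
Lemma der_eq f x a b : is_derive x 1 f a -> a = b -> is_derive x 1 f b.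
Proof. by move=> fa <-. Qed.

Lemma derD f g x a b : is_derive x 1 f a -> is_derive x 1 g b ->
  is_derive x 1 (fun t => f t + g t) (a + b).
Proof. by move=> fa gb; have := is_deriveD fa gb. Qed.

Lemma derB f g x a b : is_derive x 1 f a -> is_derive x 1 g b ->
  is_derive x 1 (fun t => f t - g t) (a - b).
Proof. by move=> fa gb; have := is_deriveB fa gb. Qed.

Lemma derN f x a : is_derive x 1 f a -> is_derive x 1 (fun t => - f t) (- a).
Proof. by move=> fa; have := is_deriveN fa. Qed.

Lemma derC k x : is_derive x 1 (fun _ : R => k) 0.
Proof. exact: is_derive_cst. Qed.

Lemma derI x : is_derive x 1 (fun t : R => t) 1.
Proof. exact: is_derive_id. Qed.

Lemma derZ k f x a : is_derive x 1 f a -> is_derive x 1 (fun t => k * f t) (k * a).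
Proof. by move=> fa; have := is_deriveZ k fa. Qed.

Lemma derM f g x a b : is_derive x 1 f a -> is_derive x 1 g b ->
  is_derive x 1 (fun t => f t * g t) (a * g x + f x * b).
Proof.
move=> fa gb; apply: der_eq (is_deriveM fa gb) _.
by rewrite addrC mulrC.
Qed.

Lemma derV f x a : f x != 0 -> is_derive x 1 f a ->
  is_derive x 1 (fun t => (f t)^-1) (- a / f x ^+ 2).
Proof.
move=> f0 fa; apply: der_eq (is_deriveV f0 fa) _.
by rewrite /GRing.scale /= mulNr mulrC mulNr.
Qed.

Lemma der_sum (I : Type) (r : seq I) (P : pred I) (h : I -> R -> R) x (d : I -> R) :
  (forall i, P i -> is_derive x 1 (h i) (d i)) ->
  is_derive x 1 (fun t => \sum_(i <- r | P i) h i t) (\sum_(i <- r | P i) d i).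
Proof.
move=> hd; elim: r => [|i r IH].
  rewrite big_nil (_ : (fun t => _) = fun=> 0); first exact: derC.
  by apply/funext => t; rewrite big_nil.
rewrite big_cons; case: ifPn => Pi.
  rewrite (_ : (fun t => _) = fun t => h i t + \sum_(j <- r | P j) h j t).
    by apply: derD => //; exact: hd.
  by apply/funext => t; rewrite big_cons Pi.
rewrite (_ : (fun t => _) = fun t => \sum_(j <- r | P j) h j t) //.
by apply/funext => t; rewrite big_cons (negPf Pi).
Qed.

Lemma der_comp f g x a b : is_derive (g x) 1 f a -> is_derive x 1 g b ->
  is_derive x 1 (fun t => f (g t)) (a * b).
Proof. exact: is_derive1_comp. Qed.

Lemma der_expR f x a : is_derive x 1 f a ->
  is_derive x 1 (fun t => expR (f t)) (expR (f x) * a).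
Proof. by move=> fa; apply: der_comp. Qed.

Lemma der_sqrt f x a : 0 < f x -> is_derive x 1 f a ->
  is_derive x 1 (fun t => Num.sqrt (f t)) (a / (2 * Num.sqrt (f x))).
Proof.
move=> f0 fa; apply: der_eq; first exact: (der_comp (is_derive1_sqrt f0) fa).
by rewrite mulrC.
Qed.

Lemma der_acos f x a : -1 < f x < 1 -> is_derive x 1 f a ->
  is_derive x 1 (fun t => acos (f t)) (- a / Num.sqrt (1 - f x ^+ 2)).
Proof.
move=> f1 fa; have h := @der_comp (@acos R) f x _ _ (is_derive1_acos f1) fa.
by apply: der_eq h _; rewrite !mulNr mulrC.
Qed.

End DerivativeRules.

Section RealCalculus.
Variable R : realType.
Implicit Types (f g F dF : R -> R) (x y a b k : R).

Lemma lipschitz_continuous f (K : R) :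
  (forall x y, `|f x - f y| <= K * `|x - y|) -> continuous f.
Proof.
move=> fK x; have fK' y : `|f x - f y| <= (`|K| + 1) * `|x - y|.
  by apply: (le_trans (fK x y)); rewrite ler_wpM2r // ler_wpDr // ler_norm.
have K1 : 0 < `|K| + 1 by rewrite ltr_wpDl.
apply/cvgrPdist_lt => e e0; near=> t.
apply: (le_lt_trans (fK' t)); rewrite mulrC -ltr_pdivlMr //.
near: t; have : 0 < e / (`|K| + 1) by rewrite divr_gt0.
by move=> d0; exists (e / (`|K| + 1)).
Unshelve. all: end_near. Qed.

Lemma derive_continuous f x d : is_derive x 1 f d -> {for x, continuous f}.
Proof.
by case=> df _; apply: differentiable_continuous; exact/derivable1_diffP.
Qed.

Lemma within_continuous f a b : (forall x, a <= x <= b -> {for x, continuous f}) ->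
  {within `[a, b], continuous f}.
Proof.
move=> fc; apply: continuous_in_subspaceT => x; rewrite inE /= in_itv /=.
exact: fc.
Qed.

Lemma derive_ge0_le F dF a b : a <= b -> {within `[a, b], continuous F} ->
  (forall x, a < x < b -> is_derive x 1 F (dF x)) ->
  (forall x, a < x < b -> 0 <= dF x) -> F a <= F b.
Proof.
rewrite le_eqVlt => /predU1P[->//|ab] cF dFx dF0.
have [t tab h] : exists2 t, t \in `]a, b[%R & F b - F a = dF t * (b - a).
  by apply: MVT => // x; rewrite in_itv; exact: dFx.
by rewrite -subr_ge0 h mulr_ge0 ?dF0 ?subr_ge0 ?ltW.
Qed.

Lemma gronwall F dF k a b : a <= b -> {within `[a, b], continuous F} ->
  (forall x, a < x < b -> is_derive x 1 F (dF x)) ->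
  (forall x, a < x < b -> dF x <= k * F x) ->
  F b <= expR (k * (b - a)) * F a.
Proof.
move=> ab cF dFx dFk.
pose G (t : R) : R := expR (- k * t) * - F t.
have : G a <= G b.
  have dG x : a < x < b ->
      is_derive x 1 G (expR (- k * x) * (- k * 1) * - F x + expR (- k * x) * - dF x).
    move=> xab.
    exact: derM (der_expR (derZ (- k) (derI x))) (derN (dFx x xab)).
  apply: (derive_ge0_le ab _ dG) => x.
  - apply: cvgM; last by apply: cvgN; exact: cF.
    apply: continuous_subspaceT => {}x.
    apply: derive_continuous (der_expR (derZ _ (derI x))).
  - move=> xab; have := dFk x xab; have := expR_ge0 (- k * x); nra.
rewrite /G /= !mulrN lerN2 mulNr => h.
have := ler_wpM2l (expR_ge0 (k * b)) h.
by rewrite !mulrA -!expRD !mulNr subrr expR0 mul1r mulrBr.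
Qed.

(* Only the nonnegative half line matters; starting the integration at -1 makes
   the derivative at 0 two-sided. *)
Lemma antiderivative_exists f : continuous f ->
  exists F, F 0 = 0 /\ forall x, -1 < x -> is_derive x 1 F (f x).
Proof.
move=> cf; pose mu := @lebesgue_measure R.
pose G x := (\int[mu]_(t in [set` Interval (BLeft (-1 : R)) (BRight x)]) f t)%R.
exists (fun x => G x - G 0); split; first by rewrite subrr.
move=> x x1.
have [dG GE] : derivable G x 1 /\ derive1 G x = f x.
  apply: (@continuous_FTC1 _ f (BLeft (-1)) x (x + 1)).
  - by rewrite ltrDl.
  - apply: continuous_compact_integrable; first exact: segment_compact.
    exact: continuous_subspaceT.
  - by [].
  - exact: cf.
have hG : is_derive x 1 G (f x) by split; rewrite -?derive1E.
by apply: der_eq (derB hG (derC _ _)) _; rewrite subr0.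
Qed.

(** A total choice of antiderivative vanishing at 0. Its properties are available for continuous
    functions only, so the integrands below are extended continuously to the whole line. *)
Definition prim f : R -> R := xget (fun=> 0)
  [set F | F 0 = 0 /\ forall x, -1 < x -> is_derive x 1 F (f x)].

Lemma primP f : continuous f ->
  prim f 0 = 0 /\ forall x, -1 < x -> is_derive x 1 (prim f) (f x).
Proof. by move=> cf; apply: xgetPex (antiderivative_exists cf). Qed.

Lemma prim0 f : continuous f -> prim f 0 = 0.
Proof. by case/primP. Qed.

Lemma prim_derive f x : continuous f -> 0 <= x -> is_derive x 1 (prim f) (f x).
Proof. by move=> /primP[_ h] x0; apply: h; lra. Qed.

Lemma prim_lipschitz f (B : R) : continuous f -> (forall x, `|f x| <= B) ->
  forall x y, 0 <= x -> 0 <= y -> `|prim f x - prim f y| <= B * `|x - y|.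
Proof.
move=> cf fB x y x0 y0.
apply: (@lipschitz_of_derive _ (prim f) f 0 (Num.max x y)) => //.
- by move=> t /andP[t0 _]; exact: prim_derive.
- by rewrite x0 le_max lexx.
- by rewrite y0 le_max lexx orbT.
Qed.

(** Integrating e^{kx} gains a factor 1/k. In the norm weighted by this exponential, Picard
    iteration contracts on the whole half line at once. *)
Lemma prim_expR_bound f g (C : R) k : continuous f -> continuous g -> 0 <= C ->
  0 < k -> (forall x, 0 <= x -> `|f x - g x| <= C * expR (k * x)) ->
  forall x, 0 <= x -> `|prim f x - prim g x| <= C / k * expR (k * x).
Proof.
move=> cf cg C0 k0; have main f1 g1 : continuous f1 -> continuous g1 ->
    (forall x, 0 <= x -> `|f1 x - g1 x| <= C * expR (k * x)) ->
    forall x, 0 <= x -> prim f1 x - prim g1 x <= C / k * expR (k * x).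
  move=> cf1 cg1 h x x0.
  pose G (t : R) : R := C / k * expR (k * t) - (prim f1 t - prim g1 t).
  have dG (t : R) : 0 <= t -> is_derive t 1 G (C * expR (k * t) - (f1 t - g1 t)).
    move=> t0; apply: der_eq.
      exact: derB (derZ (C / k) (der_expR (derZ k (derI t))))
        (derB (prim_derive cf1 t0) (prim_derive cg1 t0)).
    by field; rewrite gt_eqF.
  have : G 0 <= G x.
    apply: (@derive_ge0_le _ (fun t => C * expR (k * t) - (f1 t - g1 t))) => //.
    - apply: within_continuous => t /andP[t0 _]; exact: derive_continuous (dG t t0).
    - by move=> t /andP[/ltW t0 _]; exact: dG.
    - move=> t /andP[/ltW t0 _]; have := h t t0; rewrite ler_norml; lra.
  rewrite /G /= !prim0 // subrr subr0 mulr0 expR0 mulr1 => h0.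
  have : 0 <= C / k by rewrite divr_ge0 // ltW.
  lra.
move=> h x x0; have h1 := main f g cf cg h x x0.
have := main g f cg cf _ x x0.
rewrite ler_norml; move=> h2; apply/andP; split; last exact: h1.
rewrite lerNl opprB; apply: h2 => y y0; rewrite distrC; exact: h.
Qed.

(** The intervals of radius 2C / 2^n around the terms are nested; the limit is the supremum of their
    left ends. *)
Lemma geometric_cauchy_limit (a : nat -> R) (C : R) :
  (forall n, `|a n.+1 - a n| <= C / 2 ^+ n) ->
  exists l, forall n, `|l - a n| <= 2 * C / 2 ^+ n.
Proof.
move=> h; pose c n := 2 * C / 2 ^+ n.
have cS n : c n.+1 = C / 2 ^+ n.
  by rewrite /c exprS; field; rewrite expf_neq0 // pnatr_eq0.
have c2 n : c n = 2 * c n.+1 by rewrite cS /c mulrA.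
have c0 n : 0 <= c n.
  by rewrite c2 cS mulr_ge0 // (le_trans _ (h n)).
have step n : a n - c n <= a n.+1 - c n.+1 /\ a n.+1 + c n.+1 <= a n + c n.
  by have := h n; rewrite -cS (c2 n) ler_norml; lra.
have mono n m : a n - c n <= a (n + m)%N - c (n + m)%N /\
    a (n + m)%N + c (n + m)%N <= a n + c n.
  elim: m => [|m [IH1 IH2]]; first by rewrite addn0.
  by rewrite addnS; have [] := step (n + m)%N; lra.
have ub n m : a n - c n <= a m + c m.
  have [h1 _] := mono n m; have [_ h2] := mono m n.
  by rewrite addnC in h2; have := c0 (n + m)%N; lra.
pose S := [set a n - c n | n in setT].
have hS : has_sup S.
  split; first by exists (a 0%N - c 0%N); exists 0%N.
  by exists (a 0%N + c 0%N) => _ [n _ <-]; exact: ub.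
exists (sup S) => n.
have h1 : a n - c n <= sup S by apply: sup_upper_bound => //; exists n.
have h2 : sup S <= a n + c n.
  by apply: ge_sup; [case: hS|move=> _ [m _ <-]; exact: ub].
by rewrite ler_norml -/(c n); lra.
Qed.

Lemma le_geometric_eq0 (x C : R) : 0 <= x ->
  (forall n, x <= C / 2 ^+ n) -> x = 0.
Proof.
move=> x0 h; apply/eqP; rewrite eq_le x0 andbT leNgt; apply/negP => xp.
have [n hn] : exists n, C / x < 2 ^+ n.
  exists (Num.truncn (C / x)).+1.
  apply: lt_le_trans (truncnS_gt _) _.
  by rewrite -natrX ler_nat ltnW // ltn_expl.
have := h n; rewrite ler_pdivlMr ?exprn_gt0 // => {}h.
by move: hn; rewrite ltr_pdivrMr // mulrC ltNge h.
Qed.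

End RealCalculus.

Lemma le_geometric (R : realType) (x y C : R) :
  (forall n, x <= y + C / 2 ^+ n) -> x <= y.
Proof.
move=> h; rewrite leNgt; apply/negP => xy.
have : x - y = 0.
  apply: (@le_geometric_eq0 _ _ C); first by lra.
  by move=> n; have := h n; lra.
by lra.
Qed.

(** * Picard iteration for a bounded, globally Lipschitz field *)

Section Picard.
Variables (R : realType) (N : nat) (X : 'cV[R]_N -> 'cV[R]_N) (u0 : 'cV[R]_N).
Variables (K B : R).
Hypothesis K1 : 1 <= K.
Hypothesis X_lip : forall u v, `|X u - X v| <= K * `|u - v|.
Hypothesis X_bound : forall u, `|X u| <= B.
Implicit Types (V : R -> 'cV[R]_N) (t : R).

Let B0 : 0 <= B := le_trans (normr_ge0 _) (X_bound u0).

Let Kgt0 : 0 < K. Proof. exact: lt_le_trans K1. Qed.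
Let K0 : 0 < 2 * K. Proof. by rewrite mulr_gt0. Qed.

(** Time is frozen at 0 for negative [t], so that the iterates are Lipschitz on the whole line and
    [prim] applies to their images under [X]. *)
Let picard_step V t : 'cV[R]_N :=
  \col_i (u0 i 0 + prim (fun x => X (V x) i 0) (Num.max t 0)).

Let is_lip V := forall t t', `|V t - V t'| <= B * `|t - t'|.

Let lip_continuous V i : is_lip V -> continuous (fun x => X (V x) i 0).
Proof.
move=> lipV; apply: (@lipschitz_continuous _ _ (K * B)) => x y.
have := norm_coord (X (V x) - X (V y)) i; rewrite !mxE => /le_trans; apply.
by apply: (le_trans (X_lip _ _)); rewrite -mulrA ler_wpM2l ?lipV ?(ltW Kgt0).
Qed.

Let X_coord V i x : `|X (V x) i 0| <= B.
Proof. exact: le_trans (norm_coord _ _) (X_bound _). Qed.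

Let pos_ge0 t : 0 <= Num.max t 0. Proof. by rewrite le_max lexx orbT. Qed.

Let step_lip V : is_lip V -> is_lip (picard_step V).
Proof.
move=> lipV t t'; apply: norm_leP; first by rewrite mulr_ge0.
move=> i; rewrite !mxE opprD addrACA subrr add0r.
have cf := @lip_continuous _ i lipV.
apply: (le_trans (prim_lipschitz cf (X_coord V i) (pos_ge0 t) (pos_ge0 t'))).
rewrite ler_wpM2l //; have [t0|t0] := leP t 0; have [t0'|t0'] := leP t' 0;
  rewrite !ler_norml; apply/andP; split;
  have := ler_norm (t - t'); have := ler_norm (- (t - t')); rewrite normrN; lra.
Qed.

(** The weight e^{2Kt} against the Lipschitz constant [K] gives the contraction factor K / (2K) =
    1/2. *)
Let step_contract V W C t : is_lip V -> is_lip W -> 0 <= C ->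
  (forall x, 0 <= x -> `|V x - W x| <= C * expR (2 * K * x)) -> 0 <= t ->
  `|picard_step V t - picard_step W t| <= C / 2 * expR (2 * K * t).
Proof.
move=> lipV lipW C0 VW t0; apply: norm_leP.
  by rewrite mulr_ge0 ?expR_ge0 // divr_ge0.
move=> i; rewrite !mxE opprD addrACA subrr add0r (max_idPl t0).
have -> : C / 2 = K * C / (2 * K) by field; rewrite gt_eqF.
apply: prim_expR_bound => //; try exact: lip_continuous.
  by rewrite mulr_ge0 // ltW.
move=> x x0.
have := norm_coord (X (V x) - X (W x)) i; rewrite !mxE => /le_trans; apply.
by apply: (le_trans (X_lip _ _)); rewrite -mulrA ler_wpM2l ?VW ?(ltW Kgt0).
Qed.

Let U n := iter n picard_step (fun=> u0).

Let U_lip n : is_lip (U n).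
Proof.
elim: n => [|n IH]; last exact: step_lip.
by move=> t t'; rewrite subrr normr0 mulr_ge0.
Qed.

Let U_cauchy n t : 0 <= t ->
  `|U n.+1 t - U n t| <= B / 2 ^+ n * expR (2 * K * t).
Proof.
elim: n t => [|n IH] t t0.
  apply: norm_leP; first by rewrite expr0 divr1 mulr_ge0 ?expR_ge0.
  move=> i; rewrite !mxE addrAC subrr add0r (max_idPl t0) expr0 divr1.
  have cf := @lip_continuous _ i (U_lip 0).
  have := prim_lipschitz cf (X_coord _ i) t0 (lexx 0).
  rewrite prim0 // !subr0 (ger0_norm t0) => /le_trans; apply.
  rewrite ler_wpM2l //; apply: le_trans (expR_ge1Dx _).
  by have := K1; nra.
have -> : B / 2 ^+ n.+1 = B / 2 ^+ n / 2.
  by rewrite exprS; field; rewrite expf_neq0 // pnatr_eq0.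
apply: (step_contract (U_lip _) (U_lip _) _ IH t0).
by rewrite divr_ge0 // exprn_ge0.
Qed.

Let U_pos n t : U n (Num.max t 0) = U n t.
Proof.
case: n => [//|n]; apply/colP => i; rewrite !mxE.
by rewrite (max_idPl (pos_ge0 t)).
Qed.

Let bnd t := 2 * (B * expR (2 * K * Num.max t 0)).

Let U_limit t : exists v, forall n, `|v - U n t| <= bnd t / 2 ^+ n.
Proof.
have bnd0 n : 0 <= bnd t / 2 ^+ n.
  by rewrite divr_ge0 ?exprn_ge0 // mulr_ge0 // mulr_ge0 ?expR_ge0.
have /choice[f fP] i : exists l, forall n, `|l - U n t i 0| <= bnd t / 2 ^+ n.
  apply: geometric_cauchy_limit => n.
  have := norm_coord (U n.+1 t - U n t) i; rewrite !mxE => /le_trans; apply.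
  rewrite -U_pos -(U_pos n); apply: (le_trans (U_cauchy n (pos_ge0 t))).
  by rewrite mulrAC.
exists (\col_i f i) => n; apply: norm_leP => // i.
by rewrite !mxE; exact: fP.
Qed.

Theorem picard_lindelof : exists u : R -> 'cV[R]_N, u 0 = u0 /\
  forall t, 0 <= t -> forall i, is_derive t 1 (fun x => u x i 0) (X (u t) i 0).
Proof.
have [V VP] := choice U_limit.
have lipV : is_lip V.
  move=> t t'; apply: (@le_geometric _ _ _ (bnd t + bnd t')) => n.
  have -> : V t - V t' = (V t - U n t) + (U n t - U n t') + (U n t' - V t').
    by rewrite !addrA !subrK.
  apply: le_trans (ler_normD _ _) _; rewrite (distrC _ (V t')).
  have := VP t n; have := VP t' n; have := U_lip n t t'.
  have := ler_normD (V t - U n t) (U n t - U n t').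
  rewrite mulrDl; lra.
have cV i := @lip_continuous _ i lipV.
(* Unlike the iterates, the solution is not frozen at negative times, which gives it a two-sided
   derivative at 0. For t >= 0 it agrees with the limit [V]. *)
pose u t : 'cV[R]_N := \col_i (u0 i 0 + prim (fun x => X (V x) i 0) t).
have uV t : 0 <= t -> u t = V t.
  move=> t0; have -> : u t = picard_step V t.
    by apply/colP => i; rewrite !mxE (max_idPl t0).
  apply/eqP; rewrite -subr_eq0 -normr_eq0; apply/eqP.
  apply: (@le_geometric_eq0 _ _ (bnd t)) => // n.
  have h1 := VP t n.+1.
  (* [V] is a fixed point: its image is close to [U n.+1 t], which is close to [V t], with errors of
     order 2^-n. *)
  have h2 : `|picard_step V t - picard_step (U n) t| <= 
      2 * B / 2 ^+ n / 2 * expR (2 * K * t).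
    apply: (step_contract lipV (U_lip n) _ _ t0).
      by rewrite divr_ge0 ?exprn_ge0 // mulr_ge0.
    move=> x x0; apply: (le_trans (VP x n)).
    by rewrite /bnd (max_idPl x0) mulrA mulrAC.
  have h3 := ler_normD (picard_step V t - U n.+1 t) (U n.+1 t - V t).
  rewrite addrA subrK in h3; apply: (le_trans h3); rewrite (distrC _ (V t)).
  apply: (le_trans (lerD h2 h1)).
  rewrite /bnd (max_idPl t0) exprS.
  by rewrite le_eqVlt; apply/orP; left; apply/eqP; field;
    rewrite expf_neq0 // pnatr_eq0.
exists u; split.
  by apply/colP => i; rewrite !mxE prim0 // addr0.
move=> t t0 i; rewrite uV //.
rewrite (_ : (fun x => _) = fun x => u0 i 0 + prim (fun x => X (V x) i 0) x).
  by apply: der_eq (derD (derC _ t) (prim_derive (cV i) t0)) _; rewrite add0r.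
by apply/funext => x; rewrite mxE.
Qed.

End Picard.

(** * Flow of an abstract curvature map *)

Section Box.
Variables (R : realType) (N : nat).
Implicit Types (u v x : 'cV[R]_N) (lo hi : R).

Definition in_box lo hi u := forall i, lo <= u i 0 <= hi.

Definition segment u v (t : R) : 'cV[R]_N := u + t *: (v - u).

Lemma segment0 u v : segment u v 0 = u.
Proof. by rewrite /segment scale0r addr0. Qed.

Lemma segment1 u v : segment u v 1 = v.
Proof. by rewrite /segment scale1r addrC subrK. Qed.

Lemma segment_in_box lo hi u v t : in_box lo hi u -> in_box lo hi v ->
  0 <= t <= 1 -> in_box lo hi (segment u v t).
Proof.
move=> ub vb /andP[t0 t1] i; rewrite !mxE.
by have /andP[h1 h2] := ub i; have /andP[h3 h4] := vb i; apply/andP; split; nra.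
Qed.

Lemma segment_derive u v (t : R) i :
  is_derive t 1 (fun z => segment u v z i 0) ((v - u) i 0).
Proof.
rewrite (_ : (fun z => _) = fun z => u i 0 + z * (v - u) i 0).
  by apply: der_eq (derD (derC _ t) (derM (derI t) (derC _ t))) _; rewrite mulr0; ring.
by apply/funext => z; rewrite !mxE.
Qed.

Lemma in_box_dist lo hi u v : lo <= hi -> in_box lo hi u -> in_box lo hi v ->
  `|u - v| <= hi - lo.
Proof.
move=> lh ub vb; apply: norm_leP; first by rewrite subr_ge0.
move=> i; rewrite !mxE ler_norml.
by have /andP[h1 h2] := ub i; have /andP[h3 h4] := vb i; lra.
Qed.

End Box.

(** [d] holds everywhere in the Euclidean case and on the negative reals in the hyperbolic case. *)
Definition coord_domain (R : realType) N (d : R -> Prop) (u : 'cV[R]_N) :=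
  forall i, d (u i 0).

(* [q] spans the kernel of the Jacobian [J] of [K]: it is constant in the
   Euclidean case and zero in the hyperbolic case. *)
Record curvature_system (R : realType) N (d : R -> Prop) (q : 'cV[R]_N)
    (K : 'cV[R]_N -> 'cV[R]_N) (J : 'cV[R]_N -> 'M[R]_N) : Prop := {
  cs_down : forall a b, d a -> b <= a -> d b;
  cs_up : forall a, d a -> exists2 b, a < b & d b;
  cs_derive : forall (g : R -> 'cV[R]_N) (t : R) (x : 'cV[R]_N),
    coord_domain d (g t) ->
    (forall i, is_derive t 1 (fun z => g z i 0) (x i 0)) ->
    forall i, is_derive t 1 (fun z => K (g z) i 0) ((J (g t) *m x) i 0);
  cs_sym : forall u, coord_domain d u -> (J u)^T = J u;
  cs_kernel : forall u, coord_domain d u -> J u *m q = 0;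
  cs_lip : forall lo hi, d hi -> exists2 L, 0 <= L &
    forall u v, in_box lo hi u -> in_box lo hi v ->
    forall i j, `|J u i j - J v i j| <= L * `|u - v|;
  cs_coercive : forall lo hi, d hi -> exists2 lam, 0 < lam &
    forall u x, in_box lo hi u -> dotv q x = 0 ->
    lam * dotv x x <= dotv x (J u *m x)
}.

(** The constants of one box are packaged together because two boxes are in play: the large one that
    holds the flow, and a small one around [ubar] that controls the growth of the potential. *)
Record box_bounds (R : realType) N (d : R -> Prop) (q : 'cV[R]_N)
    (J : 'cV[R]_N -> 'M[R]_N) (lo hi L M lam : R) : Prop := {
  bb_hi : d hi;
  bb_L : 0 <= L;
  bb_lip : forall u v, in_box lo hi u -> in_box lo hi v ->
    forall i j, `|J u i j - J v i j| <= L * `|u - v|;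
  bb_bound : forall u, in_box lo hi u -> forall i j, `|J u i j| <= M;
  bb_lam : 0 < lam;
  bb_coercive : forall u x, in_box lo hi u -> dotv q x = 0 ->
    lam * dotv x x <= dotv x (J u *m x)
}.

Section CurvatureOnBox.
Variables (R : realType) (N : nat) (d : R -> Prop) (q : 'cV[R]_N).
Variables (K : 'cV[R]_N -> 'cV[R]_N) (J : 'cV[R]_N -> 'M[R]_N).
Implicit Types (u v x y : 'cV[R]_N).
Hypothesis sys : curvature_system d q K J.

Let D := @coord_domain R N d.
Let d_down := cs_down sys.
Let K_derive := cs_derive sys.
Let J_sym := cs_sym sys.
Let J_kernel := cs_kernel sys.

Lemma in_box_domain lo hi u : d hi -> in_box lo hi u -> D u.
Proof. by move=> dhi ub i; apply: d_down dhi _; case/andP: (ub i). Qed.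

Lemma jacobianE u : D u -> curvature_jacobian K u = J u.
Proof.
move=> Du; apply/matrixP => i j; rewrite mxE.
pose g (t : R) : 'cV[R]_N := u + t *: delta_mx j 0.
have g0 : g 0 = u by rewrite /g scale0r addr0.
have gd k : is_derive (0 : R) 1 (fun z => g z k 0) ((delta_mx j 0 : 'cV[R]_N) k 0).
  rewrite (_ : (fun z => _) = fun z => u k 0 + z * (delta_mx j 0 : 'cV[R]_N) k 0).
    have h := derD (derC (u k 0) (0 : R))
      (derM (derI (0 : R)) (derC ((delta_mx j 0 : 'cV[R]_N) k 0) _)).
    by apply: der_eq h _; rewrite mulr0 addr0 add0r mul1r.
  by apply/funext => z; rewrite !mxE.
have Dg : D (g 0) by rewrite g0.
have [_] := K_derive Dg gd i; rewrite g0.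
rewrite -colE mxE => <-; rewrite /derive; f_equal; f_equal.
apply/funext => h /=; congr (_ *: (_ - _)).
  by rewrite /g /= addr0 /GRing.scale /= mulr1 addrC.
by rewrite g0.
Qed.

Lemma dotv_segment_derive x u v (t : R) : D (segment u v t) ->
  is_derive t 1 (fun z => dotv x (K (segment u v z)))
    (dotv x (J (segment u v t) *m (v - u))).
Proof.
move=> Dt; have := K_derive Dt (segment_derive u v t) => h.
rewrite (_ : (fun z => _) = fun z => \sum_i x i 0 * K (segment u v z) i 0).
  by rewrite dotvE; apply: der_sum => i _; exact: derZ.
by apply/funext => z; rewrite dotvE.
Qed.

Lemma box_bounds_exist lo hi : d hi ->
  exists L M lam, box_bounds d q J lo hi L M lam.
Proof.
move=> dhi; have [L L0 hL] := cs_lip sys lo dhi.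
have [lam lam0 hlam] := cs_coercive sys lo dhi.
pose c : 'cV[R]_N := const_mx lo.
(* The size of [J] at the corner [c], plus the largest variation over the box. *)
pose M := \sum_i \sum_j `|J c i j| + L * (hi - lo).
exists L, M, lam; split => // u ub i j.
have lh : lo <= hi by have /andP[] := ub i; exact: le_trans.
have cb : in_box lo hi c by move=> k; rewrite mxE lexx.
have h1 := hL u c ub cb i j.
have h2 : L * `|u - c| <= L * (hi - lo) by rewrite ler_wpM2l // in_box_dist.
have h3 : `|J c i j| <= \sum_i \sum_j `|J c i j|.
  rewrite (bigD1 i) //= (bigD1 j) //= -addrA lerDl addr_ge0 //.
    by apply: sumr_ge0.
  by apply: sumr_ge0 => k _; apply: sumr_ge0.
have := ler_normD (J u i j - J c i j) (J c i j); rewrite subrK /M; lra.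
Qed.

Section OneBox.
Variables (lo hi L M lam : R).
Hypothesis box : box_bounds d q J lo hi L M lam.
Let dhi := bb_hi box.
Let J_lip := bb_lip box.
Let J_bound := bb_bound box.

(** The mean value inequality for K tested against [x]. The one-sided form suffices: upper bounds
    follow by replacing [x] with its opposite. *)
Lemma K_increment x u v c : in_box lo hi u -> in_box lo hi v ->
  (forall t, 0 <= t <= 1 -> c <= dotv x (J (segment u v t) *m (v - u))) ->
  c <= dotv x (K v - K u).
Proof.
move=> ub vb h; have Dseg t : 0 <= t <= 1 -> D (segment u v t).
  by move=> t01; exact: in_box_domain dhi (segment_in_box ub vb t01).
pose G (z : R) : R := dotv x (K (segment u v z)) - z * c.
pose dG (t : R) : R := dotv x (J (segment u v t) *m (v - u)) - c.
have hd (t : R) : 0 <= t <= 1 -> is_derive t 1 G (dG t).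
  move=> t01.
  have e := derB (dotv_segment_derive x (Dseg _ t01)) (derM (derI t) (derC c t)).
  by apply: der_eq e _; rewrite mulr0 addr0 mul1r.
have itv (t : R) : 0 < t < 1 -> 0 <= t <= 1 by move=> /andP[/ltW-> /ltW->].
have : G 0 <= G 1.
  apply: (@derive_ge0_le _ G dG) => [//||t /itv|t /itv t01]; last first.
  - by rewrite subr_ge0 h.
  - exact: hd.
  - by apply: within_continuous => t /hd; exact: derive_continuous.
by rewrite /G /= mul0r subr0 mul1r segment0 segment1 dotvBr; lra.
Qed.

(** The centre [a] is left free: 0 gives the Lipschitz bound, and the linear term of K at [u] gives
    the second-order remainder. *)
Lemma K_coord_bound u v i a c : in_box lo hi u -> in_box lo hi v ->
  (forall t, 0 <= t <= 1 -> `|(J (segment u v t) *m (v - u)) i 0 - a| <= c) ->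
  `|K v i 0 - K u i 0 - a| <= c.
Proof.
move=> ub vb h; pose e : 'cV[R]_N := delta_mx i 0.
have eE (y : 'cV[R]_N) : dotv e y = y i 0.
  rewrite dotvE (bigD1 i) //= big1 ?addr0 ?mxE ?eqxx ?mul1r // => j /negPf ji.
  by rewrite mxE ji mul0r.
have h1 : a - c <= dotv e (K v - K u).
  apply: K_increment => // t t01; rewrite eE.
  by have := h t t01; rewrite ler_norml; lra.
have h2 : - a - c <= dotv (- e) (K v - K u).
  apply: K_increment => // t t01; rewrite dotvC dotvNr dotvC eE.
  by have := h t t01; rewrite ler_norml; lra.
move: h1 h2; rewrite (dotvC (- e)) dotvNr (dotvC _ e) eE !mxE ler_norml.
by move=> h1 h2; apply/andP; split; lra.
Qed.

Lemma K_lipschitz u v : in_box lo hi u -> in_box lo hi v ->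
  `|K v - K u| <= N%:R * M * `|v - u|.
Proof.
move=> ub vb; have [->|vu] := eqVneq v u.
  by rewrite !subrr !normr0 mulr0.
(* [M] is nonnegative as soon as there is an index; without one, [v] and [u] would be equal. *)
have M0 : 0 <= M.
  suff [i0] : inhabited 'I_N by exact: le_trans (normr_ge0 _) (J_bound ub i0 i0).
  apply: contrapT => h; move/eqP: vu; apply.
  by apply/colP => i; case: h; constructor.
apply: norm_leP => [|i]; first by rewrite !mulr_ge0.
rewrite !mxE -[X in `|X|]subr0; apply: K_coord_bound => // t t01; rewrite subr0.
apply: (le_trans (norm_coord _ _)); rewrite -mulrA.
by apply: mulmx_bound; apply: J_bound; exact: segment_in_box.
Qed.

Lemma K_taylor u v : in_box lo hi u -> in_box lo hi v ->
  `|K v - K u - J u *m (v - u)| <= N%:R * (L * `|v - u| ^+ 2).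
Proof.
move=> ub vb; have L0 := bb_L box; apply: norm_leP => [|i].
  by rewrite !mulr_ge0.
have subE (a b : 'cV[R]_N) : (a - b) i 0 = a i 0 - b i 0 by rewrite !mxE.
rewrite !subE; apply: K_coord_bound => // t t01.
set w := segment u v t; have wb : in_box lo hi w by exact: segment_in_box.
rewrite -subE -mulmxBl.
apply: (le_trans (norm_coord _ _)); rewrite expr2 (mulrA L).
apply: mulmx_bound => k l; rewrite 2!mxE.
apply: (le_trans (J_lip wb ub k l)); rewrite ler_wpM2l //.
rewrite /w /segment addrC addKr normrZ ler_piMl //.
by case/andP: t01 => t0 t1; rewrite ger0_norm.
Qed.

(** As J is symmetric and kills [q], the pairing of [q] with K is constant. In the Euclidean case
    this is the invariance of the total curvature, as in Gauss-Bonnet. *)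
Lemma K_kernel u v : in_box lo hi u -> in_box lo hi v -> dotv q (K v - K u) = 0.
Proof.
move=> ub vb; have h x y z : in_box lo hi x -> in_box lo hi y -> in_box lo hi z ->
    dotv q (J z *m (y - x)) = 0.
  move=> _ _ zb; have Dz := in_box_domain dhi zb.
  by rewrite -(J_sym Dz) -dotv_mulmxl J_kernel // dotvE big1 // => i _;
    rewrite mxE mul0r.
apply/eqP; rewrite eq_le; apply/andP; split; last first.
  by apply: K_increment => // t t01; rewrite h // ; exact: segment_in_box.
rewrite -oppr_ge0 -dotvNr opprB.
by apply: K_increment => // t t01; rewrite h //; exact: segment_in_box.
Qed.

(** By symmetry an eigenvector with nonzero eigenvalue is orthogonal to the kernel vector [q], so
    coercivity bounds that eigenvalue from below. The entries of J bound it from above. *)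
Lemma J_gapped u : in_box lo hi u -> gapped lam (N%:R * (N%:R * M)) (J u).
Proof.
move=> ub; have Du := in_box_domain dhi ub.
split=> [|a x x0 Jx]; first exact: J_sym.
have [->|a0] := eqVneq a 0; [by left|right].
have qx : dotv q x = 0.
  have : dotv q (J u *m x) = 0.
    by rewrite -(J_sym Du) -dotv_mulmxl J_kernel // dotvE big1 // => i _;
      rewrite mxE mul0r.
  by rewrite Jx dotvZr => /eqP; rewrite mulf_eq0 (negPf a0) => /eqP.
have xx := dotv_gt0 x0; apply/andP; split.
  by have := bb_coercive box ub qx; rewrite Jx dotvZr ler_pM2r.
rewrite -(ler_pM2r xx) -dotvZr -Jx.
have M0 : 0 <= M.
  suff [i0] : inhabited 'I_N by exact: le_trans (normr_ge0 _) (J_bound ub i0 i0).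
  apply: contrapT => h; move/eqP: x0; apply.
  by apply/colP => i; case: h; constructor.
apply: (le_trans (ler_norm _)); apply: (le_trans (dotv_bound _ _)).
rewrite -mulrA ler_wpM2l // -mulrA.
apply: le_trans (ler_wpM2l (normr_ge0 x) (mulmx_bound x (J_bound ub))) _.
rewrite mulrCA ler_wpM2l // mulrCA ler_wpM2l // -expr2.
exact: norm_dotv_le.
Qed.

End OneBox.

End CurvatureOnBox.

Section Clamp.
Variable R : realType.
Implicit Types a b x y : R.

Definition clamp a b x : R := Num.max a (Num.min x b).

Lemma clamp_itv a b x : a <= b -> a <= clamp a b x <= b.
Proof. by rewrite /clamp le_max lexx ge_max => ->; rewrite ge_min lexx orbT. Qed.

Lemma clamp_id a b x : a <= x <= b -> clamp a b x = x.
Proof. by case/andP => ax xb; rewrite /clamp (min_idPl xb) (max_idPr ax). Qed.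

Lemma clamp_lipschitz a b x y : `|clamp a b x - clamp a b y| <= `|x - y|.
Proof.
have h1 := ler_norm (x - y); have h2 : - (x - y) <= `|x - y|.
  by rewrite -normrN ler_norm.
rewrite /clamp; have [xb|bx] := leP x b; have [yb|yb] := leP y b;
  have [ax|xa] := leP a x; have [ay|ya] := leP a y; have [ab|ba] := leP a b;
  rewrite ler_norml; apply/andP; split; lra.
Qed.

End Clamp.

(** * The convex potential of the curvature map *)

Section Potential.
Variables (R : realType) (N : nat) (d : R -> Prop) (q : 'cV[R]_N).
Variables (K : 'cV[R]_N -> 'cV[R]_N) (J : 'cV[R]_N -> 'M[R]_N).
Variable ubar : 'cV[R]_N.
Hypothesis sys : curvature_system d q K J.
Implicit Types (u v x y : 'cV[R]_N) (t : R).

(** The parameter is clamped to [0, 1]: beyond it the segment may leave the domain, while [prim]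
    requires continuity on the whole line. *)
Definition integrand u t : R :=
  dotv (u - ubar) (K (segment ubar u (clamp 0 1 t)) - K ubar).

(* The gradient of this convex function is [K - K ubar]. *)
Definition potential u : R := prim (integrand u) 1.

Lemma segmentB u v t t' : segment u v t' - segment u v t = (t' - t) *: (v - u).
Proof. by rewrite /segment opprD addrACA subrr add0r -scalerBl. Qed.

Lemma integrandE u t : 0 <= t <= 1 ->
  integrand u t = dotv (u - ubar) (K (segment ubar u t) - K ubar).
Proof. by move=> t01; rewrite /integrand clamp_id. Qed.

Lemma integrand0 u : integrand u 0 = 0.
Proof. by rewrite integrandE ?lexx ?ler01 // segment0 subrr /dotv mulmx0 mxE. Qed.

Lemma integrand1 u : integrand u 1 = dotv (u - ubar) (K u - K ubar).
Proof. by rewrite integrandE ?lexx ?ler01 // segment1. Qed.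

Section OneBox.
Variables (lo hi L M lam : R).
Hypothesis box : box_bounds d q J lo hi L M lam.

(** Strong convexity along a ray from [ubar]. Only the two points of the ray have to lie in the box,
    not [u] itself, so that a small box around [ubar] can be used with a distant [u]. *)
Lemma integrand_increment u t t' : 0 <= t -> t <= t' -> t' <= 1 ->
  dotv q (u - ubar) = 0 ->
  in_box lo hi (segment ubar u t) -> in_box lo hi (segment ubar u t') ->
  lam * ((t' - t) * dotv (u - ubar) (u - ubar)) <= integrand u t' - integrand u t.
Proof.
move=> t0 tt' t'1 qw tb tb'.
rewrite !integrandE ?t0 ?t'1 ?(le_trans t0) ?(le_trans tt') //.
rewrite -dotvBr opprB addrA subrK.
apply: (K_increment sys box) => // z z01; rewrite segmentB -scalemxAr dotvZr.
rewrite mulrCA ler_wpM2l ?subr_ge0 //.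
by apply: (bb_coercive box) => //; exact: segment_in_box.
Qed.

Hypothesis ubarb : in_box lo hi ubar.

Lemma integrand_continuous u : in_box lo hi u -> continuous (integrand u).
Proof.
move=> ub.
apply: (@lipschitz_continuous _ _
  (N%:R * (`|u - ubar| * (N%:R * `|M| * `|u - ubar|)))) => x y.
rewrite /integrand -dotvBr opprB addrA subrK.
apply: (le_trans (dotv_bound _ _)); rewrite -!mulrA ler_wpM2l // ler_wpM2l //.
have cb z : in_box lo hi (segment ubar u (clamp 0 1 z)).
  by apply: segment_in_box => //; exact: clamp_itv.
apply: (le_trans (K_lipschitz sys box (cb y) (cb x))).
rewrite -mulrA ler_wpM2l // segmentB normrZ.
rewrite [`|u - ubar| * _]mulrC.
apply: le_trans (_ : `|M| * (`|clamp 0 1 x - clamp 0 1 y| * `|u - ubar|) <= _).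
  by rewrite ler_wpM2r ?ler_norm ?mulr_ge0.
by rewrite ler_wpM2l // ler_wpM2r // clamp_lipschitz.
Qed.

Section AlongVector.
Variable u : 'cV[R]_N.
Hypothesis ub : in_box lo hi u.
Hypothesis qw : dotv q (u - ubar) = 0.
Let w := u - ubar.

Let cont := integrand_continuous ub.

Let segb t : 0 <= t <= 1 -> in_box lo hi (segment ubar u t).
Proof. by move=> t01; exact: segment_in_box. Qed.

Let mono t t' : 0 <= t -> t <= t' -> t' <= 1 -> integrand u t <= integrand u t'.
Proof.
move=> t0 tt' t'1; rewrite -subr_ge0.
apply: le_trans (integrand_increment t0 tt' t'1 qw _ _).
- by rewrite !mulr_ge0 ?dotv_ge0 ?subr_ge0 // ltW // (bb_lam box).
- by apply: segb; rewrite t0 (le_trans tt').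
- by apply: segb; rewrite t'1 (le_trans t0).
Qed.

Lemma gradient_ge : lam * dotv w w <= dotv w (K u - K ubar).
Proof.
have := integrand_increment (lexx 0) ler01 (lexx 1) qw.
rewrite segment0 segment1 subr0 mul1r integrand0 integrand1 subr0; exact.
Qed.

Lemma prim_integrand_ge a t : 0 <= a -> a <= t -> t <= 1 ->
  (t - a) * integrand u a <= prim (integrand u) t - prim (integrand u) a.
Proof.
move=> a0 at' t1.
pose G (z : R) : R := prim (integrand u) z - z * integrand u a.
pose dG (z : R) : R := integrand u z - integrand u a.
have hd (z : R) : a <= z -> is_derive z 1 G (dG z).
  move=> az; have z0 := le_trans a0 az.
  have e := derB (prim_derive cont z0) (derM (derI z) (derC (integrand u a) z)).
  by apply: der_eq e _; rewrite mulr0 addr0 mul1r.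
have : G a <= G t.
  apply: (@derive_ge0_le _ G dG) => // [|z /andP[/ltW az _]|z /andP[/ltW az /ltW zt]].
  - by apply: within_continuous => z /andP[az _]; exact: derive_continuous (hd z az).
  - exact: hd.
  - by rewrite subr_ge0 mono // (le_trans zt).
by rewrite /G /=; lra.
Qed.

(** A nondecreasing integrand has its integral over [0, 1] bounded by its final value. *)
Lemma potential_le : potential u <= dotv w (K u - K ubar).
Proof.
rewrite -/w -integrand1.
pose G (z : R) : R := z * integrand u 1 - prim (integrand u) z.
pose dG (z : R) : R := integrand u 1 - integrand u z.
have hd (z : R) : 0 <= z -> is_derive z 1 G (dG z).
  move=> z0.
  have e := derB (derM (derI z) (derC (integrand u 1) z)) (prim_derive cont z0).
  by apply: der_eq e _; rewrite mulr0 addr0 mul1r.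
have : G 0 <= G 1.
  apply: (@derive_ge0_le _ G dG) => // [|z /andP[/ltW z0 _]|z /andP[/ltW z0 /ltW z1]].
  - by apply: within_continuous => z /andP[z0 _]; exact: derive_continuous (hd z z0).
  - exact: hd.
  - by rewrite subr_ge0 mono.
by rewrite /G /= mul0r mul1r prim0 // /potential; lra.
Qed.

(** The integrand is at least [lam] |w|^2 t, whose integral over [0, 1] is half of its final
    value. *)
Lemma potential_ge : lam / 2 * dotv w w <= potential u.
Proof.
pose c := lam * dotv w w.
pose G (z : R) : R := prim (integrand u) z - c / 2 * (z * z).
pose dG (z : R) : R := integrand u z - c * z.
have hd (z : R) : 0 <= z -> is_derive z 1 G (dG z).
  move=> z0; have e := derB (prim_derive cont z0) (derZ (c / 2) (derM (derI z) (derI z))).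
  by apply: der_eq e _; rewrite /dG; field.
have : G 0 <= G 1.
  apply: (@derive_ge0_le _ G dG) => // [|z /andP[/ltW z0 _]|z /andP[/ltW z0 /ltW z1]].
  - by apply: within_continuous => z /andP[z0 _]; exact: derive_continuous (hd z z0).
  - exact: hd.
  have z01 : 0 <= z <= 1 by rewrite z0.
  have := integrand_increment (lexx 0) z0 z1 qw; rewrite segment0.
  move=> /(_ ubarb (segb z01)).
  by rewrite integrand0 !subr0 -/w /dG subr_ge0 /c; lra.
by rewrite /G /= prim0 // mulr1 !mulr0 subrr subr_ge0 /c /potential; lra.
Qed.

Lemma potential_ge0 : 0 <= potential u.
Proof.
apply: le_trans potential_ge.
by rewrite mulr_ge0 ?dotv_ge0 // divr_ge0 // ltW // (bb_lam box).
Qed.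

End AlongVector.

(** Identifies the gradient without differentiating under the integral sign. [G] interpolates
    between 0 and the first-order remainder of the potential, and its derivative is quadratic in v -
    u by the Taylor and Lipschitz bounds on K. *)
Lemma potential_quadratic : exists2 C, 0 <= C & forall u v,
  in_box lo hi u -> in_box lo hi v ->
  `|potential v - potential u - dotv (K u - K ubar) (v - u)| <= C * `|v - u| ^+ 2.
Proof.
have L0 := bb_L box.
pose C := N%:R * (N%:R * L * (hi - lo)) + N%:R * (N%:R * `|M|).
exists `|C| => // u v ub vb; set dv := v - u.
have [u0|u0] := eqVneq v u.
  rewrite /dv u0 !subrr normr0 expr0n mulr0 add0r.
  by rewrite /dotv mulmx0 mxE oppr0 normr0.
have lh : lo <= hi.
  suff [i0] : inhabited 'I_N by have /andP[] := ub i0; exact: le_trans.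
  apply: contrapT => h; move/eqP: u0; apply.
  by apply/colP => i; case: h; constructor.
pose w := u - ubar.
have cu := integrand_continuous ub; have cv := integrand_continuous vb.
pose G (z : R) : R := prim (integrand v) z - prim (integrand u) z
   - z * dotv dv (K (segment ubar u z) - K ubar).
pose dG (z : R) : R := integrand v z - integrand u z
  - (dotv dv (K (segment ubar u z) - K ubar) + z * dotv dv (J (segment ubar u z) *m w)).
have segb x (t : R) : in_box lo hi x -> 0 <= t <= 1 -> in_box lo hi (segment ubar x t).
  by move=> xb t01; exact: segment_in_box.
have domb x : in_box lo hi x -> coord_domain d x := in_box_domain sys (bb_hi box).
have hd (z : R) : 0 <= z <= 1 -> is_derive z 1 G (dG z).
  move=> z01; have z0 : 0 <= z by case/andP: z01.
  have e1 := dotv_segment_derive sys dv (domb _ (segb u z ub z01)).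
  have e2 := derB e1 (derC (dotv dv (K ubar)) z).
  have e := derB (derB (prim_derive cv z0) (prim_derive cu z0)) (derM (derI z) e2).
  rewrite (_ : G = fun z => prim (integrand v) z - prim (integrand u) z -
    z * (dotv dv (K (segment ubar u z)) - dotv dv (K ubar))); last first.
    by apply/funext => t; rewrite /G dotvBr.
  by apply: der_eq e _; rewrite /dG subr0 mul1r dotvBr.
have hb (z : R) : 0 <= z <= 1 -> `|dG z| <= C * `|dv| ^+ 2.
  move=> z01; have /andP[z0 z1] := z01; rewrite /dG !integrandE //.
  set a := segment ubar u z; set b := segment ubar v z.
  have ab : in_box lo hi a by exact: segb.
  have bb : in_box lo hi b by exact: segb.
  have ba : b - a = z *: dv.
    rewrite /b /a /segment opprD addrACA subrr add0r -scalerBr.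
    by rewrite opprB addrA subrK.
  have zdv : `|z *: dv| <= `|dv| by rewrite normrZ ger0_norm // ler_piMl.
  have symJ := cs_sym sys (domb _ ab).
  (* Symmetry of [J] exchanges [w] and [dv]; this is the closedness that makes the line integral a
     potential, and it cancels the first-order terms. *)
  have -> : z * dotv dv (J a *m w) = dotv w (J a *m (b - a)).
    by rewrite ba -scalemxAr dotvZr -{2}symJ -dotv_mulmxl dotvC.
  have -> : v - ubar = w + dv by rewrite /w /dv [RHS]addrC addrA subrK.
  rewrite -/w.
  have -> : dotv (w + dv) (K b - K ubar) - dotv w (K a - K ubar) -
     (dotv dv (K a - K ubar) + dotv w (J a *m (b - a))) =
     dotv w (K b - K a - J a *m (b - a)) + dotv dv (K b - K a).
    by rewrite !(dotvDl, dotvBr); ring.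
  have t1 := K_taylor sys box ab bb.
  have t2 := K_lipschitz sys box ab bb.
  rewrite ba in t1 t2 *.
  have wle : `|w| <= hi - lo by exact: in_box_dist.
  have dv2 : `|z *: dv| ^+ 2 <= `|dv| ^+ 2.
    by rewrite lerXn2r ?qualifE /=.
  have b1 : `|dotv w (K b - K a - J a *m (z *: dv))| <=
      N%:R * (N%:R * L * (hi - lo)) * `|dv| ^+ 2.
    apply: (le_trans (dotv_bound _ _)); rewrite -[leRHS]mulrA ler_wpM2l //.
    have -> : N%:R * L * (hi - lo) * `|dv| ^+ 2 = (hi - lo) * (N%:R * (L * `|dv| ^+ 2)).
      by ring.
    apply: ler_pM => //; apply: (le_trans t1).
    by rewrite ler_wpM2l // ler_wpM2l.
  have b2 : `|dotv dv (K b - K a)| <= N%:R * (N%:R * `|M|) * `|dv| ^+ 2.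
    apply: (le_trans (dotv_bound _ _)); rewrite -[leRHS]mulrA ler_wpM2l //.
    rewrite expr2 mulrCA ler_wpM2l //; apply: (le_trans t2).
    apply: (@le_trans _ _ (N%:R * `|M| * `|z *: dv|)).
      by rewrite ler_wpM2r // ler_wpM2l ?ler_norm.
    by rewrite ler_wpM2l ?mulr_ge0.
  by apply: (le_trans (ler_normD _ _)); rewrite /C mulrDl; exact: lerD.
have C0 (z : R) : 0 <= z <= 1 -> `|dG z| <= `|C| * `|dv| ^+ 2.
  move=> z01; apply: (le_trans (hb z z01)).
  by rewrite ler_wpM2r ?exprn_ge0 ?ler_norm.
have := lipschitz_of_derive hd C0 (x := 1) (y := 0).
rewrite !lexx !ler01 => /(_ isT isT); rewrite subr0 normr1 mulr1.
rewrite /G /= !prim0 // segment1 mul1r mul0r !subrr subr0.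
by rewrite (dotvC _ dv).
Qed.

End OneBox.

(* Coercivity near [ubar] already forces linear growth of the potential. *)
Lemma potential_proper lo hi L M lam lo0 hi0 L0 M0 lam0 rho u :
  box_bounds d q J lo hi L M lam -> in_box lo hi ubar ->
  box_bounds d q J lo0 hi0 L0 M0 lam0 -> 0 < rho ->
  (forall x, `|x - ubar| <= rho -> in_box lo0 hi0 x) ->
  in_box lo hi u -> dotv q (u - ubar) = 0 ->
  lam0 * rho * (`|u - ubar| - rho) <= potential u.
Proof.
move=> box ubarb box0 rho0 nb ub qw; set w := u - ubar.
have l0 := bb_lam box0.
have [wr|rw] := leP `|w| rho.
  apply: le_trans (potential_ge0 box ubarb ub qw).
  by rewrite mulr_ge0_le0 ?subr_le0 // mulr_ge0 // ltW.
have w0 : 0 < `|w| := lt_trans rho0 rw.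
(* The parameter at which the segment from [ubar] to [u] leaves the ball of radius [rho]. From there
   on the integrand stays above its value at [a]. *)
pose a := rho / `|w|.
have a0 : 0 <= a by rewrite divr_ge0 // ltW.
have a1 : a <= 1 by rewrite ler_pdivrMr // mul1r ltW.
have segn (t : R) : 0 <= t <= a -> in_box lo0 hi0 (segment ubar u t).
  move=> /andP[t0 ta]; apply: nb.
  by rewrite /segment addrAC subrr add0r normrZ ger0_norm // -ler_pdivlMr.
have h1 : lam0 * (a * dotv w w) <= integrand u a.
  have := integrand_increment box0 (lexx 0) a0 a1 qw.
  by rewrite integrand0 !subr0; apply; apply: segn; rewrite ?lexx ?a0.
have h2 : a * `|w| ^+ 2 <= a * dotv w w by rewrite ler_wpM2l // norm_dotv_le.
have h3 : a * `|w| ^+ 2 = rho * `|w| by rewrite /a expr2; field; rewrite gt_eqF.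
have h4 : lam0 * (rho * `|w|) <= integrand u a.
  by apply: le_trans h1; rewrite ler_pM2l // -h3.
have h5 := prim_integrand_ge box ubarb ub qw (lexx 0) a0 a1.
have h6 := prim_integrand_ge box ubarb ub qw a0 a1 (lexx 1).
have cont := integrand_continuous box ubarb ub.
rewrite integrand0 mulr0 prim0 // subr0 in h5.
have h7 : (1 - a) * (lam0 * (rho * `|w|)) <= (1 - a) * integrand u a.
  by rewrite ler_wpM2l // subr_ge0.
have h8 : (1 - a) * (lam0 * (rho * `|w|)) = lam0 * rho * (`|w| - rho).
  by rewrite /a; field; rewrite gt_eqF.
by rewrite /potential; lra.
Qed.

End Potential.

(** * Difference quotients and confinement to a box *)

Section Trapping.
Variable R : realType.
Implicit Types (f : R -> R) (t a e : R).

Lemma continuous_delta f t e : {for t, continuous f} -> 0 < e ->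
  exists2 del, 0 < del & forall z, `|z - t| < del -> `|f z - f t| < e.
Proof.
move=> cf e0; move/cvgrPdist_lt : cf => /(_ e e0) /nbhs_ballP[del /= d0 h].
by exists del => // z zt; rewrite distrC; apply: h; rewrite /ball /= distrC.
Qed.

(** Bridges two-sided derivatives and the difference quotients of [calabi_flow]. In Caratheodory
    form, the quotient extended by [a] at [t] is continuous there. *)
Lemma derive_quotient f t a : is_derive t 1 f a <->
  (z - t)^-1 * (f z - f t) @[z --> t^'] --> a.
Proof.
pose g z := if z == t then a else (z - t)^-1 * (f z - f t).
have gt' : {near t^', (fun z => (z - t)^-1 * (f z - f t)) =1 g}.
  near=> z; rewrite /g ifN //; near: z.
  exact: nbhs_dnbhs_neq.
have gg : g t = a by rewrite /g eqxx.
rewrite is_derive1_caratheodory; split => [[h [hE hc ha]]|fa].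
  move/continuous_withinNx : hc; rewrite ha; apply: cvg_trans.
  apply: near_eq_cvg; near=> z; rewrite hE mulrC mulfK // subr_eq0.
  near: z; exact: nbhs_dnbhs_neq.
exists g; split => //.
  move=> z; rewrite /g; have [->|zt] := eqVneq z t; first by rewrite !subrr mulr0.
  by rewrite mulrC mulVKf // subr_eq0.
apply/continuous_withinNx; rewrite gg; apply: cvg_trans fa.
exact: near_eq_cvg.
Unshelve. all: end_near. Qed.

Lemma derive_neg_right f t a : is_derive t 1 f a -> a < 0 ->
  exists2 del, 0 < del & forall z, t < z < t + del -> f z < f t.
Proof.
move=> /is_derive1_caratheodory[g [gE gc ga]] a0.
have na : 0 < - a by rewrite oppr_gt0.
have [del d0 h] := continuous_delta gc na.
exists del => // z /andP[tz zt]; rewrite -subr_lt0 gE pmulr_llt0 ?subr_gt0 //.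
have := h z; rewrite ger0_norm ?subr_ge0 ?ltW // ltrBlDl => /(_ zt).
rewrite ga => /(le_lt_trans (ler_norm _)); lra.
Qed.

(** Yields continuity relative to [I], also at an endpoint where the derivative is one-sided. *)
Lemma difference_quotient_bound f (I : set R) t a :
  (z - t)^-1 * (f z - f t) @[z --> within I t^'] --> a ->
  exists2 del, 0 < del & forall z, I z -> `|z - t| < del ->
    `|f z - f t| <= (`|a| + 1) * `|z - t|.
Proof.
move=> /cvgrPdist_lt /(_ 1 ltr01) /nbhs_ballP[del /= d0 h].
exists del => // z Iz zt; have [->|zt'] := eqVneq z t.
  by rewrite !subrr normr0 mulr0.
have := h z _ zt' Iz; rewrite /ball /= distrC => /(_ zt) h1.
have zt0 : z - t != 0 by rewrite subr_eq0.
rewrite -[f z - f t](mulVKf zt0) normrM mulrC ler_wpM2r //.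
have := ler_normD ((z - t)^-1 * (f z - f t) - a) a; rewrite subrK distrC.
by move/le_trans; apply; rewrite addrC lerD2l ltW.
Qed.

Lemma common_delta n (P : 'I_n -> R -> Prop) :
  (forall i, exists2 del, 0 < del & forall z, 0 < z < del -> P i z) ->
  exists2 del, 0 < del & forall z, 0 < z < del -> forall i, P i z.
Proof.
move=> hP; have /choice[del hdel] i :
    exists del, 0 < del /\ forall z, 0 < z < del -> P i z.
  by have [e e0 he] := hP i; exists e.
exists (\big[Num.min/1]_i del i).
  by apply: lt_bigmin => // i _; case: (hdel i).
move=> z /andP[z0 zd] i; have [_ h] := hdel i; apply: h; rewrite z0 /=.
by apply: lt_le_trans zd _; exact: bigmin_le_cond.
Qed.

(** Take the supremum T of the times up to which the curve is confined. By continuity it is still in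
    the box at T; it is off the lower face, and it is either off the upper face or moving down from
    it, so confinement lasts beyond T. The exit hypothesis may assume confinement up to T, which is
    where a priori estimates enter. *)
Lemma trapped_in_box N (u : R -> 'cV[R]_N) lo hi :
  (forall t, 0 <= t -> forall i, {for t, continuous (fun z => u z i 0)}) ->
  in_box lo hi (u 0) ->
  (forall T, 0 <= T -> (forall t, 0 <= t <= T -> in_box lo hi (u t)) ->
    forall i, lo < u T i 0 /\ (u T i 0 < hi \/
      exists2 a, a < 0 & is_derive T 1 (fun z => u z i 0) a)) ->
  forall t, 0 <= t -> in_box lo hi (u t).
Proof.
move=> uc u0 exit t1 t10; apply: contrapT => nb.
pose S := [set T | 0 <= T /\ forall t, 0 <= t <= T -> in_box lo hi (u t)].
have S0 : S 0.
  split=> // t /andP[t0 t0']; suff -> : t = 0 by [].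
  by apply/eqP; rewrite eq_le t0 t0'.
have Sub : ubound S t1.
  move=> T [T0 hT]; rewrite leNgt; apply/negP => t1T; apply: nb.
  by apply: hT; rewrite t10 ltW.
have hS : has_sup S by split; [exists 0|exists t1].
set T := sup S; have T0 : 0 <= T by exact: sup_upper_bound.
have below t : 0 <= t -> t < T -> in_box lo hi (u t).
  move=> t0 tT; have [T' [T'0 hT'] tT'] := sup_gt (ex_intro _ 0 S0) tT.
  by apply: hT'; rewrite t0 ltW.
have uT : in_box lo hi (u T).
  have [T0'|T0'] := leP T 0.
    by have -> : T = 0 by apply/eqP; rewrite eq_le T0 T0'.
  move=> i; have close e : 0 < e -> exists2 t, `|u t i 0 - u T i 0| < e & in_box lo hi (u t).
    move=> e0; have [del d0 h] := continuous_delta (uc T T0 i) e0.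
    pose t := Num.max 0 (T - del / 2).
    have tT : t < T by rewrite /t gt_max T0'; lra.
    have t0 : 0 <= t by rewrite /t le_max lexx.
    exists t; last exact: below.
    apply: h; rewrite ler0_norm; last by rewrite subr_le0 ltW.
    have : T - del / 2 <= t by rewrite /t le_max lexx orbT.
    lra.
  apply/andP; split; rewrite leNgt; apply/negP => bad.
    have e0 : 0 < lo - u T i 0 by lra.
    have [t ht /(_ i)/andP[h1 h2]] := close _ e0.
    by move: ht; rewrite ltr_norml; lra.
  have e0 : 0 < u T i 0 - hi by lra.
  have [t ht /(_ i)/andP[h1 h2]] := close _ e0.
  by move: ht; rewrite ltr_norml; lra.
have upto t : 0 <= t <= T -> in_box lo hi (u t).
  move=> /andP[t0]; rewrite le_eqVlt => /predU1P[->//|]; exact: below.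
have [i|del d0 hdel] := @common_delta N (fun i z => lo <= u (T + z) i 0 <= hi).
  have [h1 h2] := exit T T0 upto i.
  have e1 : 0 < u T i 0 - lo by rewrite subr_gt0.
  have [d1 d10 k1] := continuous_delta (uc T T0 i) e1.
  have kk z : 0 < z < d1 -> lo <= u (T + z) i 0.
    move=> /andP[z0 zd]; have := k1 (T + z); rewrite addrAC subrr add0r.
    by rewrite gtr0_norm // => /(_ zd); rewrite ltr_norml; lra.
  case: h2 => [h2|[a a0 ha]].
    have e2 : 0 < hi - u T i 0 by rewrite subr_gt0.
    have [d2 d20 k2] := continuous_delta (uc T T0 i) e2.
    exists (Num.min d1 d2); first by rewrite lt_min d10.
    move=> z /andP[z0]; rewrite lt_min => /andP[zd1 zd2].
    rewrite kk ?z0 //=; have := k2 (T + z); rewrite addrAC subrr add0r.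
    by rewrite gtr0_norm // => /(_ zd2); rewrite ltr_norml; lra.
  have [d2 d20 k2] := derive_neg_right ha a0.
  exists (Num.min d1 d2); first by rewrite lt_min d10.
  move=> z /andP[z0]; rewrite lt_min => /andP[zd1 zd2].
  rewrite kk ?z0 //=; apply: (@le_trans _ _ (u T i 0)).
    by apply/ltW/k2; rewrite ltrDl z0 ltrD2l.
  by have /andP[] := uT i.
have : S (T + del / 2).
  split; first by lra.
  move=> t /andP[t0 tT]; have [tT'|tT'] := leP t T; first by apply: upto; rewrite t0.
  have -> : t = T + (t - T) by ring.
  by apply: hdel; lra.
by move=> /(sup_upper_bound hS); rewrite -/T; lra.
Qed.

End Trapping.

(** * The flow field on a box: regularity and dissipation *)

Section FlowField.
Variables (R : realType) (N : nat) (d : R -> Prop) (q : 'cV[R]_N).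
Variables (K : 'cV[R]_N -> 'cV[R]_N) (J : 'cV[R]_N -> 'M[R]_N).
Variables (ubar : 'cV[R]_N) (s : R).
Hypothesis sys : curvature_system d q K J.
Implicit Types (u v x y : 'cV[R]_N).

Definition flow_field u : 'cV[R]_N :=
  - (spectral_power s (J u) *m (K u - K ubar)).

Lemma flow_fieldE u : coord_domain d u ->
  frac_laplacian K s u *m (K u - K ubar) = flow_field u.
Proof.
by move=> Du; rewrite /frac_laplacian (jacobianE sys Du) mulNmx.
Qed.

Section OneBox.
Variables (lo hi L M lam : R).
Hypothesis box : box_bounds d q J lo hi L M lam.
Hypothesis ubarb : in_box lo hi ubar.

Let up := N%:R * (N%:R * M).
Let gap u : in_box lo hi u -> gapped lam up (J u) := @J_gapped _ _ _ _ _ _ sys _ _ _ _ _ box u.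
Let lam0 := bb_lam box.

Lemma flow_field_kernel u : in_box lo hi u -> dotv q (flow_field u) = 0.
Proof.
move=> ub; rewrite /flow_field dotvNr -(spectral_power_sym s lam0 (gap ub)).
rewrite -dotv_mulmxl (spectral_power_kernel s lam0 (gap ub)).
  by rewrite /dotv trmx0 mul0mx mxE oppr0.
exact: (cs_kernel sys (in_box_domain sys (bb_hi box) ub)).
Qed.

Lemma flow_field_lipschitz : exists KX BX,
  (forall u v, in_box lo hi u -> in_box lo hi v ->
    `|flow_field u - flow_field v| <= KX * `|u - v|) /\
  (forall u, in_box lo hi u -> `|flow_field u| <= BX).
Proof.
have [Ks Ks0 hKs] := @spectral_power_lipschitz R N lam up s lam0.
have L0 := bb_L box.
have entry (A B : 'M[R]_N) e : gapped lam up A -> gapped lam up B -> 0 <= e ->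
    (forall i j, `|(A - B) i j| <= e) ->
    forall i j, `|(spectral_power s A - spectral_power s B) i j| <= Ks * (N%:R * e).
  move=> gA gB e0 h i j.
  rewrite -ler_sqr ?qualifE /= ?mulr_ge0 // real_normK ?num_real //.
  apply: le_trans (fro2_entry _ i j) _; apply: (le_trans (hKs _ _ gA gB)).
  by rewrite exprMn ler_wpM2l ?sqr_ge0 // fro2_bound.
have dist u v : in_box lo hi u -> in_box lo hi v -> `|u - v| <= `|hi - lo|.
  move=> ub vb; apply: norm_leP => // i.
  have lh : lo <= hi by have /andP[] := ub i; exact: le_trans.
  rewrite (@ger0_norm _ (hi - lo)) ?subr_ge0 //.
   exact: le_trans (norm_coord _ _) (in_box_dist lh ub vb).
have Fb u : in_box lo hi u -> `|K u - K ubar| <= N%:R * `|M| * `|hi - lo|.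
  move=> ub; apply: (le_trans (K_lipschitz sys box ubarb ub)).
  apply: (@le_trans _ _ (N%:R * `|M| * `|u - ubar|)).
    by rewrite ler_wpM2r // ler_wpM2l ?ler_norm.
  by rewrite ler_wpM2l ?mulr_ge0 // dist.
have Sb u : in_box lo hi u -> forall i j,
    `|spectral_power s (J u) i j| <= Ks * (N%:R * `|M|).
  move=> ub i j.
  (* The power of [J u] is bounded by comparison with the zero matrix, which is gapped and has zero
     power. *)
  have h (k l : 'I_N) : `|(J u - 0) k l| <= `|M|.
    rewrite subr0; apply: le_trans (bb_bound box ub k l) _; exact: ler_norm.
  have := entry _ _ _ (gap ub) (gapped0 N lam up) (normr_ge0 M) h i j.
  by rewrite spectral_power0 subr0.
exists (N%:R * (Ks * (N%:R * `|M|)) * (N%:R * `|M|) +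
  N%:R * (Ks * (N%:R * L)) * (N%:R * `|M| * `|hi - lo|)).
exists (N%:R * (Ks * (N%:R * `|M|) * (N%:R * `|M| * `|hi - lo|))).
split=> [u v ub vb|u ub]; last first.
  rewrite normrN; apply: (le_trans (mulmx_bound _ (Sb u ub))).
  by rewrite ler_wpM2l // ler_wpM2l ?mulr_ge0 // Fb.
have -> : flow_field u - flow_field v =
    - (spectral_power s (J u) *m (K u - K v) +
       (spectral_power s (J u) - spectral_power s (J v)) *m (K v - K ubar)).
  rewrite /flow_field -opprD; congr (- _).
  rewrite mulmxBl addrA -mulmxDr.
  by rewrite addrA subrK.
rewrite normrN; apply: (le_trans (ler_normD _ _)); rewrite mulrDl; apply: lerD.
  apply: (le_trans (mulmx_bound _ (Sb u ub))).
  rewrite -!mulrA ler_wpM2l // ler_wpM2l // ler_wpM2l // ler_wpM2l //.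
  apply: (le_trans (K_lipschitz sys box vb ub)).
  by rewrite -!mulrA ler_wpM2l // ler_wpM2r // ler_norm.
have h (k l : 'I_N) : `|(J u - J v) k l| <= L * `|u - v|.
  by rewrite !mxE; exact: (bb_lip box ub vb).
have := entry _ _ _ (gap ub) (gap vb) (mulr_ge0 L0 (normr_ge0 (u - v))) h.
move=> /(mulmx_bound (K v - K ubar)) /le_trans; apply.
rewrite -!mulrA ler_wpM2l // ler_wpM2l // ler_wpM2l // ler_wpM2l //.
rewrite [`|u - v| * _]mulrC !mulrA ler_wpM2r //.
exact: Fb.
Qed.

(** With F = K u - K ubar and w = u - ubar, the dissipation F . L^s F is at least [c0] F . L F,
    hence at least [c0 * lam] |F|^2 because F is orthogonal to [q]. Moreover |F|^2 >= [lam] w . F,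
    and convexity bounds the potential by w . F. *)
Lemma potential_descent : exists2 c, 0 < c & forall u,
  in_box lo hi u -> dotv q (u - ubar) = 0 ->
  dotv (K u - K ubar) (flow_field u) <= - c * potential K ubar u.
Proof.
have [c0 c00 hc] := @spectral_power_ge R N lam up s lam0.
exists (c0 * lam * lam); first by rewrite !mulr_gt0.
move=> u ub qw; set F := K u - K ubar; set w := u - ubar.
rewrite /flow_field dotvNr mulNr lerN2.
apply: le_trans (hc _ F (gap ub)).
have h1 : lam * dotv F F <= dotv F (J u *m F).
  by apply: (bb_coercive box) => //; exact: (K_kernel sys box).
have h2 : lam * dotv w w <= dotv w F := gradient_ge sys box ubarb ub qw.
have h3 : potential K ubar u <= dotv w F := potential_le sys box ubarb ub qw.
have h4 : lam * dotv w F <= dotv F F.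
  (* Expanding |F - lam w|^2 >= 0 and using lam |w|^2 <= w . F gives |F|^2 >= lam w . F, with no
     division by |w|. *)
  have sq (a b : 'cV[R]_N) l :
      0 <= dotv a a - 2 * l * dotv b a + l * (l * dotv b b).
    have := dotv_ge0 (a - l *: b).
    by rewrite !(dotvBl, dotvBr, dotvZl, dotvZr) (dotvC a b); lra.
  have := sq F w lam; have := ler_wpM2l (ltW lam0) h2; lra.
rewrite -!mulrA ler_pM2l //; apply: le_trans h1; rewrite ler_pM2l //.
by apply: le_trans h4; rewrite ler_pM2l.
Qed.

End OneBox.

(** The form used for uniqueness: the one-sided derivative at 0 is weakened to continuity there, and
    the equation is kept at interior times, where derivatives are two-sided. *)
Definition flow_solution (b : R) (v : R -> 'cV[R]_N) :=
  [/\ forall t, 0 <= t < b -> coord_domain d (v t),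
      forall t, 0 < t < b -> forall i,
        is_derive t 1 (fun z => v z i 0) (flow_field (v t) i 0)
    & forall T, T < b -> forall i, {within `[0, T], continuous (fun z => v z i 0)}].

Lemma calabi_flow_solution b u0 (v : R -> 'cV[R]_N) :
  calabi_flow K (coord_domain d) s (K ubar) u0 `[0, b[ v -> flow_solution b v.
Proof.
move=> [_ hv]; have itvP' (t : R) : 0 <= t < b -> `[0, b[%classic t by rewrite /= in_itv.
split.
- by move=> t /itvP' /hv [].
- move=> t /andP[t0 tb] i.
  have [Dt /(_ i)] := hv t (itvP' t (introT andP (conj (ltW t0) tb))).
  rewrite (flow_fieldE Dt) => cv; apply/derive_quotient.
  apply: cvg_trans cv; apply: cvg_app => P /= PI.
  (* Around an interior time the restriction to the interval is invisible to the limit. *)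
  have tI : t^' `[0, b[%classic.
    apply: nbhs_dnbhs; near=> z; rewrite /= in_itv /=; apply/andP; split.
      by apply/ltW; near: z; exact: lt_nbhsr.
    by near: z; exact: lt_nbhsl.
  have PI2 : t^' (fun z => `[0, b[%classic z -> P z) by exact: PI.
  by apply: filterS2 tI PI2 => z Iz h; exact: h.
move=> T Tb i; apply/subspace_continuousP => t /=; rewrite in_itv /= => /andP[t0 tT].
have tb : 0 <= t < b by rewrite t0 (le_lt_trans tT).
have [_ /(_ i)] := hv t (itvP' t tb).
move=> /difference_quotient_bound[del del0 h].
set C := `|_| + 1 in h; have C0 : 0 < C by rewrite ltr_wpDl.
apply/cvgrPdist_lt => e e0; near=> z.
have zI : `[0, b[%classic z.
  have : `[0, T]%classic z by near: z; exact: withinT.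
  by rewrite /= !in_itv /= => /andP[-> zT]; exact: le_lt_trans Tb.
have zt : `|z - t| < Num.min del (e / C).
  near: z; apply: cvg_within.
  have m0 : 0 < Num.min del (e / C) by rewrite lt_min del0 divr_gt0.
  by exists (Num.min del (e / C)) => //= z; rewrite distrC.
move: zt; rewrite lt_min => /andP[zd ze]; rewrite distrC.
apply: (le_lt_trans (h z zI zd)).
by rewrite mulrC -ltr_pdivlMr.
Unshelve. all: end_near. Qed.

End FlowField.

Lemma within_continuous_sum (R : realType) (I : Type) (r : seq I)
    (A : set R) (h : I -> R -> R) :
  (forall i, {within A, continuous (h i)}) ->
  {within A, continuous (fun t => \sum_(i <- r) h i t)}.
Proof.
move=> hc; elim: r => [|i r IH] x.
  by under eq_fun do rewrite big_nil; exact: cvg_cst.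
under eq_fun do rewrite big_cons.
by apply: cvgD; [exact: hc|exact: IH].
Qed.

(** * Uniqueness of solutions *)

Section Uniqueness.
Variables (R : realType) (N : nat) (d : R -> Prop) (q : 'cV[R]_N).
Variables (K : 'cV[R]_N -> 'cV[R]_N) (J : 'cV[R]_N -> 'M[R]_N).
Variables (ubar : 'cV[R]_N) (s : R).
Hypothesis sys : curvature_system d q K J.
Hypothesis ubarD : coord_domain d ubar.
Variable a0 : R.
Hypothesis da0 : d a0.
Implicit Types (u v : 'cV[R]_N).

(** The point [a0] seeds the extrema, so that [hi] lies in [d] even when there are no coordinates. A
    maximum of points of [d] is one of them, hence stays in [d]. *)
Lemma coord_hull (I : Type) (A : I -> Prop) (w : I -> 'cV[R]_N) :
  (forall i, exists l h, d h /\ forall t, A t -> l <= w t i 0 <= h) ->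
  exists lo hi, [/\ d hi, lo <= a0, a0 <= hi & forall t, A t -> in_box lo hi (w t)].
Proof.
move=> /choice[l /choice[h hP]].
exists (\big[Num.min/a0]_i l i), (\big[Num.max/a0]_i h i); split.
- elim/big_ind : _ => // [x y dx dy|i _]; last by case: (hP i).
  by rewrite maxEle; case: ifP.
- exact: bigmin_le_id.
- exact: bigmax_ge_id.
move=> t At i; have [_ /(_ t At)/andP[h1 h2]] := hP i; apply/andP; split.
  by apply: le_trans h1; exact: bigmin_le_cond.
by apply: (le_trans h2); exact: le_bigmax_cond.
Qed.

Lemma in_box_weaken lo hi lo' hi' u : lo' <= lo -> hi <= hi' ->
  in_box lo hi u -> in_box lo' hi' u.
Proof.
by move=> l h ub i; have /andP[h1 h2] := ub i; rewrite (le_trans l) ?(le_trans h2).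
Qed.

Lemma domain_max x y : d x -> d y -> d (Num.max x y).
Proof. by move=> dx dy; rewrite maxEle; case: ifP. Qed.

Lemma point_hull u : coord_domain d u ->
  exists lo hi, [/\ d hi, lo <= a0, a0 <= hi & in_box lo hi u].
Proof.
move=> Du; have [i|lo [hi [h1 h2 h3 h4]]] := @coord_hull unit (fun=> True) (fun=> u).
  by exists (u i 0), (u i 0); split => // _ _; rewrite lexx.
by exists lo, hi; split => //; exact: (h4 tt).
Qed.

Lemma solution_hull b T (w : R -> 'cV[R]_N) : 0 <= T < b ->
  flow_solution d K J ubar s b w ->
  exists lo hi, [/\ d hi, lo <= a0, a0 <= hi &
    forall t, 0 <= t <= T -> in_box lo hi (w t)].
Proof.
move=> /andP[T0 Tb] [wD _ wc]; apply: coord_hull => i.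
have [m /=] := EVT_max T0 (wc T Tb i); rewrite in_itv /= => /andP[m0 mT] hm.
have [m' /=] := EVT_min T0 (wc T Tb i); rewrite in_itv /= => /andP[m'0 m'T] hm'.
exists (w m' i 0), (w m i 0); split.
  by apply: wD; rewrite m0 (le_lt_trans mT).
by move=> t tT; rewrite hm ?hm' ?in_itv.
Qed.

(** On [0, T] both solutions and [ubar] lie in a common box by compactness, and the field is
    Lipschitz on it. Gronwall is applied to the squared Euclidean distance, which is differentiable,
    unlike the maximum norm. *)
Lemma flow_unique b (u v : R -> 'cV[R]_N) : u 0 = v 0 ->
  flow_solution d K J ubar s b u -> flow_solution d K J ubar s b v ->
  forall t, 0 <= t < b -> v t = u t.
Proof.
move=> uv0 su sv T /[dup] Tb /andP[T0 Tb'].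
have [lu [hu [dhu lua ahu ub]]] := solution_hull Tb su.
have [lv [hv [dhv lva ahv vb]]] := solution_hull Tb sv.
have [lb [hb [dhb lba ahb bb]]] := point_hull ubarD.
pose lo := Num.min lb (Num.min lu lv); pose hi := Num.max hb (Num.max hu hv).
have dhi : d hi by apply: domain_max => //; exact: domain_max.
have {}ub t : 0 <= t <= T -> in_box lo hi (u t).
  by move=> /ub; apply: in_box_weaken; rewrite ?le_max ?ge_min lexx ?orbT.
have {}vb t : 0 <= t <= T -> in_box lo hi (v t).
  by move=> /vb; apply: in_box_weaken; rewrite ?le_max ?ge_min lexx ?orbT.
have {}bb : in_box lo hi ubar.
  by move: bb; apply: in_box_weaken; rewrite ?le_max ?ge_min lexx.
have [L [M [lam box]]] := box_bounds_exist sys lo dhi.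
have [KX [BX [hK _]]] := flow_field_lipschitz s sys box bb.
have [_ du cu] := su; have [_ dv cv] := sv.
pose z t := \sum_i (v t i 0 - u t i 0) * (v t i 0 - u t i 0).
have zE t : z t = dotv (v t - u t) (v t - u t).
  by rewrite dotvE; apply: eq_bigr => i _; rewrite !mxE.
pose f i t := flow_field K J ubar s (v t) i 0 - flow_field K J ubar s (u t) i 0.
pose dz t := \sum_i (f i t * (v t i 0 - u t i 0) + (v t i 0 - u t i 0) * f i t).
have hz t : 0 < t < T -> is_derive t 1 z (dz t).
  move=> /andP[t0 tT]; apply: der_sum => i _.
  have tb : 0 < t < b by rewrite t0 (lt_trans tT).
  have e := derB (dv t tb i) (du t tb i).
  exact: (derM e e).
have cz : {within `[0, T], continuous z}.
  apply: within_continuous_sum => i x.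
  by apply: cvgM; apply: cvgB; [exact: cv|exact: cu|exact: cv|exact: cu].
have dzle t : 0 < t < T -> dz t <= (2 * N%:R * `|KX|) * z t.
  move=> /andP[/ltW t0 /ltW tT]; have t0T : 0 <= t <= T by rewrite t0.
  have -> : dz t = 2 * dotv (v t - u t)
      (flow_field K J ubar s (v t) - flow_field K J ubar s (u t)).
    rewrite dotvE mulr_sumr; apply: eq_bigr => i _.
    by rewrite /f (mxE _ _ i) [(v t - u t) i 0]mxE !mxE; ring.
  rewrite -!mulrA ler_pM2l //.
  apply: (le_trans (ler_norm _)); apply: (le_trans (dotv_bound _ _)).
  rewrite ler_wpM2l // zE.
  apply: (@le_trans _ _ (`|KX| * `|v t - u t| ^+ 2)); last first.
    by rewrite ler_wpM2l // norm_dotv_le.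
  rewrite expr2 mulrCA ler_wpM2l //.
  apply: (le_trans (hK _ _ (vb t t0T) (ub t t0T))).
  by rewrite ler_wpM2r // ler_norm.
have := gronwall T0 cz hz dzle.
rewrite {2}/z uv0 big1 => [|i _]; last by rewrite subrr mulr0.
rewrite mulr0 zE => h; apply/eqP; rewrite -subr_eq0; apply/eqP.
by apply: dotv_eq0; apply/eqP; rewrite eq_le h dotv_ge0.
Qed.

End Uniqueness.

Section ClampVector.
Variables (R : realType) (N : nat) (lo hi : R).
Implicit Types u v : 'cV[R]_N.

Definition clampv u : 'cV[R]_N := \col_i clamp lo hi (u i 0).

Lemma clampv_in_box u : lo <= hi -> in_box lo hi (clampv u).
Proof. by move=> lh i; rewrite mxE clamp_itv. Qed.

Lemma clampv_id u : in_box lo hi u -> clampv u = u.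
Proof. by move=> ub; apply/colP => i; rewrite mxE clamp_id. Qed.

Lemma clampv_lipschitz u v : `|clampv u - clampv v| <= `|u - v|.
Proof.
apply: norm_leP => // i; rewrite !mxE; apply: (le_trans (clamp_lipschitz _ _ _ _)).
by have := norm_coord (u - v) i; rewrite !mxE.
Qed.

End ClampVector.

(** Functions in contact to second order share their derivative. It is applied to the potential
    along the flow and its linearization. *)
Lemma derive_quadratic_remainder (R : realType) (f g : R -> R) (t a C del : R) :
  0 < del -> is_derive t 1 g a ->
  (forall z, `|z - t| < del ->
     `|f z - f t - (g z - g t)| <= C * `|z - t| ^+ 2) ->
  is_derive t 1 f a.
Proof.
move=> del0 ga h.
suff h0 : is_derive t 1 (fun z => f z - g z) 0.
  have := derD h0 ga; rewrite add0r; congr (is_derive _ _ _ _).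
  by apply/funext => z; rewrite subrK.
apply/is_derive1_caratheodory.
exists (fun z => (z - t)^-1 * (f z - g z - (f t - g t))); split.
- move=> z; have [->|zt] := eqVneq z t; first by rewrite !subrr mulr0.
  by rewrite mulrC mulVKf // subr_eq0.
- apply/cvgrPdist_lt => e e0; rewrite subrr invr0 mul0r.
  have C1 : 0 < `|C| + 1 by rewrite ltr_wpDl.
  have m0 : 0 < Num.min del (e / (`|C| + 1)) by rewrite lt_min del0 divr_gt0.
  exists (Num.min del (e / (`|C| + 1))) => // z; rewrite /ball_ /= distrC lt_min.
  move=> /andP[zd ze]; rewrite sub0r normrN.
  have [->|zt] := eqVneq z t; first by rewrite subrr invr0 mul0r normr0.
  have zt0 : 0 < `|z - t| by rewrite normr_gt0 subr_eq0.
  rewrite normrM normfV mulrC ltr_pdivrMr //.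
  have -> : f z - g z - (f t - g t) = f z - f t - (g z - g t) by ring.
  apply: (le_lt_trans (h z zd)); rewrite expr2 mulrA ltr_pM2r //.
  apply: (@le_lt_trans _ _ ((`|C| + 1) * `|z - t|)); last first.
    by rewrite mulrC -ltr_pdivlMr.
  by rewrite ler_wpM2r // (le_trans (ler_norm _)) // lerDl.
- by rewrite subrr invr0 mul0r.
Qed.

(** * Global existence and exponential convergence *)

Section CurvatureFlow.
Variables (R : realType) (N : nat) (d : R -> Prop) (q : 'cV[R]_N).
Variables (K : 'cV[R]_N -> 'cV[R]_N) (J : 'cV[R]_N -> 'M[R]_N).
Variables (ubar : 'cV[R]_N) (s : R).
Hypothesis sys : curvature_system d q K J.

Let X := flow_field K J ubar s.
Let W := potential K ubar.

Section ClampedFlow.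
Variables (lo hi L M lam : R).
Hypothesis box : box_bounds d q J lo hi L M lam.
Hypothesis ubarb : in_box lo hi ubar.
Hypothesis lohi : lo <= hi.

Let Y v := X (clampv lo hi v).

Lemma clamped_flow_exists u0 : exists u : R -> 'cV[R]_N, u 0 = u0 /\
  forall t : R, 0 <= t -> forall i, is_derive t 1 (fun z => u z i 0) (Y (u t) i 0).
Proof.
have [KX [BX [hK hB]]] := flow_field_lipschitz s sys box ubarb.
have cb (v : 'cV[R]_N) : in_box lo hi (clampv lo hi v) by exact: clampv_in_box.
apply: (@picard_lindelof _ _ Y u0 (`|KX| + 1) BX).
- by rewrite lerDr.
- move=> v w; have := hK _ _ (cb v) (cb w); move=> /le_trans; apply.
  apply: (@le_trans _ _ ((`|KX| + 1) * `|clampv lo hi v - clampv lo hi w|)).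
    by rewrite ler_wpM2r // (le_trans (ler_norm _)) // lerDl.
  by rewrite ler_wpM2l ?clampv_lipschitz // addr_ge0.
- by move=> v; exact: hB.
Qed.

Variable u : R -> 'cV[R]_N.
Hypothesis u_derive :
  forall t : R, 0 <= t -> forall i, is_derive t 1 (fun z => u z i 0) (Y (u t) i 0).

(** The field is orthogonal to the kernel of L. In the Euclidean case this is the conservation of
    the sum of the coordinates. *)
Lemma clamped_flow_orthogonal : dotv q (u 0 - ubar) = 0 ->
  forall t, 0 <= t -> dotv q (u t - ubar) = 0.
Proof.
move=> q0 t t0; rewrite -q0.
pose g z := \sum_i q i 0 * u z i 0.
have gE z : dotv q (u z - ubar) = g z - dotv q ubar by rewrite dotvBr dotvE.
have hg (z : R) : 0 <= z <= t -> is_derive z 1 g (dotv q (Y (u z))).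
  move=> /andP[z0 _]; rewrite dotvE; apply: der_sum => i _.
  exact: derZ (u_derive z0 i).
have hb (z : R) : 0 <= z <= t -> `|dotv q (Y (u z))| <= 0.
  move=> _; rewrite (flow_field_kernel ubar s sys box) ?normr0 //.
  exact: clampv_in_box.
have := lipschitz_of_derive hg hb (x := t) (y := 0).
rewrite !lexx t0 mul0r => /(_ isT isT); rewrite normr_le0 subr_eq0 => /eqP gt0.
by rewrite !gE gt0.
Qed.

Lemma clamped_flow_speed : exists2 B, 0 <= B & forall x y, 0 <= x -> 0 <= y ->
  `|u x - u y| <= B * `|x - y|.
Proof.
have [_ [BX [_ hB]]] := flow_field_lipschitz s sys box ubarb.
have B0 : 0 <= BX := le_trans (normr_ge0 _) (hB _ ubarb).
exists BX => // x y x0 y0; apply: norm_leP => [|i]; first by rewrite mulr_ge0.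
rewrite !mxE.
apply: (@lipschitz_of_derive _ (fun z => u z i 0) (fun z => Y (u z) i 0) 0
  (Num.max x y)).
- by move=> z /andP[z0 _]; exact: u_derive.
- move=> z _; apply: (le_trans (norm_coord _ _)); apply: hB.
  exact: clampv_in_box.
- by rewrite x0 le_max lexx.
- by rewrite y0 le_max lexx orbT.
Qed.

(** Clamping makes this valid at the ends of a time interval, where the curve is known to be in the
    box on one side only and the derivative formula below does not apply. *)
Lemma potential_continuous_along (t : R) : 0 <= t ->
  {for t, continuous (fun z => W (clampv lo hi (u z)))}.
Proof.
move=> t0; have [C C0 hC] := potential_quadratic sys box ubarb.
set c := clampv lo hi.
have cb (v : 'cV[R]_N) : in_box lo hi (c v) by exact: clampv_in_box.
pose A := N%:R * `|K (c (u t)) - K ubar| + C.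
have A1 : 0 < A + 1 by rewrite ltr_wpDl // addr_ge0 // mulr_ge0.
apply/cvgrPdist_lt => e e0.
pose m := Num.min 1 (e / (A + 1)).
have m0 : 0 < m by rewrite lt_min ltr01 divr_gt0.
have hcont i : exists2 del, 0 < del & forall z, 0 < z < del ->
    forall y, `|y - t| < z -> `|u y i 0 - u t i 0| < m.
  have [del d0 h] := continuous_delta (derive_continuous (u_derive t0 i)) m0.
  exists del => // z /andP[_ zd] y yz; apply: h; exact: lt_trans zd.
have [del d0 h] := common_delta hcont.
have d2 : 0 < del / 2 by rewrite divr_gt0.
exists (del / 2) => // z; rewrite /ball_ /= distrC => zt.
have uz : `|c (u z) - c (u t)| <= m.
  apply: (le_trans (clampv_lipschitz _ _ _ _)); apply: norm_leP => [|i].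
    exact: ltW.
  rewrite !mxE; apply/ltW/(h (del / 2)) => //.
  by rewrite d2 /=; lra.
have := hC _ _ (cb (u t)) (cb (u z)); set x := c (u z) - c (u t) in uz *.
have xm1 : `|x| <= 1 by apply: (le_trans uz); rewrite ge_min lexx.
have hx2 : C * `|x| ^+ 2 <= C * `|x|.
  by rewrite ler_wpM2l // expr2 ler_piMl.
have hd := dotv_bound (K (c (u t)) - K ubar) x.
have me : (A + 1) * m <= e by rewrite mulrC -ler_pdivlMr // ge_min lexx orbT.
have Ax : A * `|x| < (A + 1) * m.
  apply: (@le_lt_trans _ _ (A * m)); last by rewrite ltr_pM2r // ltrDl.
  by rewrite ler_wpM2l // addr_ge0 // mulr_ge0.
move: Ax; rewrite mulrDl -mulrA -/W => Ax hW.
set dd := dotv _ _ in hW hd.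
rewrite distrC; have -> : W (c (u z)) - W (c (u t)) =
  (W (c (u z)) - W (c (u t)) - dd) + dd by ring.
by apply: (le_lt_trans (ler_normD _ _)); lra.
Qed.

Lemma potential_derive_along (t del : R) : 0 <= t -> 0 < del ->
  (forall z, `|z - t| < del -> 0 <= z /\ in_box lo hi (u z)) ->
  is_derive t 1 (fun z => W (clampv lo hi (u z)))
    (dotv (K (u t) - K ubar) (X (u t))).
Proof.
move=> t0 del0 near_t.
have [_ ut] : 0 <= t /\ in_box lo hi (u t) by apply: near_t; rewrite subrr normr0.
have [C C0 hC] := potential_quadratic sys box ubarb.
have [B B0 hB] := clamped_flow_speed.
pose g z := \sum_i (K (u t) - K ubar) i 0 * u z i 0.
have gE z y : g z - g y = dotv (K (u t) - K ubar) (u z - u y).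
  by rewrite dotvBr !dotvE.
apply: (@derive_quadratic_remainder _ _ g t _ (C * B ^+ 2) del) => //.
  rewrite dotvE; apply: der_sum => i _; apply: derZ.
  by have := u_derive t0 i; rewrite /Y clampv_id.
move=> z zt; have [z0 uz] := near_t z zt.
rewrite !clampv_id // gE; apply: (le_trans (hC _ _ ut uz)).
rewrite -mulrA -exprMn ler_wpM2l // lerXn2r ?qualifE /= ?mulr_ge0 //.
exact: hB.
Qed.

Lemma potential_decay : exists2 c, 0 < c & dotv q (u 0 - ubar) = 0 ->
  forall T, 0 <= T -> (forall t, 0 <= t <= T -> in_box lo hi (u t)) ->
  W (u T) <= expR (- c * T) * W (u 0).
Proof.
have [c c0 hc] := potential_descent s sys box ubarb.
exists c => // q0 T T0 ub.
have qt := clamped_flow_orthogonal q0.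
have ends : W (u T) = W (clampv lo hi (u T)) /\ W (u 0) = W (clampv lo hi (u 0)).
  by rewrite !clampv_id //; apply: ub; rewrite ?lexx ?T0.
rewrite ends.1 ends.2 -[T in expR (- c * T)]subr0.
pose dW t := dotv (K (u t) - K ubar) (X (u t)).
apply: (@gronwall _ (fun z => W (clampv lo hi (u z))) dW) => //.
- apply: within_continuous => t /andP[t0 _]; exact: potential_continuous_along.
- move=> t /andP[t0 tT].
  apply: (@potential_derive_along t (Num.min t (T - t))); first exact: ltW.
    by rewrite lt_min t0 subr_gt0.
  move=> z; rewrite lt_min !ltr_norml => zt.
  have z0 : 0 <= z by lra.
  by split => //; apply: ub; rewrite z0; lra.
- move=> t /andP[/ltW t0 /ltW tT]; have tb : in_box lo hi (u t) by apply: ub; rewrite t0.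
  by rewrite clampv_id //; apply: hc => //; exact: qt.
Qed.

End ClampedFlow.

(** The last hypothesis produces the upper face of the box: either it can be put beyond any
    prescribed level [h0], or the field points inwards on it. The lower face is always beyond the
    reach of the sublevel set of the potential. In such a box the clamped flow never feels the
    clamping. *)
Theorem curvature_flow u0 a0 : d a0 -> coord_domain d ubar -> coord_domain d u0 ->
  dotv q (u0 - ubar) = 0 ->
  (forall lo h1 h0, d h1 -> exists hi, [/\ d hi, h1 <= hi &
     h0 < hi \/ forall u, in_box lo hi u -> forall i, u i 0 = hi -> X u i 0 < 0]) ->
  exists u : R -> 'cV[R]_N,
     [/\ calabi_flow K (coord_domain d) s (K ubar) u0 `[0, +oo[ u,
         forall (b : R) (v : R -> 'cV[R]_N),
           calabi_flow K (coord_domain d) s (K ubar) u0 `[0, b[ v ->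
           forall t, 0 <= t < b -> v t = u t
       & exists C c : R, [/\ 0 < C, 0 < c &
           forall t, 0 <= t -> `|u t - ubar| <= C * expR (- c * t)]].
Proof.
move=> da0 Dbar Du0 q0 wall.
have [lb [hb [dhb lba ahb bb]]] := point_hull da0 Dbar.
have [lu [hu [dhu lua ahu ub]]] := point_hull da0 Du0.
have [hb' hbb' dhb'] := cs_up sys dhb.
pose rho := hb' - hb; have rho0 : 0 < rho by rewrite subr_gt0.
have [L0 [M0 [lam0 box0]]] := box_bounds_exist sys (lb - rho) dhb'.
have l0 := bb_lam box0.
have near_bar x : `|x - ubar| <= rho -> in_box (lb - rho) hb' x.
  move=> xr i; have /andP[h1 h2] := bb i.
  have := le_trans (norm_coord (x - ubar) i) xr; rewrite !mxE ler_norml /rho.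
  by move=> /andP[h3 h4]; apply/andP; split; move: h3 h4; rewrite /rho; lra.
(* Solves [lam0 * rho * (r - rho) <= W u0] for r. The absolute value makes the radius nonnegative
   already here, before a box containing both [u0] and [ubar] is available to show that W is
   nonnegative. *)
pose rad := `|rho + W u0 / (lam0 * rho)|.
have lr0 : 0 < lam0 * rho by rewrite mulr_gt0.
(* The extra 1 keeps the flow strictly above the lower face. *)
pose lo := Num.min lu (lb - rad - 1).
pose h1 := Num.max hu hb.
(* No coordinate exceeds [hb + rad] on the sublevel set, so a face beyond that level is never
   reached. *)
have [hi [dhi h1hi hwall]] := wall lo h1 (hb + rad) (domain_max dhu dhb).
have lolu : lo <= lu by rewrite ge_min lexx.
have lolb : lo <= lb - rad - 1 by rewrite ge_min lexx orbT.
have rad0 : 0 <= rad by exact: normr_ge0.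
have huhi : hu <= hi by apply: le_trans h1hi; rewrite le_max lexx.
have hbhi : hb <= hi by apply: le_trans h1hi; rewrite le_max lexx orbT.
have ubarb : in_box lo hi ubar by apply: in_box_weaken bb => //; lra.
have u0b : in_box lo hi u0 by apply: in_box_weaken ub.
have lohi : lo <= hi by lra.
have [L [M [lam box]]] := box_bounds_exist sys lo dhi.
have [u [uu0 ud]] := clamped_flow_exists box ubarb lohi u0.
have [c c0 decay] := potential_decay box ubarb lohi ud.
rewrite uu0 in decay; have {}decay := decay q0.
have W00 : 0 <= W u0 by exact: (potential_ge0 sys box ubarb).
have qt := clamped_flow_orthogonal box lohi ud.
rewrite uu0 in qt; have {}qt := qt q0.
have ubox : forall t, 0 <= t -> in_box lo hi (u t).
  apply: trapped_in_box => [t t0 i||T T0 hT i].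
  - exact: derive_continuous (ud t t0 i).
  - by rewrite uu0.
  have uT : in_box lo hi (u T) by apply: hT; rewrite T0 lexx.
  have WT : W (u T) <= W u0.
    apply: (le_trans (decay T T0 hT)); rewrite ler_piMl //.
    by rewrite -expR0 ler_expR mulNr oppr_le0 mulr_ge0 // ltW.
  have := potential_proper sys box ubarb box0 rho0 near_bar uT (qt T T0).
  move=> /le_trans /(_ WT); rewrite mulrC -ler_pdivlMr // lerBlDl => wrad.
  have {}wrad : `|u T - ubar| <= rad := le_trans wrad (ler_norm _).
  have := le_trans (norm_coord (u T - ubar) i) wrad; rewrite !mxE ler_norml.
  have /andP[bi1 bi2] := bb i; move=> /andP[w1 w2]; split; first by lra.
  have /andP[_] := uT i; rewrite le_eqVlt => /predU1P[uhi|]; last by left.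
  case: hwall => [hr|hX]; first by left; lra.
  right; exists (X (u T) i 0); first exact: hX.
  by have := ud T T0 i; rewrite clampv_id.
have uD (t : R) : 0 <= t -> coord_domain d (u t).
  by move=> t0; apply: (in_box_domain sys dhi); exact: ubox.
have uX (t : R) : 0 <= t -> forall i, is_derive t 1 (fun z => u z i 0) (X (u t) i 0).
  by move=> t0 i; have := ud t t0 i; rewrite clampv_id //; exact: ubox.
exists u; split.
- split=> // t /=; rewrite in_itv /= andbT => t0; split; first exact: uD.
  move=> i; rewrite (flow_fieldE ubar s sys (uD t t0)).
  have /derive_quotient := uX t t0 i; apply: cvg_trans.
  exact/cvg_app/cvg_within.
- move=> b v hv; apply: (flow_unique sys Dbar da0).
  + by have [-> _] := hv.
  + split.
    * by move=> t /andP[t0 _]; exact: uD.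
    * by move=> t /andP[/ltW t0 _] i; exact: uX.
    * move=> T Tb i; apply: within_continuous => z /andP[z0 _].
      exact: derive_continuous (uX z z0 i).
  + exact: (calabi_flow_solution sys hv).
(* From [lam] / 2 |u - ubar|^2 <= W(u) <= e^{-ct} W(u0); the square root halves the rate, and the 1
   makes the constant positive. *)
exists (Num.sqrt (2 * W u0 / lam) + 1), (c / 2).
have lam1 := bb_lam box.
have C0 : 0 <= 2 * W u0 / lam by rewrite divr_ge0 ?mulr_ge0 // ltW.
split; [by rewrite ltr_wpDl ?sqrtr_ge0|by rewrite divr_gt0|].
move=> t t0; apply: (@le_trans _ _ (Num.sqrt (2 * W u0 / lam) * expR (- (c / 2) * t))).
  rewrite -ler_sqr ?qualifE /= ?mulr_ge0 ?expR_ge0 ?sqrtr_ge0 //.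
  apply: (le_trans (norm_dotv_le _)).
  have := potential_ge sys box ubarb (ubox t t0) (qt t t0).
  have := decay t t0 (fun z hz => ubox z (proj1 (andP hz))).
  rewrite exprMn sqr_sqrtr // expr2 -expRD.
  have -> : - (c / 2) * t + - (c / 2) * t = - c * t by field.
  move=> hW /le_trans /(_ hW); rewrite mulrC.
  rewrite -ler_pdivlMr ?divr_gt0 //; congr (_ <= _).
  by field; rewrite gt_eqF.
by rewrite ler_wpM2r ?expR_ge0 // lerDl.
Qed.

End CurvatureFlow.

(** * Derivatives of the inner angles *)

Section AngleDerivative.
Variable R : realType.

(** In both geometries the cosine of an angle is n / sqrt(p q), with p q - n^2 a multiple of a Gram
    determinant. Logarithmic differentiation of the denominator leaves that determinant as the only
    new radical. *)
Lemma acos_ratio_derive (n p q : R -> R) (t n' p' q' : R) : 0 < p t -> 0 < q t ->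
  0 < p t * q t - n t ^+ 2 ->
  is_derive t 1 n n' -> is_derive t 1 p p' -> is_derive t 1 q q' ->
  is_derive t 1 (fun z => acos (n z / (Num.sqrt (p z) * Num.sqrt (q z))))
    (- ((n' - n t * (p' / (2 * p t) + q' / (2 * q t))) /
        Num.sqrt (p t * q t - n t ^+ 2))).
Proof.
move=> p0 q0 S0 dn dp dq.
set S := p t * q t - n t ^+ 2.
have a0 : 0 < Num.sqrt (p t) by rewrite sqrtr_gt0.
have b0 : 0 < Num.sqrt (q t) by rewrite sqrtr_gt0.
have r0 : 0 < Num.sqrt S by rewrite sqrtr_gt0.
have ab0 : Num.sqrt (p t) * Num.sqrt (q t) != 0 by rewrite mulf_neq0 ?gt_eqF.
have dab := derM (der_sqrt p0 dp) (der_sqrt q0 dq).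
have dg := derM dn
  (@derV R (fun z => Num.sqrt (p z) * Num.sqrt (q z)) t _ ab0 dab).
have a2 : p t = Num.sqrt (p t) ^+ 2 by rewrite sqr_sqrtr // ltW.
have b2 : q t = Num.sqrt (q t) ^+ 2 by rewrite sqr_sqrtr // ltW.
have gS : 1 - (n t * (Num.sqrt (p t) * Num.sqrt (q t))^-1) ^+ 2 =
    (Num.sqrt S / (Num.sqrt (p t) * Num.sqrt (q t))) ^+ 2.
  rewrite !exprMn !exprVn sqr_sqrtr ?ltW // exprMn -a2 -b2 /S.
  by field; rewrite !gt_eqF.
have g1 : -1 < n t * (Num.sqrt (p t) * Num.sqrt (q t))^-1 < 1.
  rewrite -ltr_norml -[X in _ < X]normr1 -ltr_sqr ?qualifE //= !real_normK ?num_real //.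
  by rewrite expr1n -subr_gt0 gS exprn_gt0 // divr_gt0 // mulr_gt0.
have dh := @der_acos R
  (fun z => n z * (Num.sqrt (p z) * Num.sqrt (q z))^-1) t _ g1 dg.
apply: der_eq dh _.
rewrite gS sqrtr_sqr ger0_norm; last by rewrite divr_ge0 ?mulr_ge0 // ltW.
set A := Num.sqrt (p t) in a0 a2 *; set B := Num.sqrt (q t) in b0 b2 *.
rewrite -/S a2 b2; move: (Num.sqrt S) r0 => r r0.
move: (A) (B) a0 b0 => {A B a2 b2 gS g1 ab0 dab dg} A B a0 b0.
by field; rewrite !gt_eqF.
Qed.

End AngleDerivative.

(* In both geometries the derivatives of the angle at the first vertex of a
   triangle with weights [a] (opposite), [b], [c] come from the same algebra:
   [gam a b c] is the structure condition at that vertex. *)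
Section Weights.
Variable R : realType.
Implicit Types (X Y Z a b c : R).

Definition gam a b c := a + b * c.

(* With X, Y, Z the exponentials of the u-coordinates, [eP] is the squared edge
   length, [eS] four times the squared area, and [eW] the derivative of the angle
   at the first vertex with respect to the u-coordinate of the second. *)
Definition eP X Y c := X ^+ 2 + Y ^+ 2 + 2 * c * X * Y.

Definition eS X Y Z a b c :=
  X ^+ 2 * Y ^+ 2 * (1 - c ^+ 2) + X ^+ 2 * Z ^+ 2 * (1 - b ^+ 2) +
  Y ^+ 2 * Z ^+ 2 * (1 - a ^+ 2) +
  2 * X * Y * Z * (X * gam a b c + Y * gam b c a + Z * gam c a b).

Definition eQ X Y Z a b c :=
  X * Y * (1 - c ^+ 2) + X * Z * gam a b c + Y * Z * gam b c a.

Definition eW X Y Z a b c :=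
  X * Y * eQ X Y Z a b c / (Num.sqrt (eS X Y Z a b c) * eP X Y c).

Definition nondeg a b c := [/\ -1 < a <= 1, -1 < b <= 1, -1 < c <= 1 &
  [/\ 0 <= gam a b c, 0 <= gam b c a & 0 <= gam c a b]].

Lemma nondeg_sqr a : -1 < a <= 1 -> 0 <= 1 - a ^+ 2.
Proof. by move=> /andP[h1 h2]; nra. Qed.

Lemma eP_gt0 X Y c : 0 < X -> 0 < Y -> -1 < c -> 0 < eP X Y c.
Proof.
move=> X0 Y0 c1; have h : 0 < X * Y * (1 + c) by rewrite !mulr_gt0 //; lra.
by rewrite /eP; have := sqr_ge0 (X - Y); nra.
Qed.

(** Nondegeneracy of the Euclidean triangle. All terms are nonnegative; if c^2 < 1 the first is
    positive, and otherwise c = 1 forces one of two structure terms to be positive. *)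
Lemma eS_gt0 X Y Z a b c : 0 < X -> 0 < Y -> 0 < Z -> nondeg a b c ->
  0 < eS X Y Z a b c.
Proof.
move=> X0 Y0 Z0 [ha hb hc [g1 g2 g3]].
have a2 := nondeg_sqr ha; have b2 := nondeg_sqr hb; have c2 := nondeg_sqr hc.
have XY : 0 < X ^+ 2 * Y ^+ 2 by rewrite mulr_gt0 ?exprn_gt0.
have XZ : 0 < X ^+ 2 * Z ^+ 2 by rewrite mulr_gt0 ?exprn_gt0.
have YZ : 0 < Y ^+ 2 * Z ^+ 2 by rewrite mulr_gt0 ?exprn_gt0.
have XYZ : 0 < 2 * X * Y * Z by rewrite !mulr_gt0.
have s1 : 0 <= X ^+ 2 * Y ^+ 2 * (1 - c ^+ 2) by rewrite mulr_ge0 // ltW.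
have s2 : 0 <= X ^+ 2 * Z ^+ 2 * (1 - b ^+ 2) by rewrite mulr_ge0 // ltW.
have s3 : 0 <= Y ^+ 2 * Z ^+ 2 * (1 - a ^+ 2) by rewrite mulr_ge0 // ltW.
have t1 : 0 <= X * gam a b c by rewrite mulr_ge0 // ltW.
have t2 : 0 <= Y * gam b c a by rewrite mulr_ge0 // ltW.
have t3 : 0 <= Z * gam c a b by rewrite mulr_ge0 // ltW.
have t : 0 <= 2 * X * Y * Z * (X * gam a b c + Y * gam b c a + Z * gam c a b).
  by rewrite mulr_ge0 ?addr_ge0 // ltW.
have [c1|c1] := ltP (c ^+ 2) 1.
  have : 0 < X ^+ 2 * Y ^+ 2 * (1 - c ^+ 2) by rewrite mulr_gt0 // subr_gt0.
  by rewrite /eS; lra.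
have c1' : c = 1 by nra.
(* For c = 1 this sum equals (1 + a) (1 + b). *)
have gpos : 0 < gam a b c + gam c a b.
  rewrite /gam c1'; case/andP: ha => ha1 _; case/andP: hb => hb1 _; nra.
have : 0 < 2 * X * Y * Z * (X * gam a b c + Y * gam b c a + Z * gam c a b).
  rewrite mulr_gt0 //.
  have [g|g] := ltP 0 (gam a b c).
    have : 0 < X * gam a b c by rewrite mulr_gt0.
    lra.
  have : 0 < Z * gam c a b by rewrite mulr_gt0 //; lra.
  lra.
by rewrite /eS; lra.
Qed.

Lemma eS_swap X Y Z a b c : eS X Z Y a c b = eS X Y Z a b c.
Proof. by rewrite /eS /gam; ring. Qed.

Lemma eS_flip X Y Z a b c : eS Y X Z b a c = eS X Y Z a b c.
Proof. by rewrite /eS /gam; ring. Qed.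

(** The symmetry of the Jacobian, obtained face by face. *)
Lemma eW_sym X Y Z a b c : eW Y X Z b a c = eW X Y Z a b c.
Proof.
rewrite /eW eS_flip; congr (_ / (_ * _)); rewrite /eQ /eP /gam; ring.
Qed.

(** Only differences of x', y', z' occur, reflecting that angles are invariant under scaling; this
    puts constants in the kernel of L. *)
Lemma eucl_angle_derive (x y z : R -> R) (t x' y' z' a b c : R) :
  nondeg a b c ->
  is_derive t 1 x x' -> is_derive t 1 y y' -> is_derive t 1 z z' ->
  let w := eW (expR (x t)) (expR (y t)) (expR (z t)) a b c in
  let w' := eW (expR (x t)) (expR (z t)) (expR (y t)) a c b in
  is_derive t 1 (fun s =>
     eucl_angle (Num.sqrt (expR (2 * x s) + expR (2 * y s) + 2 * c * expR (x s + y s)))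
       (Num.sqrt (expR (2 * x s) + expR (2 * z s) + 2 * b * expR (x s + z s)))
       (Num.sqrt (expR (2 * y s) + expR (2 * z s) + 2 * a * expR (y s + z s))))
   (- (w * (x' - y') + w' * (x' - z'))).
Proof.
move=> nd dx dy dz w w'.
have sqE (u : R) : expR (2 * u) = expR u * expR u.
  by rewrite -expRD; congr expR; ring.
pose P (u v : R -> R) e s := expR (u s) * expR (u s) + expR (v s) * expR (v s) +
  2 * e * (expR (u s) * expR (v s)).
(* The product of the two adjacent sides with the cosine, that is, half of the combination in the
   law of cosines. *)
pose n s := expR (x s) * expR (x s) + b * (expR (x s) * expR (z s)) +
  c * (expR (x s) * expR (y s)) - a * (expR (y s) * expR (z s)).
have [/andP[ha _] /andP[hb _] /andP[hc _] _] := nd.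
have PE u v e s : P u v e s = eP (expR (u s)) (expR (v s)) e.
  by rewrite /P /eP; ring.
have P0 u v e s : -1 < e -> 0 < P u v e s.
  by move=> e1; rewrite PE; apply: eP_gt0 => //; exact: expR_gt0.
rewrite (_ : (fun s => _) = fun s => acos (n s /
    (Num.sqrt (P x y c s) * Num.sqrt (P x z b s)))); last first.
  apply/funext => s; rewrite /eucl_angle !sqE !expRD.
  rewrite -/(P x y c s) -/(P x z b s) -/(P y z a s).
  rewrite !sqr_sqrtr ?ltW ?P0 //.
  have nE : P x y c s + P x z b s - P y z a s = 2 * n s by rewrite /P /n; ring.
  have r1 : 0 < Num.sqrt (P x y c s) by rewrite sqrtr_gt0 P0.
  have r2 : 0 < Num.sqrt (P x z b s) by rewrite sqrtr_gt0 P0.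
  rewrite nE; congr acos; move: (Num.sqrt _) (Num.sqrt _) r1 r2 => r1 r2 h1 h2.
  by field; rewrite !gt_eqF.
have dX := der_expR dx; have dY := der_expR dy; have dZ := der_expR dz.
have dP (u v : R -> R) e u' v' (du : is_derive t 1 (fun s => expR (u s)) u')
    (dv : is_derive t 1 (fun s => expR (v s)) v') :
    is_derive t 1 (P u v e) (u' * expR (u t) + expR (u t) * u' +
      (v' * expR (v t) + expR (v t) * v') +
      2 * e * (u' * expR (v t) + expR (u t) * v')).
  exact: (derD (derD (derM du du) (derM dv dv)) (derZ (2 * e) (derM du dv))).
have dn := derB (derD (derD (derM dX dX) (derZ b (derM dX dZ)))
  (derZ c (derM dX dY))) (derZ a (derM dY dZ)).
have X0 := expR_gt0 (x t); have Y0 := expR_gt0 (y t); have Z0 := expR_gt0 (z t).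
have SE : P x y c t * P x z b t - n t ^+ 2 =
    eS (expR (x t)) (expR (y t)) (expR (z t)) a b c.
  by rewrite /P /n /eS /gam; ring.
have S0 := eS_gt0 X0 Y0 Z0 nd.
have D0 : 0 < P x y c t * P x z b t - n t ^+ 2 by rewrite SE.
have h := @acos_ratio_derive R n (P x y c) (P x z b) t _ _ _ (P0 _ _ _ _ hc)
  (P0 _ _ _ _ hb) D0 dn (dP _ _ c _ _ dX dY) (dP _ _ b _ _ dX dZ).
apply: der_eq h _; rewrite SE.
rewrite /w /w' /eW eS_swap !PE /n; move: S0.
have := P0 x y c t hc; have := P0 x z b t hb; rewrite !PE.
move: (expR (x t)) (expR (y t)) (expR (z t)) => X Y Z; rewrite /eQ /gam /eP => Pb Pc S0'.
field; apply/and3P; split; rewrite gt_eqF //.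
by rewrite sqrtr_gt0 eS_swap.
Qed.

End Weights.

(** * Hyperbolic angles in terms of cosh u and sinh u *)

Section HyperbolicFunctions.
Variable R : realType.
Implicit Types (x y l e : R).

Lemma coshE2 x : cosh x ^+ 2 = 1 + sinh x ^+ 2.
Proof.
rewrite /cosh /sinh expRN; have := expR_gt0 x; move: (expR x) => y y0.
by field; rewrite gt_eqF.
Qed.

Lemma sinh_lt0 x : x < 0 -> sinh x < 0.
Proof.
move=> x0; rewrite /sinh pmulr_llt0 ?invr_gt0 // subr_lt0 ltr_expR; lra.
Qed.

Lemma cosh_ge1 x : 1 <= cosh x.
Proof.
have c0 : 0 < cosh x by rewrite /cosh divr_gt0 // addr_gt0 ?expR_gt0.
by have := coshE2 x; have := sqr_ge0 (sinh x); nra.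
Qed.

Lemma der_cosh (f : R -> R) (t a : R) : is_derive t 1 f a ->
  is_derive t 1 (fun z => cosh (f z)) (sinh (f t) * a).
Proof.
move=> fa; have h := derM (derD (der_expR fa) (der_expR (derN fa))) (derC 2^-1 t).
by apply: der_eq h _; rewrite /sinh; ring.
Qed.

Lemma hyp_radius_cosh x : x < 0 ->
  cosh (hyp_radius x) = cosh x / - sinh x /\
  sinh (hyp_radius x) = (- sinh x)^-1.
Proof.
move=> x0; have y0 := expR_gt0 x; have y1 : expR x < 1 by rewrite expR_lt1.
rewrite hyp_radiusE // /cosh /sinh !expRN lnK; last first.
  by rewrite posrE divr_gt0 //; lra.
move: (expR x) y0 y1 => y y0 y1.
have d1 : 1 - y != 0 by rewrite gt_eqF //; lra.
have d2 : 1 + y != 0 by rewrite gt_eqF //; lra.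
have yn : y != 0 by rewrite gt_eqF.
have -> : - ((y - y^-1) / 2) = (1 - y) * (1 + y) / (2 * y) by field.
by split; field; rewrite ?d1 ?d2 ?yn.
Qed.

Lemma arcosh_cosh x : 1 < x ->
  cosh (arcosh x) = x /\ sinh (arcosh x) = Num.sqrt (x ^+ 2 - 1).
Proof.
move=> x1; rewrite arcoshE //; set w := Num.sqrt _.
have w0 : 0 <= w by exact: sqrtr_ge0.
have w2 : w ^+ 2 = x ^+ 2 - 1 by rewrite sqr_sqrtr //; nra.
have xw : 0 < x + w by lra.
rewrite /cosh /sinh expRN lnK ?posrE //.
have -> : (x + w)^-1 = x - w.
  have xw0 : x + w != 0 by rewrite gt_eqF.
  by apply: (mulfI xw0); rewrite mulfV //; lra.
by split; lra.
Qed.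

End HyperbolicFunctions.

Section HyperbolicAngle.
Variable R : realType.
Implicit Types (X Y Z a b c u v : R).

(* With X, Y, Z = cosh u_i, cosh u_j, cosh u_k, one has cosh r = - coth u and
   sinh r = - 1 / sinh u, so the edge length satisfies
   cosh l = (X Y + c) / (sinh u_i sinh u_j) and sinh l ^ 2 is
   hP / (sinh u_i sinh u_j) ^ 2; the cosine of the angle at i is
   hN / sqrt (hP hP'), and hG is the Gram determinant of [hN_gram]. *)
Definition hP X Y c := X ^+ 2 + Y ^+ 2 + 2 * c * X * Y + c ^+ 2 - 1.

Definition hN X Y Z a b c :=
  (X * Z + b) * (X * Y + c) - (X ^+ 2 - 1) * (Y * Z + a).

Definition hG X Y Z a b c :=
  X ^+ 2 * (1 - a ^+ 2) + Y ^+ 2 * (1 - b ^+ 2) + Z ^+ 2 * (1 - c ^+ 2) +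
  2 * Y * Z * gam a b c + 2 * X * Z * gam b c a + 2 * X * Y * gam c a b +
  a ^+ 2 + b ^+ 2 + c ^+ 2 + 2 * a * b * c - 1.

Definition hQ X Y Z a b c :=
  Z * (1 - c ^+ 2) + Y * gam a b c + X * gam b c a.

Definition hV X Y Z a b c :=
  hQ X Y Z a b c * (X * Y + c) / (hP X Y c * Num.sqrt (hG X Y Z a b c)).

Definition hW u v X Y Z a b c :=
  u * v * hQ X Y Z a b c / (hP X Y c * Num.sqrt (hG X Y Z a b c)).

(** The bound is the value at X = Y = 1, so it does not degenerate when coordinates tend to 0. *)
Lemma hP_ge X Y c : 1 <= X -> 1 <= Y -> -1 < c -> (1 + c) ^+ 2 <= hP X Y c.
Proof.
move=> X1 Y1 c1.
have -> : hP X Y c = (1 + c) ^+ 2 + 2 * (1 + c) * (X * Y - 1) + (X - Y) ^+ 2.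
  by rewrite /hP; ring.
have : 0 <= (1 + c) * (X * Y - 1) by rewrite mulr_ge0 //; nra.
have := sqr_ge0 (X - Y); lra.
Qed.

Lemma hP_gt0 X Y c : 1 <= X -> 1 <= Y -> -1 < c -> 0 < hP X Y c.
Proof.
move=> X1 Y1 c1; apply: lt_le_trans (hP_ge X1 Y1 c1).
by rewrite exprn_gt0 //; lra.
Qed.

(** The left side is the value at X = Y = Z = 1; the rest has nonnegative coefficients in X^2 - 1,
    YZ - 1 and their analogues. Hence a lower bound uniform up to the boundary. *)
Lemma hG_ge X Y Z a b c : 1 <= X -> 1 <= Y -> 1 <= Z -> nondeg a b c ->
  2 * ((1 + a) * (1 + b) * (1 + c)) <= hG X Y Z a b c.
Proof.
move=> X1 Y1 Z1 [ha hb hc [g1 g2 g3]].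
have a2 := nondeg_sqr ha; have b2 := nondeg_sqr hb; have c2 := nondeg_sqr hc.
have -> : hG X Y Z a b c = 2 * ((1 + a) * (1 + b) * (1 + c)) +
  ((X ^+ 2 - 1) * (1 - a ^+ 2) + (Y ^+ 2 - 1) * (1 - b ^+ 2) +
   (Z ^+ 2 - 1) * (1 - c ^+ 2) + 2 * ((Y * Z - 1) * gam a b c) +
   2 * ((X * Z - 1) * gam b c a) + 2 * ((X * Y - 1) * gam c a b)).
  by rewrite /hG /gam; ring.
rewrite lerDl.
have sq (x : R) : 1 <= x -> 0 <= x ^+ 2 - 1 by move=> x1; nra.
have pr (x y : R) : 1 <= x -> 1 <= y -> 0 <= x * y - 1 by move=> x1 y1; nra.
by rewrite !addr_ge0 ?mulr_ge0 ?sq ?pr.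
Qed.

Lemma nondeg_prod a b c : nondeg a b c -> 0 < 2 * ((1 + a) * (1 + b) * (1 + c)).
Proof.
move=> [/andP[ha _] /andP[hb _] /andP[hc _] _].
by rewrite !mulr_gt0 //; lra.
Qed.

Lemma hG_gt0 X Y Z a b c : 1 <= X -> 1 <= Y -> 1 <= Z -> nondeg a b c ->
  0 < hG X Y Z a b c.
Proof.
by move=> X1 Y1 Z1 nd; exact: lt_le_trans (nondeg_prod nd) (hG_ge X1 Y1 Z1 nd).
Qed.

Lemma hG_swap X Y Z a b c : hG X Z Y a c b = hG X Y Z a b c.
Proof. by rewrite /hG /gam; ring. Qed.

Lemma hG_flip X Y Z a b c : hG Y X Z b a c = hG X Y Z a b c.
Proof. by rewrite /hG /gam; ring. Qed.

Lemma hW_sym u v X Y Z a b c : hW v u Y X Z b a c = hW u v X Y Z a b c.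
Proof.
by rewrite /hW hG_flip; congr (_ / (_ * _)); rewrite /hQ /hP /gam; ring.
Qed.

Lemma hV_sym X Y Z a b c : hV Y X Z b a c = hV X Y Z a b c.
Proof.
by rewrite /hV hG_flip; congr (_ / (_ * _)); rewrite /hQ /hP /gam; ring.
Qed.

Lemma hN_gram X Y Z a b c :
  hP X Y c * hP X Z b - hN X Y Z a b c ^+ 2 = (X ^+ 2 - 1) * hG X Y Z a b c.
Proof. by rewrite /hP /hN /hG /gam; ring. Qed.

(** The terms in Y' and Z' carry the factor X^2 - 1 = sinh^2 u_i while the term in X' does not.
    After division by -sinh u_i, and as X' itself contains sinh u_i, the off-diagonal entries keep a
    factor that vanishes at the boundary and the diagonal ones do not. *)
Lemma hyp_derivative_identity X Y Z a b c X' Y' Z' :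
  hP X Y c != 0 -> hP X Z b != 0 ->
  (X' * Z + X * Z') * (X * Y + c) + (X * Z + b) * (X' * Y + X * Y') -
  (2 * (X * X') * (Y * Z + a) + (X ^+ 2 - 1) * (Y' * Z + Y * Z')) -
  hN X Y Z a b c *
   (2 * (X * X' + Y * Y' + c * (X' * Y + X * Y')) / (2 * hP X Y c) +
    2 * (X * X' + Z * Z' + b * (X' * Z + X * Z')) / (2 * hP X Z b)) =
  (X ^+ 2 - 1) * (Y' * (hQ X Y Z a b c / hP X Y c) +
                  Z' * (hQ X Z Y a c b / hP X Z b)) -
  X' * (hQ X Y Z a b c * (X * Y + c) / hP X Y c +
        hQ X Z Y a c b * (X * Z + b) / hP X Z b).
Proof.
rewrite /hP /hN /hQ /gam => h1 h2; field.
by rewrite h1 h2.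
Qed.

Lemma hyp_cosh_length x y c : x < 0 -> y < 0 -> -1 < c ->
  let A := cosh (hyp_radius x) * cosh (hyp_radius y) +
    c * sinh (hyp_radius x) * sinh (hyp_radius y) in
  cosh (arcosh A) = (cosh x * cosh y + c) / (- sinh x * - sinh y) /\
  sinh (arcosh A) = Num.sqrt (hP (cosh x) (cosh y) c) / (- sinh x * - sinh y).
Proof.
move=> x0 y0 c1 A.
have sx : 0 < - sinh x by rewrite oppr_gt0 sinh_lt0.
have sy : 0 < - sinh y by rewrite oppr_gt0 sinh_lt0.
have sxy : 0 < - sinh x * - sinh y by rewrite mulr_gt0.
have cx := cosh_ge1 x; have cy := cosh_ge1 y.
have AE : A = (cosh x * cosh y + c) / (- sinh x * - sinh y).
  rewrite /A (hyp_radius_cosh x0).1 (hyp_radius_cosh x0).2.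
  rewrite (hyp_radius_cosh y0).1 (hyp_radius_cosh y0).2.
  move: (- sinh x) (- sinh y) sx sy => p q p0 q0.
  by field; rewrite !gt_eqF.
have P0 := hP_gt0 cx cy c1.
have PE : hP (cosh x) (cosh y) c =
    (cosh x * cosh y + c) ^+ 2 - (- sinh x * - sinh y) ^+ 2.
  have sq (u : R) : sinh u ^+ 2 = cosh u ^+ 2 - 1.
    by rewrite coshE2 addrAC subrr add0r.
  by rewrite exprMn !sqrrN !sq /hP; ring.
have A2 : A ^+ 2 - 1 = hP (cosh x) (cosh y) c / (- sinh x * - sinh y) ^+ 2.
  rewrite AE PE; move: (- sinh x * - sinh y) sxy => p p0.
  by field; rewrite gt_eqF.
have A0 : 0 < A by rewrite AE divr_gt0 //; nra.
have A1 : 1 < A.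
  have : 0 < A ^+ 2 - 1 by rewrite A2 divr_gt0 // exprn_gt0.
  by nra.
have [-> ->] := arcosh_cosh A1; split => //.
rewrite A2 sqrtrM ?ltW // sqrtrV ?sqr_ge0 //.
by rewrite sqrtr_sqr gtr0_norm.
Qed.

Lemma hyp_angle_formula x y z a b c : x < 0 -> y < 0 -> z < 0 -> nondeg a b c ->
  let len u v e := arcosh (cosh (hyp_radius u) * cosh (hyp_radius v) +
    e * sinh (hyp_radius u) * sinh (hyp_radius v)) in
  hyp_angle (len x y c) (len x z b) (len y z a) =
  acos (hN (cosh x) (cosh y) (cosh z) a b c /
    (Num.sqrt (hP (cosh x) (cosh y) c) * Num.sqrt (hP (cosh x) (cosh z) b))).
Proof.
move=> x0 y0 z0 [/andP[ha _] /andP[hb _] /andP[hc _] _] len.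
rewrite /hyp_angle /len.
have [-> ->] := hyp_cosh_length x0 y0 hc.
have [-> ->] := hyp_cosh_length x0 z0 hb.
have [-> _] := hyp_cosh_length y0 z0 ha.
have sx : 0 < - sinh x by rewrite oppr_gt0 sinh_lt0.
have sy : 0 < - sinh y by rewrite oppr_gt0 sinh_lt0.
have sz : 0 < - sinh z by rewrite oppr_gt0 sinh_lt0.
have p1 : 0 < Num.sqrt (hP (cosh x) (cosh y) c).
  by rewrite sqrtr_gt0 hP_gt0 ?cosh_ge1.
have p2 : 0 < Num.sqrt (hP (cosh x) (cosh z) b).
  by rewrite sqrtr_gt0 hP_gt0 ?cosh_ge1.
have sx2 : cosh x ^+ 2 - 1 = (- sinh x) ^+ 2 by rewrite coshE2 sqrrN addrAC subrr add0r.
rewrite /hN sx2; congr acos.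
move: (Num.sqrt _) (Num.sqrt _) p1 p2 => p1 p2 h1 h2.
move: (- sinh x) (- sinh y) (- sinh z) sx sy sz => p q r p0 q0 r0.
by field; rewrite !gt_eqF.
Qed.

Lemma hyp_angle_derive (x y z : R -> R) (t x' y' z' a b c : R) :
  nondeg a b c -> x t < 0 -> y t < 0 -> z t < 0 ->
  is_derive t 1 x x' -> is_derive t 1 y y' -> is_derive t 1 z z' ->
  let C (f : R -> R) := cosh (f t) in let S (f : R -> R) := - sinh (f t) in
  let v := hV (C x) (C y) (C z) a b c in
  let w := hW (S x) (S y) (C x) (C y) (C z) a b c in
  let v' := hV (C x) (C z) (C y) a c b in
  let w' := hW (S x) (S z) (C x) (C z) (C y) a c b in
  let len (f g : R -> R) e s := arcosh (cosh (hyp_radius (f s)) * cosh (hyp_radius (g s)) +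
    e * sinh (hyp_radius (f s)) * sinh (hyp_radius (g s))) in
  is_derive t 1 (fun s => hyp_angle (len x y c s) (len x z b s) (len y z a s))
   (- ((v * x' - w * y') + (v' * x' - w' * z'))).
Proof.
move=> nd x0 y0 z0 dx dy dz C S v w v' w' len.
have [/andP[ha _] /andP[hb _] /andP[hc _] _] := nd.
pose P (f g : R -> R) e s := cosh (f s) * cosh (f s) + cosh (g s) * cosh (g s) +
  2 * e * (cosh (f s) * cosh (g s)) + (e ^+ 2 - 1).
pose n s := (cosh (x s) * cosh (z s) + b) * (cosh (x s) * cosh (y s) + c) -
  (cosh (x s) * cosh (x s) - 1) * (cosh (y s) * cosh (z s) + a).
have PE f g e s : P f g e s = hP (cosh (f s)) (cosh (g s)) e.
  by rewrite /P /hP; ring.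
have nE s : n s = hN (cosh (x s)) (cosh (y s)) (cosh (z s)) a b c.
  by rewrite /n /hN expr2.
(* The closed form of the angle requires negative coordinates, so the two functions agree only near
   [t]. *)
apply: (@near_eq_is_derive _ _ _
  (fun s => acos (n s / (Num.sqrt (P x y c s) * Num.sqrt (P x z b s))))).
  have neg (f : R -> R) f' : is_derive t 1 f f' -> f t < 0 -> \forall s \near t, f s < 0.
    move=> df ft; have := derive_continuous df.
    by move=> /cvgr_lt; apply.
  have nx := neg _ _ dx x0; have ny := neg _ _ dy y0; have nz := neg _ _ dz z0.
  near=> s; rewrite nE !PE -hyp_angle_formula //.
  - by near: s.
  - by near: s.
  - by near: s.
have dX := der_cosh dx; have dY := der_cosh dy; have dZ := der_cosh dz.
have dP (f g : R -> R) e f' g' (df : is_derive t 1 (fun s => cosh (f s)) f')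
    (dg : is_derive t 1 (fun s => cosh (g s)) g') :
    is_derive t 1 (P f g e) (2 * (cosh (f t) * f' + cosh (g t) * g' +
      e * (f' * cosh (g t) + cosh (f t) * g'))).
  have h := derD (derD (derD (derM df df) (derM dg dg)) (derZ (2 * e) (derM df dg)))
    (derC (e ^+ 2 - 1) t).
  by apply: der_eq h _; ring.
have dn := derB (derM (derD (derM dX dZ) (derC b t)) (derD (derM dX dY) (derC c t)))
  (derM (derB (derM dX dX) (derC 1 t)) (derD (derM dY dZ) (derC a t))).
have cx := cosh_ge1 (x t); have cy := cosh_ge1 (y t); have cz := cosh_ge1 (z t).
have P1 : 0 < P x y c t by rewrite PE hP_gt0.
have P2 : 0 < P x z b t by rewrite PE hP_gt0.
have sx : 0 < - sinh (x t) by rewrite oppr_gt0 sinh_lt0.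
have sx2 : cosh (x t) ^+ 2 - 1 = (- sinh (x t)) ^+ 2.
  by rewrite coshE2 sqrrN addrAC subrr add0r.
have G0 := hG_gt0 cx cy cz nd.
have SE : P x y c t * P x z b t - n t ^+ 2 =
    (- sinh (x t)) ^+ 2 * hG (cosh (x t)) (cosh (y t)) (cosh (z t)) a b c.
  by rewrite !PE nE hN_gram sx2.
have D0 : 0 < P x y c t * P x z b t - n t ^+ 2.
  by rewrite SE mulr_gt0 // exprn_gt0.
have h := @acos_ratio_derive R n (P x y c) (P x z b) t _ _ _ P1 P2 D0 dn
  (dP _ _ c _ _ dX dY) (dP _ _ b _ _ dX dZ).
apply: der_eq h _; rewrite SE sqrtrM ?sqr_ge0 // sqrtr_sqr gtr0_norm //.
have r0 : 0 < Num.sqrt (hG (cosh (x t)) (cosh (y t)) (cosh (z t)) a b c).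
  by rewrite sqrtr_gt0.
rewrite PE in P1; rewrite PE in P2.
have id := @hyp_derivative_identity (cosh (x t)) (cosh (y t)) (cosh (z t)) a b c
  (sinh (x t) * x') (sinh (y t) * y') (sinh (z t) * z')
  (lt0r_neq0 P1) (lt0r_neq0 P2).
pose E := (cosh (x t) ^+ 2 - 1) *
  (sinh (y t) * y' * (hQ (C x) (C y) (C z) a b c / hP (C x) (C y) c) +
   sinh (z t) * z' * (hQ (C x) (C z) (C y) a c b / hP (C x) (C z) b)) -
  sinh (x t) * x' * (hQ (C x) (C y) (C z) a b c * (C x * C y + c) / hP (C x) (C y) c +
     hQ (C x) (C z) (C y) a c b * (C x * C z + b) / hP (C x) (C z) b).
transitivity (- (E / (- sinh (x t) *
    Num.sqrt (hG (cosh (x t)) (cosh (y t)) (cosh (z t)) a b c)))).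
  congr (- (_ / _)); rewrite -[E]id !PE nE; congr (_ - _); ring.
rewrite /E sx2 /v /w /v' /w' /hV /hW hG_swap /S /C.
field; apply/and4P; split; try by rewrite gt_eqF.
  by rewrite gt_eqF // sqrtr_gt0 hG_swap.
by rewrite lt_eqF // -oppr_gt0.
Unshelve. all: end_near. Qed.

End HyperbolicAngle.

(** * Assembly over the triangulation *)

Section FaceWeights.
Variable R : realType.
Implicit Types a b c : R.

(** The common value of [eQ] and [hQ] at X = Y = Z = 1. It controls the edge weights from below in
    both geometries. *)
Definition face_weight a b c := 1 - c ^+ 2 + gam a b c + gam b c a.

Lemma face_weight_ge0 a b c : nondeg a b c -> 0 <= face_weight a b c.
Proof.
by move=> [_ _ /nondeg_sqr hc [g1 g2 g3]]; rewrite /face_weight; lra.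
Qed.

(** An edge may have zero weight in a face: this forces c = 1 and a + b = 0. Then both other edges
    have weight 2 (1 - a^2), which is positive since a and -a exceed -1. *)
Lemma face_weight_eq0 a b c : nondeg a b c -> face_weight a b c = 0 ->
  0 < face_weight a c b /\ 0 < face_weight b c a.
Proof.
move=> [/andP[ha1 ha2] /andP[hb1 hb2] /andP[hc1 hc2] [g1 g2 g3]].
rewrite /face_weight => h.
have c2 : c ^+ 2 <= 1 by nra.
have cE : c = 1 by nra.
have gE : a + b = 0 by move: h g1 g2; rewrite /gam cE; lra.
move: g1 g2 g3; rewrite /gam cE => g1 g2 g3.
have bE : b = - a by lra.
by split; rewrite bE; nra.
Qed.

End FaceWeights.

Section Triangulation.
Variables (R : realType) (N : nat) (T : triangulation N) (eta : {set 'I_N} -> R).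
Hypothesis eta_range : forall p q, [set p; q]%SET \in edges T ->
  -1 < eta [set p; q]%SET <= 1.
Hypothesis eta_structure : structure_condition T eta.
Implicit Types (i j k : 'I_N).

Definition face i j k := [set i; j; k]%SET \in faces T.

Lemma face_swap i j k : face i k j = face i j k.
Proof. by rewrite /face finset.setUAC. Qed.

Lemma face_flip i j k : face j i k = face i j k.
Proof. by rewrite /face [[set i; j]%SET]finset.setUC. Qed.

Lemma face_neq i j k : face i j k -> [/\ i != j, i != k & j != k].
Proof.
move=> /card_face c3; split; apply/negP => /eqP e; move: c3; rewrite ?e.
- by rewrite finset.setUid => /esym/eqP; rewrite gtn_eqF // cards2; case: eqP.
- rewrite finset.setUAC finset.setUid => /esym/eqP; rewrite gtn_eqF // cards2; by case: eqP.
- by rewrite -finset.setUA finset.setUid => /esym/eqP; rewrite gtn_eqF // cards2; case: eqP.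
Qed.

Lemma face_edges i j k : face i j k -> [/\ [set i; j]%SET \in edges T,
  [set i; k]%SET \in edges T & [set j; k]%SET \in edges T].
Proof.
move=> f; have [ij ik jk] := face_neq f.
have sub p q : p != q -> p \in [set i; j; k]%SET -> q \in [set i; j; k]%SET ->
    [set p; q]%SET \in edges T.
  move=> pq pf qf; apply: (face_edge f); last by rewrite cards2 pq.
  by apply/fintype.subsetP => x; rewrite finset.in_set2 => /orP[]/eqP->.
by split; apply: sub; rewrite // !inE eqxx ?orbT.
Qed.

Lemma face_nondeg i j k : face i j k ->
  nondeg (eta [set j; k]%SET) (eta [set i; k]%SET) (eta [set i; j]%SET).
Proof.
move=> f; have [e1 e2 e3] := face_edges f; have [_ st] := eta_structure.
have C2 (p r : 'I_N) : [set p; r]%SET = [set r; p]%SET by rewrite finset.setUC.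
have f2 : face j i k by rewrite face_flip.
have f3 : face k i j by rewrite face_swap face_flip face_swap in f2 *.
have s1 := st i j k f; have s2 := st j i k f2; have s3 := st k i j f3.
rewrite (C2 j i) in s2; rewrite (C2 k i) (C2 k j) in s3.
split; rewrite ?eta_range //; rewrite /gam.
by split; [rewrite mulrC|exact: s2|rewrite mulrC].
Qed.

Lemma vertex_face i : exists j k, face i j k.
Proof.
have [c [uc sc _ hf]] := link_cycle T i.
case: c uc sc hf => [//|j c] uc _ hf.
by exists j, (next (j :: c) j); rewrite /face hf mem_head eqxx.
Qed.

Lemma edge_face i j : [set i; j]%SET \in edges T -> exists k, face i j k.
Proof.
have [c [_ _ he hf]] := link_cycle T i; rewrite he => jc.
by exists (next c j); rewrite /face hf jc eqxx.
Qed.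

(** Passes from faces counted once, as in [curvature], to ordered pairs. No term with j = k is lost,
    because the vertices of a face are distinct. *)
Lemma sum_face_pairs i (A : 'I_N -> 'I_N -> R) :
  \sum_(j < N) \sum_(k < N | (j < k)%N && face i j k) (A j k + A k j) =
  \sum_j \sum_(k | face i j k) A j k.
Proof.
have -> : \sum_j \sum_(k | face i j k) A j k =
    \sum_(j < N) \sum_(k < N | (j < k)%N && face i j k) A j k +
    \sum_(j < N) \sum_(k < N | (k < j)%N && face i j k) A j k.
  rewrite -big_split; apply: eq_bigr => j _ /=.
  rewrite (bigID (fun k : 'I_N => (j < k)%N)) /=; congr (_ + _).
    by apply: eq_bigl => k; rewrite andbC.
  apply: eq_bigl => k; rewrite -leqNgt leq_eqVlt andbC.
  case f : (face i j k); rewrite ?andbF //.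
  have [_ _ /negPf jk] := face_neq f; rewrite !andbT.
  by rewrite -[(k == j :> nat)]/(k == j) eq_sym jk.
have -> : \sum_(j < N) \sum_(k < N | (k < j)%N && face i j k) A j k =
    \sum_(j < N) \sum_(k < N | (j < k)%N && face i j k) A k j.
  rewrite (exchange_big_dep xpredT) //=; apply: eq_bigr => j _.
  by apply: eq_bigl => k; rewrite face_swap.
rewrite -big_split; apply: eq_bigr => j _ /=.
by rewrite big_split.
Qed.

(* The weight of the edge ij in the face ijk is indexed by the ordered triple
   (i, j, k). *)
Section Assembly.
Variables (V W : 'I_N -> 'I_N -> 'I_N -> R).
Hypothesis V_sym : forall i j k, face i j k -> V j i k = V i j k.
Hypothesis W_sym : forall i j k, face i j k -> W j i k = W i j k.

(** A weighted Laplacian with separate diagonal weights: [V] equals [W] in the Euclidean case, and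
    exceeds or equals it in the hyperbolic case. *)
Definition assembled : 'M[R]_N := \matrix_(i, j)
  ((\sum_j' \sum_(k | face i j' k) V i j' k) *+ (i == j) -
   \sum_(k | face i j k) W i j k).

Lemma assembled_mul (x : 'cV[R]_N) i : (assembled *m x) i 0 =
  \sum_j \sum_(k | face i j k) (V i j k * x i 0 - W i j k * x j 0).
Proof.
rewrite mxE; under eq_bigr => j _ do rewrite mxE mulrBl.
rewrite big_split /= (bigD1 i) //= eqxx mulr1n [X in _ + X + _]big1 => [|j ji]; last first.
  by rewrite eq_sym (negPf ji) mulr0n mul0r.
rewrite addr0 mulr_suml -big_split; apply: eq_bigr => j _ /=.
rewrite -mulNr mulr_suml -sumrN mulr_suml -big_split; apply: eq_bigr => k _ /=.
by rewrite mulNr.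
Qed.

Lemma assembled_sym : assembled^T = assembled.
Proof.
apply/matrixP => i j; rewrite !mxE eq_sym; congr (_ - _).
  by case: eqVneq => // ->.
by rewrite (eq_bigl _ _ (fun k => face_flip i j k)); apply: eq_bigr => k; exact: W_sym.
Qed.

(** Doubling allows each edge of a face to be counted in both orientations, so that the form becomes
    symmetric in the two ends. For [V] = [W] it is a Dirichlet energy. *)
Lemma assembled_quadratic (x : 'cV[R]_N) : 2 * dotv x (assembled *m x) =
  \sum_i \sum_j \sum_(k | face i j k)
    (V i j k * (x i 0 ^+ 2 + x j 0 ^+ 2) - 2 * W i j k * x i 0 * x j 0).
Proof.
pose f i j k := V i j k * x i 0 ^+ 2 - W i j k * x i 0 * x j 0.
have E : dotv x (assembled *m x) = \sum_i \sum_j \sum_(k | face i j k) f i j k.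
  rewrite dotvE; apply: eq_bigr => i _; rewrite assembled_mul mulr_sumr.
  apply: eq_bigr => j _; rewrite mulr_sumr; apply: eq_bigr => k _.
  by rewrite /f; ring.
have E' : dotv x (assembled *m x) = \sum_i \sum_j \sum_(k | face i j k) f j i k.
  rewrite E exchange_big /=; apply: eq_bigr => i _; apply: eq_bigr => j _.
  by apply: eq_bigl => k; rewrite face_flip.
rewrite mulr_natl mulr2n {1}E E' -big_split; apply: eq_bigr => i _ /=.
rewrite -big_split; apply: eq_bigr => j _ /=.
rewrite -big_split; apply: eq_bigr => k fk /=.
by rewrite /f (V_sym fk) (W_sym fk); ring.
Qed.

End Assembly.

Lemma curvature_derive (angle : R -> R -> R -> R) (l : 'cV[R]_N -> 'I_N -> 'I_N -> R)
    (V W : 'cV[R]_N -> 'I_N -> 'I_N -> 'I_N -> R) (g : R -> 'cV[R]_N)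
    (t : R) (x : 'cV[R]_N) :
  (forall i j k, face i j k ->
    is_derive t 1 (fun s => angle (l (g s) i j) (l (g s) i k) (l (g s) j k))
      (- ((V (g t) i j k * x i 0 - W (g t) i j k * x j 0) +
          (V (g t) i k j * x i 0 - W (g t) i k j * x k 0)))) ->
  forall i, is_derive t 1 (fun s => curvature T angle (l (g s)) i 0)
    ((assembled (V (g t)) (W (g t)) *m x) i 0).
Proof.
move=> h i; rewrite assembled_mul.
pose A j k := V (g t) i j k * x i 0 - W (g t) i j k * x j 0.
rewrite (_ : (fun s => _) = fun s => 2 * pi - \sum_(j < N)
   \sum_(k < N | (j < k)%N && face i j k) 
     angle (l (g s) i j) (l (g s) i k) (l (g s) j k)); last first.
  by apply/funext => s; rewrite mxE.
have hs : is_derive t 1 (fun s => \sum_(j < N)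
   \sum_(k < N | (j < k)%N && face i j k)
     angle (l (g s) i j) (l (g s) i k) (l (g s) j k))
   (\sum_(j < N) \sum_(k < N | (j < k)%N && face i j k) - (A j k + A k j)).
  apply: der_sum => j _; apply: der_sum => k /andP[_ f].
  by have := h i j k f.
apply: der_eq (derB (derC (2 * pi) t) hs) _.
rewrite sub0r -(sum_face_pairs i A) -sumrN; apply: eq_bigr => j _.
by rewrite -sumrN; apply: eq_bigr => k _; rewrite opprK.
Qed.

End Triangulation.

(** * Bounded Lipschitz functions on a set *)

Section BoundedLipschitz.
Variables (R : realType) (N : nat) (A : 'cV[R]_N -> Prop).
Implicit Types (f g : 'cV[R]_N -> R).

(** Boundedness is included to make the class stable under products; the entries of L are then
    treated by following their formulas. *)
Definition lipb f := exists2 C, 0 <= C & forall u v, A u -> A v ->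
  `|f u| <= C /\ `|f u - f v| <= C * `|u - v|.

Lemma lipb_const c : lipb (fun=> c).
Proof.
exists `|c| => // u v _ _; split=> //.
by rewrite subrr normr0 mulr_ge0.
Qed.

Lemma lipbD f g : lipb f -> lipb g -> lipb (fun u => f u + g u).
Proof.
move=> [C C0 hf] [B B0 hg]; exists (C + B); first exact: addr_ge0.
move=> u v Au Av; have [f1 f2] := hf u v Au Av; have [g1 g2] := hg u v Au Av.
split; first by apply: (le_trans (ler_normD _ _)); exact: lerD.
rewrite opprD addrACA mulrDl; apply: (le_trans (ler_normD _ _)); exact: lerD.
Qed.

Lemma lipbN f : lipb f -> lipb (fun u => - f u).
Proof.
move=> [C C0 hf]; exists C => // u v Au Av; have [f1 f2] := hf u v Au Av.
by split; rewrite ?normrN // -opprD normrN.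
Qed.

Lemma lipbB f g : lipb f -> lipb g -> lipb (fun u => f u - g u).
Proof. by move=> hf hg; apply: lipbD => //; exact: lipbN. Qed.

Lemma lipbM f g : lipb f -> lipb g -> lipb (fun u => f u * g u).
Proof.
move=> [C C0 hf] [B B0 hg]; exists (2 * (C * B)).
  by rewrite !mulr_ge0.
move=> u v Au Av; have [f1 f2] := hf u v Au Av; have [g1 g2] := hg u v Au Av.
have [fv _] := hf v u Av Au; have CB := mulr_ge0 C0 B0.
split.
  rewrite normrM; apply: (@le_trans _ _ (C * B)); first exact: ler_pM.
  by rewrite ler_peMl // ler1n.
have -> : f u * g u - f v * g v = (f u - f v) * g u + f v * (g u - g v) by ring.
apply: (le_trans (ler_normD _ _)); rewrite !normrM.
have -> : 2 * (C * B) * `|u - v| = C * `|u - v| * B + C * (B * `|u - v|) by ring.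
by apply: lerD; apply: ler_pM.
Qed.

Lemma lipbX f n : lipb f -> lipb (fun u => f u ^+ n).
Proof.
move=> hf; elim: n => [|n IH]; first exact: lipb_const.
by under eq_fun do rewrite exprS; exact: lipbM.
Qed.

Lemma lipb_sum (I : Type) (r : seq I) (P : pred I) (h : I -> 'cV[R]_N -> R) :
  (forall i, P i -> lipb (h i)) -> lipb (fun u => \sum_(i <- r | P i) h i u).
Proof.
move=> hh; elim: r => [|i r IH].
  by under eq_fun do rewrite big_nil; exact: lipb_const.
have [Pi|/negPf Pi] := boolP (P i).
  by under eq_fun do rewrite big_cons Pi; apply: lipbD => //; exact: hh.
by under eq_fun do rewrite big_cons Pi.
Qed.

Lemma lipbV f c : 0 < c -> (forall u, A u -> c <= f u) -> lipb f ->
  lipb (fun u => (f u)^-1).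
Proof.
move=> c0 fc [C C0 hf]; have cV := invr_ge0 c; rewrite (ltW c0) in cV.
exists (c^-1 + C * c^-1 * c^-1); first by rewrite addr_ge0 // !mulr_ge0 // cV.
move=> u v Au Av; have [f1 f2] := hf u v Au Av.
have fu := lt_le_trans c0 (fc u Au); have fv := lt_le_trans c0 (fc v Av).
have iu : (f u)^-1 <= c^-1 by rewrite lef_pV2 ?posrE // fc.
have iv : (f v)^-1 <= c^-1 by rewrite lef_pV2 ?posrE // fc.
have iu0 : 0 <= (f u)^-1 by rewrite invr_ge0 ltW.
have iv0 : 0 <= (f v)^-1 by rewrite invr_ge0 ltW.
split.
  rewrite (ger0_norm iu0); apply: (le_trans iu).
  by rewrite lerDl !mulr_ge0 // cV.
have -> : (f u)^-1 - (f v)^-1 = (f v - f u) * (f u)^-1 * (f v)^-1.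
  by field; rewrite !gt_eqF.
rewrite !normrM distrC (ger0_norm iu0) (ger0_norm iv0).
apply: (@le_trans _ _ (C * `|u - v| * c^-1 * c^-1)).
  by apply: ler_pM; rewrite ?mulr_ge0 //; apply: ler_pM.
rewrite mulrDl; have -> : C * `|u - v| * c^-1 * c^-1 = C * c^-1 * c^-1 * `|u - v|.
  by ring.
by rewrite lerDr mulr_ge0 // cV.
Qed.

Lemma lipb_sqrt f c : 0 < c -> (forall u, A u -> c <= f u) -> lipb f ->
  lipb (fun u => Num.sqrt (f u)).
Proof.
move=> c0 fc [C C0 hf]; have r0 : 0 < Num.sqrt c by rewrite sqrtr_gt0.
exists (1 + C + C / Num.sqrt c).
  by rewrite !addr_ge0 // divr_ge0 // ltW.
move=> u v Au Av; have [f1 f2] := hf u v Au Av.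
have fu := lt_le_trans c0 (fc u Au); have fv := lt_le_trans c0 (fc v Av).
have ru : Num.sqrt c <= Num.sqrt (f u) by rewrite ler_sqrt ?fc // ltW.
have rv : 0 < Num.sqrt (f v) by rewrite sqrtr_gt0.
have su : Num.sqrt (f u) ^+ 2 = f u by rewrite sqr_sqrtr // ltW.
have sv : Num.sqrt (f v) ^+ 2 = f v by rewrite sqr_sqrtr // ltW.
split.
  rewrite ger0_norm ?sqrtr_ge0 //; have Cr : 0 <= C / Num.sqrt c by rewrite divr_ge0 // ltW.
  have : Num.sqrt (f u) <= 1 + f u by move: su; nra.
  have := ler_norm (f u); lra.
have ruv : 0 < Num.sqrt (f u) + Num.sqrt (f v) by rewrite ltr_wpDl ?sqrtr_ge0.
have -> : Num.sqrt (f u) - Num.sqrt (f v) = (f u - f v) / (Num.sqrt (f u) + Num.sqrt (f v)).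
  have -> : f u - f v = (Num.sqrt (f u) - Num.sqrt (f v)) *
      (Num.sqrt (f u) + Num.sqrt (f v)) by rewrite -subr_sqr su sv.
  by rewrite mulfK // gt_eqF.
rewrite normrM normfV (gtr0_norm ruv).
apply: (@le_trans _ _ (C * `|u - v| / Num.sqrt c)).
  apply: ler_pM; rewrite ?invr_ge0 ?(ltW ruv) //.
  by rewrite lef_pV2 ?posrE // (le_trans ru) // lerDl ltW.
rewrite mulrAC ler_wpM2r // lerDr addr_ge0 //.
Qed.

Lemma lipb_coord (h dh : R -> R) (lo hi M : R) i : 0 <= M ->
  (forall u, A u -> lo <= u i 0 <= hi) ->
  (forall x, lo <= x <= hi -> is_derive x 1 h (dh x)) ->
  (forall x, lo <= x <= hi -> `|h x| <= M /\ `|dh x| <= M) ->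
  lipb (fun u => h (u i 0)).
Proof.
move=> M0 Ai hd hM; exists M => // u v Au Av; split.
  by have [] := hM _ (Ai u Au).
have hdM (x : R) : lo <= x <= hi -> `|dh x| <= M by move=> /hM[].
apply: (le_trans (lipschitz_of_derive hd hdM (Ai u Au) (Ai v Av))).
rewrite ler_wpM2l //.
by have := norm_coord (u - v) i; rewrite !mxE.
Qed.

Lemma lipb_bound f : lipb f -> exists2 C, 0 < C & forall u, A u -> f u <= C.
Proof.
move=> [C C0 hf]; exists (C + 1); first by rewrite ltr_wpDl.
move=> u Au; have [h _] := hf u u Au Au.
by rewrite (le_trans (ler_norm _)) // (le_trans h) // lerDl.
Qed.

End BoundedLipschitz.

(** Makes constants uniform over the finitely many faces or vertices; the condition of being a face
    is put inside [P]. *)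
Lemma finite_common_pos (R : realType) (I : finType) (P : I -> R -> Prop) :
  (forall i, exists2 c, 0 < c & P i c) ->
  (forall i c c', 0 < c' -> c' <= c -> P i c -> P i c') ->
  exists2 c, 0 < c & forall i, P i c.
Proof.
move=> hP mono; have /choice[f fP] i : exists c, 0 < c /\ P i c.
  by have [c c0 hc] := hP i; exists c.
exists (\big[Num.min/1]_i f i).
  by apply: lt_bigmin => // i _; case: (fP i).
move=> i; have [_ h] := fP i; apply: mono h; last exact: bigmin_le_cond.
by apply: lt_bigmin => // j _; case: (fP j).
Qed.

Lemma finite_common_bound (R : realType) (I : finType) (P : I -> R -> Prop) :
  (forall i, exists2 c, 0 <= c & P i c) ->
  (forall i c c', c <= c' -> P i c -> P i c') ->
  exists2 c, 0 <= c & forall i, P i c.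
Proof.
move=> hP mono; have /choice[f fP] i : exists c, 0 <= c /\ P i c.
  by have [c c0 hc] := hP i; exists c.
exists (\big[Num.max/0]_i f i); first exact: bigmax_ge_id.
by move=> i; have [_ h] := fP i; apply: mono h; exact: le_bigmax_cond.
Qed.

Section AssembledLipschitz.
Variables (R : realType) (N : nat) (T : triangulation N) (A : 'cV[R]_N -> Prop).
Variables V W : 'cV[R]_N -> 'I_N -> 'I_N -> 'I_N -> R.
Hypothesis V_lipb : forall i j k, face T i j k -> lipb A (fun u => V u i j k).
Hypothesis W_lipb : forall i j k, face T i j k -> lipb A (fun u => W u i j k).

Lemma assembled_lipschitz : exists2 L, 0 <= L & forall u v, A u -> A v ->
  forall i j, `|assembled T (V u) (W u) i j| <= L /\
    `|assembled T (V u) (W u) i j - assembled T (V v) (W v) i j| <= L * `|u - v|.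
Proof.
pose P (p : 'I_N * 'I_N) L := forall u v, A u -> A v ->
  `|assembled T (V u) (W u) p.1 p.2| <= L /\
  `|assembled T (V u) (W u) p.1 p.2 - assembled T (V v) (W v) p.1 p.2| <= L * `|u - v|.
have [[i j]|p c c' cc' h u v Au Av|L L0 hL] := @finite_common_bound R _ P.
- suff : lipb A (fun u => assembled T (V u) (W u) i j) by [].
  under eq_fun do rewrite mxE; apply: lipbB; last first.
    by apply: lipb_sum => k; exact: W_lipb.
  case: eqVneq => _; last first.
    by under eq_fun do rewrite mulr0n; exact: lipb_const.
  under eq_fun do rewrite mulr1n.
  by apply: lipb_sum => j' _; apply: lipb_sum => k; exact: V_lipb.
- have [h1 h2] := h u v Au Av; split; first exact: le_trans cc'.
  by apply: (le_trans h2); rewrite ler_wpM2r.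
by exists L => // u v Au Av i j; exact: (hL (i, j)).
Qed.

End AssembledLipschitz.

(** * Euclidean curvature *)

Section Poincare.
Variables (R : realType) (N : nat) (T : triangulation N) (eta : {set 'I_N} -> R).
Hypothesis eta_range : forall p q, [set p; q]%SET \in edges T ->
  -1 < eta [set p; q]%SET <= 1.
Hypothesis eta_structure : structure_condition T eta.
Implicit Types (i j k : 'I_N) (x : 'cV[R]_N).

Definition fweight i j k :=
  face_weight (eta [set j; k]%SET) (eta [set i; k]%SET) (eta [set i; j]%SET).

Let face_nd i j k : face T i j k ->
  nondeg (eta [set j; k]%SET) (eta [set i; k]%SET) (eta [set i; j]%SET).
Proof. exact: face_nondeg. Qed.

Lemma fweight_ge0 i j k : face T i j k -> 0 <= fweight i j k.
Proof. by move=> f; apply/face_weight_ge0/face_nd. Qed.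

Lemma fweight_eq0 i j k : face T i j k -> fweight i j k = 0 ->
  0 < fweight i k j /\ 0 < fweight j k i.
Proof.
move=> f /(face_weight_eq0 (face_nd f)); rewrite /fweight.
by rewrite ![[set k; _]%SET]finset.setUC [[set j; i]%SET]finset.setUC.
Qed.

(** The energy controls the increments of [x] along edges, connectedness of the skeleton extends
    this to all pairs of vertices, and the zero sum turns differences into coordinates. *)
Lemma dirichlet_poincare : exists2 mu, 0 < mu & forall x, \sum_i x i 0 = 0 ->
  mu * dotv x x <=
  \sum_i \sum_j \sum_(k | face T i j k) fweight i j k * (x i 0 - x j 0) ^+ 2.
Proof.
(* The least nonzero weight; zero weights have to be set aside. *)
have [m m0 hm] : exists2 m, 0 < m & forall p : 'I_N * 'I_N * 'I_N,
    face T p.1.1 p.1.2 p.2 -> fweight p.1.1 p.1.2 p.2 != 0 ->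
    m <= fweight p.1.1 p.1.2 p.2.
  apply: finite_common_pos => [[[i j] k]|p c c' _ cc' h f w0] /=; last first.
    by apply: le_trans cc' _; exact: h.
  have [f|nf] := boolP (face T i j k); last by exists 1 => //.
  have [w0|w0] := eqVneq (fweight i j k) 0; first by exists 1.
  by exists (fweight i j k) => //; rewrite lt_neqAle eq_sym w0 fweight_ge0.
have N0 : 0 < N%:R :> R by rewrite ltr0n (Defs.nonempty T).
exists (m / (N%:R * (N%:R * 2) ^+ 2)).
  by rewrite divr_gt0 // mulr_gt0 // exprn_gt0 // mulr_gt0.
move=> x sx; set E := \sum_i _.
have term_ge0 i j k : face T i j k -> 0 <= fweight i j k * (x i 0 - x j 0) ^+ 2.
  by move=> f; rewrite mulr_ge0 ?fweight_ge0 ?sqr_ge0.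
have E0 : 0 <= E.
  by apply: sumr_ge0 => i _; apply: sumr_ge0 => j _; apply: sumr_ge0 => k; exact: term_ge0.
pose e := Num.sqrt (E / m).
have e0 : 0 <= e by exact: sqrtr_ge0.
have e2 : e ^+ 2 = E / m by rewrite sqr_sqrtr // divr_ge0 // ltW.
have strong i j k : face T i j k -> fweight i j k != 0 -> `|x i 0 - x j 0| <= e.
  move=> f w0; rewrite -ler_sqr ?qualifE //= real_normK ?num_real // e2 ler_pdivlMr //.
  apply: (@le_trans _ _ (fweight i j k * (x i 0 - x j 0) ^+ 2)).
    by rewrite mulrC ler_wpM2r ?sqr_ge0 // (hm (i, j, k)).
  rewrite /E (bigD1 i) //= (bigD1 j) //= (bigD1 k) //= -!addrA lerDl !addr_ge0 //.
  - by apply: sumr_ge0 => k' /andP[f' _]; exact: term_ge0.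
  - by apply: sumr_ge0 => j' _; apply: sumr_ge0 => k'; exact: term_ge0.
  - by apply: sumr_ge0 => i' _; apply: sumr_ge0 => j' _; apply: sumr_ge0 => k'; exact: term_ge0.
(* An edge with zero weight in a face is bypassed through the third vertex, since the other two
   edges then have positive weight. Hence the factor 2. *)
have edge_le i j : [set i; j]%SET \in edges T -> `|x i 0 - x j 0| <= 2 * e.
  move=> /edge_face[k f]; have [w0|w0] := eqVneq (fweight i j k) 0; last first.
    by apply: (le_trans (strong _ _ _ f w0)); lra.
  have [w1 w2] := fweight_eq0 f w0.
  have f1 : face T i k j by rewrite face_swap.
  have f2 : face T j k i by rewrite face_swap face_flip.
  have h1 := strong _ _ _ f1 (lt0r_neq0 w1).
  have h2 := strong _ _ _ f2 (lt0r_neq0 w2).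
  have := ler_normD (x i 0 - x k 0) (x k 0 - x j 0).
  rewrite addrA subrK (distrC (x k 0)); lra.
pose adj := fun p q : 'I_N => [set p; q]%SET \in edges T.
have path_le p i : path adj i p -> `|x i 0 - x (last i p) 0| <= (size p)%:R * (2 * e).
  elim: p i => [|j p IH] i /=; first by rewrite subrr normr0 mul0r.
  move=> /andP[/edge_le h1 /IH h2].
  have := ler_normD (x i 0 - x j 0) (x j 0 - x (last j p) 0).
  rewrite addrA subrK -natr1 mulrDl mul1r; lra.
have diff_le i j : `|x i 0 - x j 0| <= N%:R * (2 * e).
  have /connectP[p pp ->] := connected_skeleton T i j.
  case/shortenP: pp => p' pp' up' _.
  apply: (le_trans (path_le _ _ pp')); rewrite ler_wpM2r ?mulr_ge0 // ler_nat.
  have := max_card (mem (i :: p')); rewrite (card_uniqP up') card_ord /=.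
  exact: ltnW.
have coord_le i : `|x i 0| <= N%:R * 2 * e.
  (* As the coordinates sum to 0, this sum is N times the i-th coordinate. *)
  have : `|\sum_(j < N) (x i 0 - x j 0)| <= N%:R * (N%:R * (2 * e)).
    by apply: (le_trans (ler_norm_sum _ _ _)); apply: sum_ord_le.
  rewrite big_split /= sumrN sx subr0 sumr_const card_ord -[x i 0 *+ N]mulr_natl normrM.
  by rewrite (ger0_norm (ltW N0)) ler_pM2l // mulrA.
have : dotv x x <= N%:R * ((N%:R * 2 * e) ^+ 2).
  rewrite dotvE; apply: sum_ord_le => i; rewrite -expr2 -real_normK ?num_real //.
  by rewrite lerXn2r ?qualifE //= ?mulr_ge0 ?ler0n.
rewrite exprMn e2 => h; rewrite mulrAC ler_pdivrMr ?mulr_gt0 ?exprn_gt0 ?mulr_gt0 //.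
have -> : E * (N%:R * (N%:R * 2) ^+ 2) = m * (N%:R * ((N%:R * 2) ^+ 2 * (E / m))).
  by field; rewrite gt_eqF.
by rewrite ler_pM2l.
Qed.

End Poincare.

Section EuclideanSystem.
Variables (R : realType) (N : nat) (T : triangulation N) (eta : {set 'I_N} -> R).
Hypothesis eta_range : forall p q, [set p; q]%SET \in edges T ->
  -1 < eta [set p; q]%SET <= 1.
Hypothesis eta_structure : structure_condition T eta.
Implicit Types (i j k : 'I_N) (u x : 'cV[R]_N).

Definition eucl_weight u i j k : R :=
  eW (expR (u i 0)) (expR (u j 0)) (expR (u k 0))
    (eta [set j; k]%SET) (eta [set i; k]%SET) (eta [set i; j]%SET).

Definition eucl_jacobian u := assembled T (eucl_weight u) (eucl_weight u).

Let face_nd i j k : face T i j k ->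
  nondeg (eta [set j; k]%SET) (eta [set i; k]%SET) (eta [set i; j]%SET).
Proof. exact: face_nondeg. Qed.

Lemma eucl_weight_sym u i j k : eucl_weight u j i k = eucl_weight u i j k.
Proof. by rewrite /eucl_weight [[set j; i]%SET]finset.setUC eW_sym. Qed.

Lemma eucl_curvature_derive (g : R -> 'cV[R]_N) (t : R) x :
  (forall i, is_derive t 1 (fun z => g z i 0) (x i 0)) ->
  forall i, is_derive t 1 (fun z => eucl_curvature T eta (g z) i 0)
    ((eucl_jacobian (g t) *m x) i 0).
Proof.
move=> hg; apply: curvature_derive => i j k f.
have h := eucl_angle_derive (face_nd f) (hg i) (hg j) (hg k).
apply: der_eq h _; rewrite -!mulrBr.
by congr (- (_ + _ * _)); rewrite /eucl_weight [[set k; j]%SET]finset.setUC.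
Qed.

Section Box.
Variables lo hi : R.
Let A := @in_box R N lo hi.

Let expR_lipb i : lipb A (fun u => expR (u i 0)).
Proof.
apply: (@lipb_coord _ _ _ _ expR lo hi (expR hi)) => [|u ub|x /andP[_ xh]].
- exact: expR_ge0.
- exact: ub.
- by rewrite ger0_norm ?expR_ge0 // ler_expR.
Qed.

Let e := expR lo.
Let e0 : 0 < e := expR_gt0 lo.

Let expR_ge u i : A u -> e <= expR (u i 0).
Proof. by move=> /(_ i)/andP[h _]; rewrite ler_expR. Qed.

Let prod_ge (X Y : R) : e <= X -> e <= Y -> e ^+ 2 <= X * Y.
Proof. by move=> eX eY; rewrite expr2 ler_pM // ltW. Qed.

Let sqr_prod_ge (X Y : R) : e <= X -> e <= Y -> e ^+ 4 <= X ^+ 2 * Y ^+ 2.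
Proof.
move=> eX eY; have h := prod_ge eX eY; have h0 : 0 <= e ^+ 2 by exact: sqr_ge0.
by rewrite -exprMn (exprM e 2 2) lerXn2r ?qualifE //= (le_trans h0).
Qed.

Let quad_ge (X Y Z : R) : e <= X -> e <= Y -> e <= Z -> e ^+ 4 <= X * Y * Z * X.
Proof.
move=> eX eY eZ; have -> : X * Y * Z * X = (X * Y) * (X * Z) by ring.
rewrite (exprD e 2 2).
by apply: ler_pM; rewrite ?exprn_ge0 ?(ltW e0) ?prod_ge.
Qed.

Let eP_lower (X Y c : R) : e <= X -> e <= Y -> -1 < c <= 1 ->
  e ^+ 2 * (1 + c) <= eP X Y c.
Proof.
move=> eX eY /andP[c1 c2]; have eXY := prod_ge eX eY.
have h0 : 0 <= 1 + c by lra.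
have h1 := ler_wpM2r h0 eXY.
have h2 : 0 <= X * Y * (1 + c).
  by rewrite mulr_ge0 // (le_trans _ eXY) // sqr_ge0.
by have := sqr_ge0 (X - Y); rewrite /eP; lra.
Qed.

(** [eS] is homogeneous of degree four with nonnegative coefficients, so each monomial may be
    replaced by e^4. *)
Let eS_lower (X Y Z a b c : R) : e <= X -> e <= Y -> e <= Z -> nondeg a b c ->
  e ^+ 4 * eS 1 1 1 a b c <= eS X Y Z a b c.
Proof.
move=> eX eY eZ [ha hb hc [g1 g2 g3]].
have a2 := nondeg_sqr ha; have b2 := nondeg_sqr hb; have c2 := nondeg_sqr hc.
have h1 := ler_wpM2r c2 (sqr_prod_ge eX eY).
have h2 := ler_wpM2r b2 (sqr_prod_ge eX eZ).
have h3 := ler_wpM2r a2 (sqr_prod_ge eY eZ).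
have h4 := ler_wpM2r g1 (quad_ge eX eY eZ).
have h5 := ler_wpM2r g2 (quad_ge eY eX eZ).
have h6 := ler_wpM2r g3 (quad_ge eZ eX eY).
rewrite /eS !expr1n !mul1r; lra.
Qed.

Let eQ_lower (X Y Z a b c : R) : e <= X -> e <= Y -> e <= Z -> nondeg a b c ->
  e ^+ 2 * face_weight a b c <= eQ X Y Z a b c.
Proof.
move=> eX eY eZ [ha hb hc [g1 g2 g3]]; have c2 := nondeg_sqr hc.
have h1 := ler_wpM2r c2 (prod_ge eX eY).
have h2 := ler_wpM2r g1 (prod_ge eX eZ).
have h3 := ler_wpM2r g2 (prod_ge eY eZ).
rewrite /eQ /face_weight; lra.
Qed.

Let eP_lipb i j (c : R) : lipb A (fun u => eP (expR (u i 0)) (expR (u j 0)) c).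
Proof.
apply: lipbD; first by apply: lipbD; exact: lipbX.
by apply: lipbM => //; apply: lipbM => //; exact: lipb_const.
Qed.

Let eQ_lipb i j k (a b c : R) :
  lipb A (fun u => eQ (expR (u i 0)) (expR (u j 0)) (expR (u k 0)) a b c).
Proof.
by apply: lipbD; [apply: lipbD|]; apply: lipbM => //;
  try exact: lipb_const; exact: lipbM.
Qed.

Let eS_lipb i j k (a b c : R) :
  lipb A (fun u => eS (expR (u i 0)) (expR (u j 0)) (expR (u k 0)) a b c).
Proof.
have c3 (x y : 'I_N) (z : R) : lipb A (fun u : 'cV[R]_N => expR (u x 0) ^+ 2 * expR (u y 0) ^+ 2 * z).
  apply: lipbM; last exact: lipb_const.
  by apply: lipbM; exact: lipbX.
have c4 (x : 'I_N) (y : R) : lipb A (fun u : 'cV[R]_N => expR (u x 0) * y).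
  by apply: lipbM => //; exact: lipb_const.
apply: lipbD; first by apply: lipbD; [apply: lipbD|]; exact: c3.
apply: lipbM; last by apply: lipbD; [apply: lipbD|]; exact: c4.
by do 3!(apply: lipbM => //); exact: lipb_const.
Qed.

Let denom_lower u i j k : A u -> face T i j k ->
  let a := eta [set j; k]%SET in let b := eta [set i; k]%SET in
  let c := eta [set i; j]%SET in
  [/\ 0 < e ^+ 4 * eS 1 1 1 a b c, 0 < e ^+ 2 * (1 + c) &
  Num.sqrt (e ^+ 4 * eS 1 1 1 a b c) * (e ^+ 2 * (1 + c)) <=
  Num.sqrt (eS (expR (u i 0)) (expR (u j 0)) (expR (u k 0)) a b c) *
    eP (expR (u i 0)) (expR (u j 0)) c].
Proof.
move=> ub f a b c; have nd := face_nd f.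
have s0 : 0 < e ^+ 4 * eS 1 1 1 a b c.
  by rewrite mulr_gt0 ?exprn_gt0 // eS_gt0.
have p0 : 0 < e ^+ 2 * (1 + c).
  rewrite mulr_gt0 ?exprn_gt0 //.
  by have [_ _ /andP[h _] _] := nd; move: h; rewrite -/c; lra.
split => //; apply: ler_pM; rewrite ?sqrtr_ge0 ?(ltW p0) //.
- rewrite ler_sqrt; last by apply: (le_trans (ltW s0)); apply: eS_lower; rewrite ?expR_ge.
  by apply: eS_lower; rewrite ?expR_ge.
- by apply: eP_lower; rewrite ?expR_ge //; case: nd.
Qed.

Let denom_lipb i j k : face T i j k -> 
  let a := eta [set j; k]%SET in let b := eta [set i; k]%SET in
  let c := eta [set i; j]%SET in
  lipb A (fun u => Num.sqrt (eS (expR (u i 0)) (expR (u j 0)) (expR (u k 0)) a b c) *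
    eP (expR (u i 0)) (expR (u j 0)) c).
Proof.
move=> f a b c; apply: lipbM; last exact: eP_lipb.
have s0 : 0 < e ^+ 4 * eS 1 1 1 a b c.
  by rewrite mulr_gt0 ?exprn_gt0 // eS_gt0 //; exact: face_nd.
apply: (lipb_sqrt s0); last exact: eS_lipb.
by move=> u ub; apply: eS_lower; rewrite ?expR_ge //; exact: face_nd.
Qed.

Lemma eucl_weight_lipb i j k : face T i j k -> lipb A (fun u => eucl_weight u i j k).
Proof.
move=> f; apply: lipbM.
  by apply: lipbM; [exact: lipbM|exact: eQ_lipb].
have [[u0 u0b]|nA] := pselect (exists u, A u); last first.
  exists 0 => // u v uA _; by case: nA; exists u.
have [s0 p0 _] := denom_lower u0b f.
apply: (@lipbV _ _ _ _ (Num.sqrt (e ^+ 4 * eS 1 1 1 (eta [set j; k]%SET)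
  (eta [set i; k]%SET) (eta [set i; j]%SET)) * (e ^+ 2 * (1 + eta [set i; j]%SET)))).
- by rewrite mulr_gt0 // sqrtr_gt0.
- by move=> v vb; have [] := denom_lower vb f.
- exact: denom_lipb.
Qed.

Lemma eucl_weight_lower : exists2 c, 0 < c & forall u i j k, A u -> face T i j k ->
  c * fweight eta i j k <= eucl_weight u i j k.
Proof.
have [||c c0 hc] := @finite_common_pos R ('I_N * 'I_N * 'I_N)%type
  (fun p c => forall u, A u -> face T p.1.1 p.1.2 p.2 ->
    c * fweight eta p.1.1 p.1.2 p.2 <= eucl_weight u p.1.1 p.1.2 p.2).
- move=> [[i j] k] /=; have [f|nf] := boolP (face T i j k); last by exists 1.
  have [D D0 hD] := lipb_bound (denom_lipb f).
  (* Two factors e come from the product of exponentials, two from [eQ]; [D] bounds the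
     denominator. *)
  exists (e ^+ 4 / D); first by rewrite divr_gt0 ?exprn_gt0.
  move=> u ub _; have [s0 p0 hden] := denom_lower ub f.
  have r0 : 0 < Num.sqrt (e ^+ 4 * eS 1 1 1 (eta [set j; k]%SET)
    (eta [set i; k]%SET) (eta [set i; j]%SET)) by rewrite sqrtr_gt0.
  have den0 := lt_le_trans (mulr_gt0 r0 p0) hden.
  have nd := face_nd f.
  have eu := expR_ge _ ub.
  rewrite /eucl_weight /eW ler_pdivlMr //.
  have F0 := fweight_ge0 eta_range eta_structure f.
  apply: (@le_trans _ _ (e ^+ 4 * fweight eta i j k)).
    rewrite [e ^+ 4 / D * _]mulrAC -[leLHS]mulrA ler_piMr //.
      by rewrite mulr_ge0 // exprn_ge0 // ltW.
    by rewrite mulrC ler_pdivrMr // mul1r hD.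
  rewrite (exprD e 2 2) -mulrA; apply: ler_pM; rewrite ?sqr_ge0 //.
  - by rewrite mulr_ge0 ?sqr_ge0.
  - by apply: prod_ge; exact: eu.
  - by apply: eQ_lower; rewrite ?eu.
- by move=> [[i j] k] c c' c'0 cc' /= h u ub f; apply: le_trans (h u ub f);
    rewrite ler_wpM2r // (fweight_ge0 eta_range eta_structure).
by exists c => // u i j k ub f; exact: (hc (i, j, k)).
Qed.

End Box.

Lemma eucl_system :
  curvature_system (fun=> True) (const_mx 1) (eucl_curvature T eta) eucl_jacobian.
Proof.
split => //.
- by move=> a _; exists (a + 1) => //; rewrite ltrDl.
- by move=> g t x _; exact: eucl_curvature_derive.
- move=> u _; apply: assembled_sym => i j k _; exact: eucl_weight_sym.
- move=> u _; apply/colP => i; rewrite assembled_mul [RHS]mxE.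
  by apply: big1 => j _; apply: big1 => k _; rewrite !mxE subrr.
- move=> lo hi _.
  have [L L0 hL] := assembled_lipschitz (@eucl_weight_lipb lo hi) (@eucl_weight_lipb lo hi).
  by exists L => // u v ub vb i j; have [] := hL u v ub vb i j.
move=> lo hi _; have [c c0 hc] := eucl_weight_lower lo hi.
have [mu mu0 hmu] := dirichlet_poincare eta_range eta_structure.
(* The 2 comes from the doubled quadratic form. *)
exists (c * mu / 2); first by rewrite divr_gt0 // mulr_gt0.
move=> u x ub qx; have sx : \sum_i x i 0 = 0.
  by rewrite -[RHS]qx dotvE; apply: eq_bigr => i _; rewrite mxE mul1r.
have h1 := hmu x sx.
have h2 : c * (\sum_i \sum_j \sum_(k | face T i j k)
    fweight eta i j k * (x i 0 - x j 0) ^+ 2) <= 2 * dotv x (eucl_jacobian u *m x).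
  rewrite assembled_quadratic; last 2 first.
  - by move=> i j k _; exact: eucl_weight_sym.
  - by move=> i j k _; exact: eucl_weight_sym.
  rewrite mulr_sumr; apply: ler_sum => i _; rewrite mulr_sumr; apply: ler_sum => j _.
  rewrite mulr_sumr; apply: ler_sum => k f; rewrite mulrA.
  apply: (le_trans (ler_wpM2r (sqr_ge0 _) (hc u i j k ub f))).
  by rewrite le_eqVlt; apply/orP; left; apply/eqP; ring.
have := ler_wpM2l (ltW c0) h1; lra.
Qed.

End EuclideanSystem.

(** * Hyperbolic curvature *)

Section HyperbolicBounds.
Variable R : realType.
Implicit Types (X Y Z a b c : R).

Lemma hQ_ge X Y Z a b c : 1 <= X -> 1 <= Y -> 1 <= Z -> nondeg a b c ->
  face_weight a b c <= hQ X Y Z a b c.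
Proof.
move=> X1 Y1 Z1 [ha hb hc [g1 g2 g3]]; have c2 := nondeg_sqr hc.
have h1 := ler_wpM2r c2 Z1; have h2 := ler_wpM2r g1 Y1; have h3 := ler_wpM2r g2 X1.
rewrite /hQ /face_weight; lra.
Qed.

(** [hP] is a difference of squares, and the numerator X Y + c - u v of the gap cancels one of its
    factors. What is left stays bounded below up to the boundary. *)
Lemma hVW_gap (u v X Y Z a b c : R) : 0 <= u -> 0 <= v ->
  u ^+ 2 = X ^+ 2 - 1 -> v ^+ 2 = Y ^+ 2 - 1 ->
  1 <= X -> 1 <= Y -> 1 <= Z -> nondeg a b c ->
  hV X Y Z a b c - hW u v X Y Z a b c =
  hQ X Y Z a b c / (Num.sqrt (hG X Y Z a b c) * (X * Y + c + u * v)).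
Proof.
move=> u0 v0 u2 v2 X1 Y1 Z1 nd; have [_ _ /andP[hc _] _] := nd.
have r0 : 0 < Num.sqrt (hG X Y Z a b c) by rewrite sqrtr_gt0 hG_gt0.
have XY : 1 <= X * Y by nra.
have uv : 0 <= u * v by exact: mulr_ge0.
have p0 : 0 < X * Y + c + u * v by lra.
have PE : hP X Y c = (X * Y + c - u * v) * (X * Y + c + u * v).
  have -> : (X * Y + c - u * v) * (X * Y + c + u * v) =
    (X * Y + c) ^+ 2 - u ^+ 2 * v ^+ 2 by ring.
  by rewrite u2 v2 /hP; ring.
have P0 := hP_gt0 X1 Y1 hc; rewrite PE pmulr_lgt0 // in P0.
rewrite /hV /hW PE; move: (Num.sqrt _) r0 => r r0.
by field; rewrite !gt_eqF.
Qed.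

(** Derivative bounds fail at 1, so continuity there is drawn from the monotonicity of the
    cosine. *)
Lemma acos_near1 (e : R) : 0 < e -> exists2 del, 0 < del &
  forall y, -1 <= y <= 1 -> 1 - del <= y -> acos y <= e.
Proof.
move=> e0; have [pe|ep] := leP pi e.
  exists 1 => // y y1 _; apply: le_trans pe; exact: acos_lepi.
have ce : cos e < 1.
  rewrite -(cos0 R) ltr_cos ?in_itv /= ?lexx ?pi_ge0 ?(ltW e0) ?(ltW ep) //.
exists (1 - cos e); first by rewrite subr_gt0.
move=> y y1; rewrite opprB addrC subrK => cy.
rewrite leNgt; apply/negP => h.
have : cos (acos y) < cos e.
  by rewrite ltr_cos // in_itv /= ?(ltW e0) ?(ltW ep) // acos_ge0 ?acos_lepi.
by rewrite acosK ?in_itv //; apply/negP; rewrite -leNgt.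
Qed.

End HyperbolicBounds.

Section HyperbolicSystem.
Variables (R : realType) (N : nat) (T : triangulation N) (eta : {set 'I_N} -> R).
Hypothesis eta_range : forall p q, [set p; q]%SET \in edges T ->
  -1 < eta [set p; q]%SET <= 1.
Hypothesis eta_structure : structure_condition T eta.
Implicit Types (i j k : 'I_N) (u x : 'cV[R]_N).

Definition hyp_diag u i j k : R :=
  hV (cosh (u i 0)) (cosh (u j 0)) (cosh (u k 0))
    (eta [set j; k]%SET) (eta [set i; k]%SET) (eta [set i; j]%SET).

Definition hyp_offdiag u i j k : R :=
  hW (- sinh (u i 0)) (- sinh (u j 0))
    (cosh (u i 0)) (cosh (u j 0)) (cosh (u k 0))
    (eta [set j; k]%SET) (eta [set i; k]%SET) (eta [set i; j]%SET).

Definition hyp_jacobian u := assembled T (hyp_diag u) (hyp_offdiag u).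

(** Unlike the radii and lengths, this closed form keeps its meaning at u_i = 0. *)
Definition cos_angle u i j k : R :=
  hN (cosh (u i 0)) (cosh (u j 0)) (cosh (u k 0))
    (eta [set j; k]%SET) (eta [set i; k]%SET) (eta [set i; j]%SET) /
  (Num.sqrt (hP (cosh (u i 0)) (cosh (u j 0)) (eta [set i; j]%SET)) *
   Num.sqrt (hP (cosh (u i 0)) (cosh (u k 0)) (eta [set i; k]%SET))).

Let D := @coord_domain R N (fun x : R => x < 0).

Let face_nd i j k : face T i j k ->
  nondeg (eta [set j; k]%SET) (eta [set i; k]%SET) (eta [set i; j]%SET).
Proof. exact: face_nondeg. Qed.

Lemma hyp_diag_sym u i j k : hyp_diag u j i k = hyp_diag u i j k.
Proof. by rewrite /hyp_diag [[set j; i]%SET]finset.setUC hV_sym. Qed.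

Lemma hyp_offdiag_sym u i j k : hyp_offdiag u j i k = hyp_offdiag u i j k.
Proof. by rewrite /hyp_offdiag [[set j; i]%SET]finset.setUC hW_sym. Qed.

Lemma hyp_curvature_derive (g : R -> 'cV[R]_N) (t : R) x : D (g t) ->
  (forall i, is_derive t 1 (fun z => g z i 0) (x i 0)) ->
  forall i, is_derive t 1 (fun z => hyp_curvature T eta (g z) i 0)
    ((hyp_jacobian (g t) *m x) i 0).
Proof.
move=> Dt hg; apply: curvature_derive => i j k f.
have h := hyp_angle_derive (face_nd f) (Dt i) (Dt j) (Dt k) (hg i) (hg j) (hg k).
apply: der_eq h _.
by congr (- (_ + (_ * _ - _ * _)));
  rewrite /hyp_diag /hyp_offdiag [[set k; j]%SET]finset.setUC.
Qed.

Lemma hyp_curvatureE u i : D u -> hyp_curvature T eta u i 0 =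
  2 * pi - \sum_(j < N) \sum_(k < N | (j < k)%N && face T i j k) acos (cos_angle u i j k).
Proof.
move=> Du; rewrite mxE; congr (_ - _); apply: eq_bigr => j _.
apply: eq_bigr => k /andP[_ f].
by rewrite -hyp_angle_formula //; exact: face_nd.
Qed.

Lemma cos_angle_sqr u i j k : face T i j k ->
  let a := eta [set j; k]%SET in let b := eta [set i; k]%SET in
  let c := eta [set i; j]%SET in
  1 - cos_angle u i j k ^+ 2 = sinh (u i 0) ^+ 2 *
    hG (cosh (u i 0)) (cosh (u j 0)) (cosh (u k 0)) a b c /
    (hP (cosh (u i 0)) (cosh (u j 0)) c * hP (cosh (u i 0)) (cosh (u k 0)) b).
Proof.
move=> f a b c; have [_ /andP[hb _] /andP[hc _] _] := face_nd f.
have P1 : 0 < hP (cosh (u i 0)) (cosh (u j 0)) c by rewrite hP_gt0 ?cosh_ge1.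
have P2 : 0 < hP (cosh (u i 0)) (cosh (u k 0)) b by rewrite hP_gt0 ?cosh_ge1.
rewrite /cos_angle exprMn exprVn exprMn !sqr_sqrtr ?(ltW P1) ?(ltW P2) //.
have -> : sinh (u i 0) ^+ 2 = cosh (u i 0) ^+ 2 - 1.
  by rewrite coshE2 addrAC subrr add0r.
rewrite -hN_gram -/a -/b -/c; move: (hN _ _ _ _ _ _) => n.
by field; rewrite !gt_eqF.
Qed.

Lemma cos_angle_le1 u i j k : face T i j k -> -1 <= cos_angle u i j k <= 1.
Proof.
move=> f; have [_ /andP[hb _] /andP[hc _] _] := face_nd f.
have h : 0 <= 1 - cos_angle u i j k ^+ 2.
  rewrite cos_angle_sqr // divr_ge0 //.
    by rewrite mulr_ge0 ?sqr_ge0 // ltW // hG_gt0 ?cosh_ge1 //; exact: face_nd.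
  by rewrite mulr_ge0 // ltW // hP_gt0 ?cosh_ge1.
by move: (cos_angle _ _ _ _) h => y h; apply/andP; split; nra.
Qed.

Lemma cos_angle_lt1 u i j k : D u -> face T i j k -> cos_angle u i j k < 1.
Proof.
move=> Du f; have [_ /andP[hb _] /andP[hc _] _] := face_nd f.
have h : 0 < 1 - cos_angle u i j k ^+ 2.
  rewrite cos_angle_sqr // divr_gt0 //.
    rewrite mulr_gt0 //; last by rewrite hG_gt0 ?cosh_ge1 //; exact: face_nd.
    by rewrite exprn_even_gt0 //= lt_eqF // sinh_lt0 //; exact: Du.
  by rewrite mulr_gt0 // hP_gt0 ?cosh_ge1.
by move: (cos_angle _ _ _ _) h => y h; nra.
Qed.

Section Box.
Variable lo : R.
(** The box includes the boundary value 0, so the bounds below are uniform in the distance to it. *)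
Let A := @in_box R N lo 0.

Let M := expR (- lo).

Let sinh_cosh_bound (x : R) : lo <= x <= 0 -> `|sinh x| <= M /\ `|cosh x| <= M.
Proof.
move=> /andP[lx x0]; have h1 : expR (- x) <= M by rewrite ler_expR lerN2.
have h2 : expR x <= M by rewrite ler_expR; lra.
have := expR_gt0 x; have := expR_gt0 (- x).
by rewrite /sinh /cosh !ler_norml => e1 e2; split; apply/andP; split; lra.
Qed.

Let der_cosh1 (x : R) : is_derive x 1 (@cosh R) (sinh x).
Proof. by apply: der_eq (der_cosh (derI x)) _; rewrite mulr1. Qed.

Let der_sinh1 (x : R) : is_derive x 1 (@sinh R) (cosh x).
Proof.
have h := derM (derB (der_expR (derI x)) (der_expR (derN (derI x)))) (derC 2^-1 x).
by apply: der_eq h _; rewrite /cosh; ring.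
Qed.

Let cosh_lipb i : lipb A (fun u => cosh (u i 0)).
Proof.
apply: (@lipb_coord _ _ _ (@cosh R) (@sinh R) lo 0 M) => [|u ub|x _|x xb].
- exact: expR_ge0.
- exact: ub.
- exact: der_cosh1.
- by have [] := sinh_cosh_bound xb.
Qed.

Let sinh_lipb i : lipb A (fun u => - sinh (u i 0)).
Proof.
apply: lipbN; apply: (@lipb_coord _ _ _ (@sinh R) (@cosh R) lo 0 M) => [|u ub|x _|x xb].
- exact: expR_ge0.
- exact: ub.
- exact: der_sinh1.
- by have [] := sinh_cosh_bound xb.
Qed.

Let hP_lipb i j (c : R) : lipb A (fun u => hP (cosh (u i 0)) (cosh (u j 0)) c).
Proof.
apply: lipbB; last exact: lipb_const.
apply: lipbD; last exact: lipb_const.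
apply: lipbD; first by apply: lipbD; exact: lipbX.
by apply: lipbM => //; apply: lipbM => //; exact: lipb_const.
Qed.

Let hG_lipb i j k (a b c : R) :
  lipb A (fun u => hG (cosh (u i 0)) (cosh (u j 0)) (cosh (u k 0)) a b c).
Proof.
have c1 (p : 'I_N) (z : R) : lipb A (fun u : 'cV[R]_N => cosh (u p 0) ^+ 2 * z).
  by apply: lipbM; [exact: lipbX|exact: lipb_const].
have c2 (p r : 'I_N) (z : R) :
    lipb A (fun u : 'cV[R]_N => 2 * cosh (u p 0) * cosh (u r 0) * z).
  apply: lipbM; last exact: lipb_const.
  by apply: lipbM => //; apply: lipbM => //; exact: lipb_const.
rewrite /hG; apply: lipbB; last exact: lipb_const.
by do 9?[apply: lipbD => //]; try exact: lipb_const.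
Qed.

Let hQ_lipb i j k (a b c : R) :
  lipb A (fun u => hQ (cosh (u i 0)) (cosh (u j 0)) (cosh (u k 0)) a b c).
Proof.
by apply: lipbD; [apply: lipbD|]; apply: lipbM => //; exact: lipb_const.
Qed.

Let hN_lipb i j k (a b c : R) :
  lipb A (fun u => hN (cosh (u i 0)) (cosh (u j 0)) (cosh (u k 0)) a b c).
Proof.
apply: lipbB; apply: lipbM.
- by apply: lipbD; [exact: lipbM|exact: lipb_const].
- by apply: lipbD; [exact: lipbM|exact: lipb_const].
- by apply: lipbB; [exact: lipbX|exact: lipb_const].
- by apply: lipbD; [exact: lipbM|exact: lipb_const].
Qed.

Let sqrt_hG_lipb i j k (a b c : R) : nondeg a b c ->
  lipb A (fun u => Num.sqrt (hG (cosh (u i 0)) (cosh (u j 0)) (cosh (u k 0)) a b c)).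
Proof.
move=> nd; apply: (lipb_sqrt (nondeg_prod nd)); last exact: hG_lipb.
by move=> u _; apply: hG_ge; rewrite ?cosh_ge1.
Qed.

Let denom_lipb i j k : face T i j k ->
  let a := eta [set j; k]%SET in let b := eta [set i; k]%SET in
  let c := eta [set i; j]%SET in
  lipb A (fun u => (hP (cosh (u i 0)) (cosh (u j 0)) c *
    Num.sqrt (hG (cosh (u i 0)) (cosh (u j 0)) (cosh (u k 0)) a b c))^-1).
Proof.
move=> f a b c; have nd := face_nd f; have [_ _ /andP[hc _] _] := nd.
have c0 : 0 < 1 + c by rewrite -/c in hc; lra.
apply: (@lipbV _ _ _ _ ((1 + c) ^+ 2 * Num.sqrt (2 * ((1 + a) * (1 + b) * (1 + c))))).
- by rewrite mulr_gt0 ?exprn_gt0 // sqrtr_gt0; exact: nondeg_prod.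
- move=> u _; apply: ler_pM; rewrite ?sqr_ge0 ?sqrtr_ge0 //.
    by apply: hP_ge; rewrite ?cosh_ge1.
  rewrite ler_sqrt; first by apply: hG_ge; rewrite ?cosh_ge1.
  by rewrite ltW // hG_gt0 ?cosh_ge1.
- by apply: lipbM; [exact: hP_lipb|exact: sqrt_hG_lipb].
Qed.

Lemma hyp_diag_lipb i j k : face T i j k -> lipb A (fun u => hyp_diag u i j k).
Proof.
move=> f; apply: lipbM; last exact: denom_lipb.
apply: lipbM; first exact: hQ_lipb.
by apply: lipbD; [exact: lipbM|exact: lipb_const].
Qed.

Lemma hyp_offdiag_lipb i j k : face T i j k -> lipb A (fun u => hyp_offdiag u i j k).
Proof.
move=> f; apply: lipbM; last exact: denom_lipb.
by apply: lipbM; [exact: lipbM|exact: hQ_lipb].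
Qed.

Lemma cos_angle_lipb i j k : face T i j k -> lipb A (fun u => cos_angle u i j k).
Proof.
move=> f; have [_ /andP[hb _] /andP[hc _] _] := face_nd f.
have sqP p r c : -1 < c -> lipb A (fun u => Num.sqrt (hP (cosh (u p 0)) (cosh (u r 0)) c)).
  move=> c1; apply: (@lipb_sqrt _ _ _ _ ((1 + c) ^+ 2)); last exact: hP_lipb.
    by rewrite exprn_gt0 //; lra.
  by move=> u _; apply: hP_ge; rewrite ?cosh_ge1.
apply: lipbM; first exact: hN_lipb.
apply: (@lipbV _ _ _ _ (Num.sqrt ((1 + eta [set i; j]%SET) ^+ 2) *
  Num.sqrt ((1 + eta [set i; k]%SET) ^+ 2))).
- by rewrite mulr_gt0 // sqrtr_gt0 exprn_gt0 //; lra.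
- move=> u _; apply: ler_pM; rewrite ?sqrtr_ge0 // ler_sqrt ?hP_ge ?cosh_ge1 //.
    by rewrite ltW // hP_gt0 ?cosh_ge1.
  by rewrite ltW // hP_gt0 ?cosh_ge1.
- by apply: lipbM; exact: sqP.
Qed.

Lemma hyp_weight_gap : exists2 c, 0 < c & forall u i j k, A u -> face T i j k ->
  c * fweight eta i j k <= hyp_diag u i j k - hyp_offdiag u i j k /\
  0 <= hyp_offdiag u i j k.
Proof.
have neg_sinh u i : A u -> 0 <= - sinh (u i 0).
  move=> /(_ i)/andP[_]; rewrite le_eqVlt => /predU1P[->|h].
    by rewrite /sinh oppr0 expR0 subrr mul0r oppr0.
  by rewrite oppr_ge0 ltW // sinh_lt0.
have sq u i : (- sinh (u i 0)) ^+ 2 = cosh (u i 0) ^+ 2 - 1 :> R.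
  by rewrite sqrrN coshE2 addrAC subrr add0r.
have [||c c0 hc] := @finite_common_pos R ('I_N * 'I_N * 'I_N)%type
  (fun p c => forall u, A u -> face T p.1.1 p.1.2 p.2 ->
    c * fweight eta p.1.1 p.1.2 p.2 <=
      hyp_diag u p.1.1 p.1.2 p.2 - hyp_offdiag u p.1.1 p.1.2 p.2).
- move=> [[i j] k] /=; have [f|nf] := boolP (face T i j k); last by exists 1.
  have nd := face_nd f; have [_ _ /andP[hcc _] _] := nd.
  have [|B B0 hB] := @lipb_bound _ _ A (fun u =>
    Num.sqrt (hG (cosh (u i 0)) (cosh (u j 0)) (cosh (u k 0)) 
      (eta [set j; k]%SET) (eta [set i; k]%SET) (eta [set i; j]%SET)) *
    (cosh (u i 0) * cosh (u j 0) + eta [set i; j]%SET + - sinh (u i 0) * - sinh (u j 0))).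
    apply: lipbM; first exact: sqrt_hG_lipb.
    apply: lipbD; last exact: lipbM.
    by apply: lipbD; [exact: lipbM|exact: lipb_const].
  exists B^-1; first by rewrite invr_gt0.
  move=> u ub _; rewrite hVW_gap ?neg_sinh ?sq ?cosh_ge1 //.
  rewrite mulrC; have hb := hB u ub.
  have pos : 0 < cosh (u i 0) * cosh (u j 0) + eta [set i; j]%SET +
      - sinh (u i 0) * - sinh (u j 0).
    have := mulr_ge0 (neg_sinh u i ub) (neg_sinh u j ub).
    have := cosh_ge1 (u i 0); have := cosh_ge1 (u j 0); nra.
  have r0 : 0 < Num.sqrt (hG (cosh (u i 0)) (cosh (u j 0)) (cosh (u k 0)) 
      (eta [set j; k]%SET) (eta [set i; k]%SET) (eta [set i; j]%SET)).
    by rewrite sqrtr_gt0 hG_gt0 ?cosh_ge1.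
  apply: ler_pM.
  + exact: (fweight_ge0 eta_range eta_structure f).
  + by rewrite invr_ge0 ltW.
  + by apply: hQ_ge; rewrite ?cosh_ge1.
  + by rewrite lef_pV2 ?posrE // mulr_gt0.
- move=> [[i j] k] c c' c'0 cc' /= h u ub f; apply: le_trans (h u ub f).
  by rewrite ler_wpM2r // (fweight_ge0 eta_range eta_structure).
exists c => // u i j k ub f; split; first exact: (hc (i, j, k)).
have nd := face_nd f; have [_ _ /andP[hcc _] _] := nd.
rewrite /hyp_offdiag /hW divr_ge0 //.
  rewrite mulr_ge0 //; first by rewrite mulr_ge0 ?neg_sinh.
  apply: le_trans (hQ_ge _ _ _ nd); rewrite ?cosh_ge1 //.
  exact: (fweight_ge0 eta_range eta_structure f).
by rewrite mulr_ge0 ?sqrtr_ge0 // ltW // hP_gt0 ?cosh_ge1.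
Qed.

(** V (p^2 + r^2) - 2 W p r = (V - W) (p^2 + r^2) + W (p - r)^2, with both coefficients nonnegative,
    and every vertex has an edge of positive weight in some face. No kernel has to be removed. *)
Lemma hyp_jacobian_coercive : exists2 lam, 0 < lam & forall u x, A u ->
  lam * dotv x x <= dotv x (hyp_jacobian u *m x).
Proof.
have [c c0 hc] := hyp_weight_gap.
pose w i := \sum_j \sum_(k | face T i j k) fweight eta i j k.
have F0 i j k : face T i j k -> 0 <= fweight eta i j k.
  exact: (fweight_ge0 eta_range eta_structure).
have w0 i : 0 < w i.
  have pos j k : face T i j k -> 0 < fweight eta i j k -> 0 < w i.
    move=> f h; rewrite /w (bigD1 j) //= (bigD1 k) //= -addrA ltr_pwDl // addr_ge0 //.
      by apply: sumr_ge0 => k' /andP[f' _]; exact: F0.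
    by apply: sumr_ge0 => j' _; apply: sumr_ge0 => k'; exact: F0.
  have [j [k f]] := vertex_face T i.
  have [z|z] := eqVneq (fweight eta i j k) 0; last first.
    by apply: (pos j k f); rewrite lt_neqAle eq_sym z F0.
  have [h _] := fweight_eq0 eta_range eta_structure f z.
  by apply: (pos k j) h; rewrite face_swap.
have [||m m0 hm] := @finite_common_pos R 'I_N (fun i m => m <= w i).
- by move=> i; exists (w i).
- by move=> i m m' _ mm' /(le_trans mm').
exists (c * m / 2); first by rewrite divr_gt0 // mulr_gt0.
move=> u x ub; suff : c * (m * dotv x x) <= 2 * dotv x (hyp_jacobian u *m x) by lra.
rewrite assembled_quadratic; last 2 first.
- by move=> i j k _; exact: hyp_diag_sym.
- by move=> i j k _; exact: hyp_offdiag_sym.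
apply: (@le_trans _ _ (\sum_i \sum_j \sum_(k | face T i j k)
   c * fweight eta i j k * x i 0 ^+ 2)).
  rewrite dotvE !mulr_sumr; apply: ler_sum => i _.
  apply: (@le_trans _ _ (c * (w i * x i 0 ^+ 2))).
    by rewrite ler_pM2l // -expr2 ler_wpM2r ?sqr_ge0.
  rewrite /w mulr_suml mulr_sumr; apply: ler_sum => j _.
  rewrite mulr_suml mulr_sumr; apply: ler_sum => k _.
  by rewrite mulrA.
apply: ler_sum => i _; apply: ler_sum => j _; apply: ler_sum => k f.
have [h1 h2] := hc u i j k ub f.
have h3 := ler_wpM2r (sqr_ge0 (x i 0)) h1.
have h4 : 0 <= (hyp_diag u i j k - hyp_offdiag u i j k) * x j 0 ^+ 2.
  by rewrite mulr_ge0 ?sqr_ge0 // (le_trans _ h1) // mulr_ge0 ?F0 // ltW.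
have h5 : 0 <= hyp_offdiag u i j k * (x i 0 - x j 0) ^+ 2.
  by rewrite mulr_ge0 ?sqr_ge0.
move: h3 h4 h5; move: (hyp_diag _ _ _ _) (hyp_offdiag _ _ _ _) (x i 0) (x j 0) => v y p r.
lra.
Qed.

Lemma hyp_uniform_bounds : exists L M lam, [/\ 0 <= L,
  forall u v, A u -> A v ->
    forall i j, `|hyp_jacobian u i j - hyp_jacobian v i j| <= L * `|u - v| &
  forall hi, hi < 0 -> box_bounds (fun x : R => x < 0) 0 hyp_jacobian lo hi L M lam].
Proof.
have [L L0 hL] := assembled_lipschitz hyp_diag_lipb hyp_offdiag_lipb.
have [lam lam0 hlam] := hyp_jacobian_coercive.
exists L, L, lam; split=> // [u v Au Av i j|hi hi0].
  by have [] := hL u v Au Av i j.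
have sub u : in_box lo hi u -> A u.
  by move=> ub i; have /andP[-> h] := ub i; exact: le_trans (ltW hi0).
split => //.
- by move=> u v /sub Au /sub Av i j; have [] := hL u v Au Av i j.
- by move=> u /sub Au i j; have [] := hL u u Au Au i j.
- by move=> u x /sub Au _; exact: hlam.
Qed.

End Box.

Lemma hyp_system :
  curvature_system (fun x : R => x < 0) 0 (hyp_curvature T eta) hyp_jacobian.
Proof.
split.
- by move=> a b a0 /le_lt_trans; apply.
- by move=> a a0; exists (a / 2); lra.
- exact: hyp_curvature_derive.
- move=> u _; apply: assembled_sym => i j k _; exact: hyp_offdiag_sym.
- by move=> u _; rewrite mulmx0.
- move=> lo hi hi0; have [L [M [lam [L0 _ /(_ hi hi0) box]]]] := hyp_uniform_bounds lo.
  by exists L => //; exact: bb_lip box.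
- move=> lo hi hi0; have [L [M [lam [_ _ /(_ hi hi0) box]]]] := hyp_uniform_bounds lo.
  by exists lam; [exact: bb_lam box|exact: bb_coercive box].
Qed.

End HyperbolicSystem.

(** * Repulsion from the hyperbolic boundary *)

Section HyperbolicWall.
Variables (R : realType) (N : nat) (T : triangulation N) (eta : {set 'I_N} -> R).
Hypothesis eta_range : forall p q, [set p; q]%SET \in edges T ->
  -1 < eta [set p; q]%SET <= 1.
Hypothesis eta_structure : structure_condition T eta.
Implicit Types (i j k : 'I_N) (u v : 'cV[R]_N).

Local Notation K := (hyp_curvature T eta).
Local Notation J := (hyp_jacobian T eta).
Local Notation neg := (fun x : R => x < 0).

(** The nearby boundary point. Lipschitz bounds between it and [u] turn exact values on the boundary
    into estimates of order |u_i|. *)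
Definition zero_coord i u : 'cV[R]_N := \col_k (if k == i then 0 else u k 0).

Lemma zero_coord_dist i u : `|u - zero_coord i u| <= `|u i 0|.
Proof.
apply: norm_leP => // k; rewrite !mxE.
by case: eqVneq => [->|_]; rewrite ?subr0 // subrr normr0.
Qed.

Lemma zero_coord_box lo u i : in_box lo 0 u -> in_box lo 0 (zero_coord i u).
Proof.
move=> ub k; rewrite mxE; case: eqP => // _; rewrite lexx andbT.
by have /andP[] := ub i; exact: le_trans.
Qed.

Lemma cosh0 : cosh (0 : R) = 1.
Proof. by rewrite /cosh oppr0 expR0; lra. Qed.

Lemma sinh0 : sinh (0 : R) = 0.
Proof. by rewrite /sinh oppr0 subrr mul0r. Qed.

Lemma hyp_jacobian_offdiag0 u i j : j != i -> J (zero_coord i u) i j = 0.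
Proof.
move=> ji; rewrite mxE eq_sym (negPf ji) mulr0n sub0r big1 ?oppr0 // => k f.
by rewrite /hyp_offdiag /hW mxE eqxx sinh0 oppr0 !mul0r.
Qed.

(** At u_i = 0 the radius is infinite and the vertex ideal. Algebraically, [hP] becomes a perfect
    square and [hN] the product of the two roots. *)
Lemma cos_angle1 u i j k : face T i j k -> cos_angle eta (zero_coord i u) i j k = 1.
Proof.
move=> f; have [e1 e2 e3] := face_edges f.
have /andP[b1 _] := eta_range e2; have /andP[c1 _] := eta_range e1.
rewrite /cos_angle !(mxE, eqxx) cosh0; set y := cosh _; set z := cosh _.
have y1 : 1 <= y by exact: cosh_ge1. have z1 : 1 <= z by exact: cosh_ge1.
move: (eta _) b1 => b b1; move: (eta _) c1 => c c1; move: (eta _) => a.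
have -> : hP 1 y c = (y + c) ^+ 2 by rewrite /hP; ring.
have -> : hP 1 z b = (z + b) ^+ 2 by rewrite /hP; ring.
rewrite !sqrtr_sqr !ger0_norm; [|lra..].
have -> : hN 1 y z a b c = (y + c) * (z + b) by rewrite /hN; ring.
by rewrite divff // mulf_neq0 // gt_eqF //; lra.
Qed.

Lemma hyp_angle_small lo (e : R) : 0 < e -> exists2 del, 0 < del &
  forall u i j k, in_box lo 0 u -> face T i j k -> - del <= u i 0 ->
  acos (cos_angle eta u i j k) <= e.
Proof.
move=> e0; have [r r0 hr] := acos_near1 e0.
have [||del del0 h] := @finite_common_pos R ('I_N * 'I_N * 'I_N)%type (fun p c =>
    forall u, in_box lo 0 u -> face T p.1.1 p.1.2 p.2 -> - c <= u p.1.1 0 ->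
    acos (cos_angle eta u p.1.1 p.1.2 p.2) <= e).
- move=> [[i j] k] /=; have [f|nf] := boolP (face T i j k); last by exists 1.
  have [C C0 hC] := cos_angle_lipb eta_range eta_structure lo f.
  exists (r / (C + 1)); first by rewrite divr_gt0 // ltr_wpDl.
  move=> u ub _; rewrite lerNl ler_pdivlMr ?ltr_wpDl // => ui.
  apply: hr; first exact: cos_angle_le1 eta_range eta_structure _ _ _ _ f.
  have [_] := hC u (zero_coord i u) ub (zero_coord_box i ub).
  rewrite cos_angle1 // distrC => h.
  have /andP[_ u0] := ub i; have := zero_coord_dist i u.
  rewrite (ler0_norm u0) => /(ler_wpM2l C0) h2.
  have := le_trans (ler_norm _) (le_trans h h2); nra.
- move=> [[i j] k] c c' _ cc' /= h u ub f ui; apply: h => //.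
  by apply: le_trans ui; rewrite lerN2.
by exists del => // u i j k ub f; exact: (h (i, j, k)).
Qed.

Let angle_sum u i := \sum_(j < N) \sum_(k < N | (j < k)%N && face T i j k)
  acos (cos_angle eta u i j k).

Let acos_nneg u i j k : face T i j k -> 0 <= acos (cos_angle eta u i j k).
Proof. by move=> f; rewrite acos_ge0 //; exact: (cos_angle_le1 eta_range eta_structure). Qed.

Lemma hyp_angle_sum_gt0 u i : coord_domain neg u -> 0 < angle_sum u i.
Proof.
move=> Du; have [j [k]] := vertex_face T i.
wlog jk : j k / (j < k)%N.
  move=> h f; have [_ _ njk] := face_neq f.
  by have [jk|kj|/val_inj e] := ltngtP j k;
    [exact: (h j k)|apply: (h k j) => //; rewrite face_swap|rewrite e eqxx in njk].
move=> f; rewrite /angle_sum (bigD1 j) //= (bigD1 k) /=; last by rewrite jk.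
rewrite -addrA ltr_pwDl ?addr_ge0 //.
- rewrite acos_gt0 // (cos_angle_lt1 eta_range eta_structure) // andbT.
  by have /andP[] := cos_angle_le1 eta_range eta_structure u f.
- by apply: sumr_ge0 => k' /andP[/andP[_ f'] _]; exact: acos_nneg.
- by apply: sumr_ge0 => j' _; apply: sumr_ge0 => k' /andP[_ f']; exact: acos_nneg.
Qed.

(** The difference of curvatures is the angle sum at [ubar], at least [tau] for every vertex, minus
    the angle sum at [u], which is made at most half of [tau] near the boundary. *)
Lemma hyp_curvature_wall lo ubar : coord_domain neg ubar ->
  exists2 tau, 0 < tau & exists2 del, 0 < del &
  forall u i, in_box lo 0 u -> coord_domain neg u -> - del <= u i 0 ->
  tau <= (K u - K ubar) i 0.
Proof.
move=> Dub; have [||tau tau0 htau] := @finite_common_pos R 'I_N (fun i c => c <= angle_sum ubar i).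
- by move=> i; exists (angle_sum ubar i) => //; exact: hyp_angle_sum_gt0.
- by move=> i c c' _ cc' /(le_trans cc').
pose n : R := N%:R * N%:R.
have n0 : 0 <= n by rewrite mulr_ge0.
(* At most [n] angles meet at a vertex in the double sum; the 1 avoids a zero divisor. *)
have e0 : 0 < tau / (2 * (n + 1)) by rewrite divr_gt0 // mulr_gt0 // ltr_wpDl.
have [del del0 hdel] := hyp_angle_small lo e0.
exists (tau / 2); first by rewrite divr_gt0.
exists del => // u i ub Du ui.
have small : angle_sum u i <= tau / 2.
  apply: (@le_trans _ _ (N%:R * (N%:R * (tau / (2 * (n + 1)))))).
    apply: sum_ord_le => j; rewrite big_mkcond; apply: sum_ord_le => k.
    case: ifP => [/andP[_ f]|_]; last exact: ltW.
    exact: hdel ub f ui.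
  rewrite mulrA -/n mulrA ler_pdivrMr; last by rewrite mulr_gt0 // ltr_wpDl.
  nra.
have E v : coord_domain neg v -> K v i 0 = 2 * pi - angle_sum v i.
  by move=> Dv; rewrite (hyp_curvatureE eta_range eta_structure).
have gap (x y : 'cV[R]_N) : x i 0 = 2 * pi - angle_sum u i ->
    y i 0 = 2 * pi - angle_sum ubar i -> tau / 2 <= (x - y) i 0.
  have := htau i; rewrite !mxE; move: (angle_sum _ _) (angle_sum _ _) small.
  by move=> a b *; lra.
exact: gap (E u Du) (E ubar Dub).
Qed.

(** At u_i = -m the diagonal term of the field is at least [c * lam * tau] in size, while the others
    add up to at most [Z * m], and neither [Z] nor the first bound depends on m. *)
Lemma hyp_wall ubar s lo (h1 h0 : R) : coord_domain neg ubar -> h1 < 0 ->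
  exists hi, [/\ hi < 0, h1 <= hi & h0 < hi \/ forall u, in_box lo hi u ->
    forall i, u i 0 = hi -> flow_field K J ubar s u i 0 < 0].
Proof.
move=> Dub h10.
have [l [h [hneg _ _ ubb]]] := @point_hull R N neg h1 h10 ubar Dub.
pose lo1 := Num.min lo l.
have [L [M [lam [L0 hL box]]]] := hyp_uniform_bounds eta_range eta_structure lo1.
have lam0 : 0 < lam by exact: (bb_lam (box _ hneg)).
have [c c0 hc] := @spectral_power_ge R N lam (N%:R * (N%:R * M)) s lam0.
have [Ko Ko0 hKo] := @spectral_power_offdiag R N lam (N%:R * (N%:R * M)) s lam0.
have [tau tau0 [del del0 hdel]] := hyp_curvature_wall lo1 Dub.
(* Two points with coordinates in [[lo1], 0] differ by at most |lo1|, which bounds the curvature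
   difference independently of m. *)
pose B := `|N%:R * M * lo1|.
pose Z := N%:R * (Ko * L * B).
have Z0 : 0 <= Z by rewrite mulr_ge0 // mulr_ge0 ?normr_ge0 // mulr_ge0.
have cl0 : 0 < c * lam * tau by rewrite !mulr_gt0.
have r0 : 0 < c * lam * tau / (Z + 1) by rewrite divr_gt0 // ltr_wpDl.
(* In this order: the face lies above [h1], above the coordinates of [ubar], within the range where
   the angles are small, and where the diagonal term wins. *)
pose m := Num.min (Num.min (- h1) (- h)) (Num.min del (c * lam * tau / (Z + 1))).
have m0 : 0 < m by rewrite !lt_min !oppr_gt0 h10 hneg del0.
have : m <= m by []. rewrite {2}/m !le_min => /andP[/andP[m1 m2] /andP[m3 m4]].
exists (- m); split; [by rewrite oppr_lt0|by rewrite lerNr|right => u ub i ui].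
have hi0 : - m < 0 by rewrite oppr_lt0.
have bx := box _ hi0.
have ub1 : in_box lo1 (- m) u by apply: in_box_weaken ub => //; rewrite ge_min lexx.
have ubb1 : in_box lo1 (- m) ubar.
  by apply: in_box_weaken ubb; rewrite ?ge_min ?lexx ?orbT // lerNr.
have ub0 : in_box lo1 0 u by apply: in_box_weaken ub1 => //; exact: ltW.
have sys := hyp_system eta_range eta_structure.
have Du : coord_domain neg u by exact: in_box_domain sys _ _ _ hi0 ub1.
have gap := J_gapped sys bx ub1.
pose F := K u - K ubar.
have Fi : tau <= F i 0 by apply: hdel => //; rewrite ui lerN2.
have Fj j : `|F j 0| <= B.
  apply: le_trans (norm_coord _ _) _.
  apply: (le_trans (K_lipschitz sys bx ubb1 ub1)); rewrite /B normrM.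
  rewrite (le_trans (ler_norm _)) // normrM ler_wpM2l // normr_id.
  apply: norm_leP => // j'; rewrite !mxE.
  have /andP[a1 a2] := ub1 j'; have /andP[b1 b2] := ubb1 j'.
  have lo10 : lo1 <= 0 by lra.
  by rewrite (ler0_norm lo10) ler_norml; apply/andP; split; lra.
set S := spectral_power s (J u).
(* A diagonal entry is the quadratic form at a basis vector, so coercivity of [J] and the comparison
   of powers bound it below. *)
have Sii : c * lam <= S i i.
  have := hc _ (delta_mx i 0) gap; rewrite -/S.
  have E (A : 'M[R]_N) : dotv (delta_mx i 0) (A *m delta_mx i 0) = A i i.
    rewrite -colE dotvE (bigD1 i) //= !mxE !eqxx mul1r big1 ?addr0 // => j ji.
    by rewrite mxE (negPf ji) mul0r.
  rewrite !E; apply: le_trans; rewrite ler_pM2l //.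
  have := bb_coercive bx ub1 (x := delta_mx i 0); rewrite E => /(_ _).
  have -> : dotv (0 : 'cV[R]_N) (delta_mx i 0) = 0.
    by rewrite dotvE big1 // => j _; rewrite mxE mul0r.
  move=> /(_ erefl); apply: le_trans.
  rewrite dotvE (bigD1 i) //= mxE !eqxx mulr1 ler_peMr ?(ltW lam0) // lerDl.
  by apply: sumr_ge0 => j _; rewrite -expr2 sqr_ge0.
have Jij j : j != i -> `|J u i j| <= L * m.
  move=> ji; have := hL u (zero_coord i u) ub0 (zero_coord_box i ub0) i j.
  rewrite hyp_jacobian_offdiag0 // subr0 => /le_trans; apply.
  apply: ler_wpM2l => //; apply: le_trans (zero_coord_dist i u) _.
  by rewrite ui normrN gtr0_norm.
have Sij := hKo _ _ _ gap Jij; rewrite -/S in Sij.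
have off : `|\sum_(j | j != i) S i j * F j 0| <= Z * m.
  apply: le_trans (ler_norm_sum _ _ _) _; rewrite big_mkcond /Z -mulrA.
  apply: sum_ord_le => j; case: ifP => ji; last first.
    by apply: mulr_ge0 (ltW m0); rewrite mulr_ge0 ?normr_ge0 // mulr_ge0.
  have -> : Ko * L * B * m = Ko * (L * m) * B by ring.
  rewrite normrM.
  by apply: ler_pM => //; exact: Sij.
have Zm : Z * m < c * lam * tau.
  rewrite ler_pdivlMr ?ltr_wpDl // in m4; lra.
have main : c * lam * tau <= S i i * F i 0.
  by apply: ler_pM => //; rewrite ?mulr_ge0 // ltW.
rewrite /flow_field -/F -/S mxE oppr_lt0 mxE (bigD1 i) //=.
by move: off; rewrite ler_norml => /andP[]; lra.
Qed.

End HyperbolicWall.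

(** The middle clause makes [u] the solution: any solution on a half-open interval is a restriction
    of it. The norm is the maximum of the coordinates, equivalent to any other. *)
Theorem theorem1p2 (R : realType) (N : nat) (T : triangulation N)
    (eta : {set 'I_N} -> R)
    (eta_range : forall p q, [set p; q]%SET \in edges T ->
       -1 < eta [set p; q]%SET <= 1)
    (eta_structure : structure_condition T eta) :
  (forall ubar Kbar : 'cV[R]_N, Kbar = eucl_curvature T eta ubar ->
   forall (s : R) (u0 : 'cV[R]_N), \sum_i u0 i 0 = \sum_i ubar i 0 ->
   exists u : R -> 'cV[R]_N,
     [/\ calabi_flow (eucl_curvature T eta) setT s Kbar u0 `[0, +oo[ u,
         forall (b : R) (v : R -> 'cV[R]_N),
           calabi_flow (eucl_curvature T eta) setT s Kbar u0 `[0, b[ v ->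
           forall t, 0 <= t < b -> v t = u t
       & exists C c : R, [/\ 0 < C, 0 < c &
           forall t, 0 <= t -> `|u t - ubar| <= C * expR (- c * t)]]) /\
  (forall ubar Kbar : 'cV[R]_N, hyp_domain ubar ->
   Kbar = hyp_curvature T eta ubar ->
   forall (s : R) (u0 : 'cV[R]_N), hyp_domain u0 ->
   exists u : R -> 'cV[R]_N,
     [/\ calabi_flow (hyp_curvature T eta) (@hyp_domain R N) s Kbar u0
           `[0, +oo[ u,
         forall (b : R) (v : R -> 'cV[R]_N),
           calabi_flow (hyp_curvature T eta) (@hyp_domain R N) s Kbar u0
             `[0, b[ v ->
           forall t, 0 <= t < b -> v t = u t
       & exists C c : R, [/\ 0 < C, 0 < c &
           forall t, 0 <= t -> `|u t - ubar| <= C * expR (- c * t)]]).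
Proof.
split=> [ubar Kbar -> s u0 sum0|ubar Kbar Dub -> s u0 Du0].
  have sys := eucl_system eta_range eta_structure.
  have DT : coord_domain (fun=> True) = setT :> set 'cV[R]_N.
    by apply/seteqP; split.
  rewrite -DT; apply: (curvature_flow sys (a0 := 0)) => //.
    (* Orthogonality to the constant vector is the equality of the two sums. *)
    rewrite dotvE (eq_bigr (fun i => u0 i 0 - ubar i 0)) => [|i _].
      by rewrite sumrB sum0 subrr.
    by rewrite !mxE mul1r.
  (* The Euclidean domain has no boundary, so the upper face is placed out of reach. *)
  move=> lo h1 h0 _; exists (Num.max h1 (h0 + 1)); split=> //.
    by rewrite le_max lexx.
  by left; rewrite lt_max ltrDl ltr01 orbT.
have sys := hyp_system eta_range eta_structure.
apply: (curvature_flow sys (a0 := -1)) => //.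
- by rewrite dotvE big1 // => i _; rewrite mxE mul0r.
- by move=> lo h1 h0 h10; exact: hyp_wall.
Qed.
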